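(* Let $L$ be a countable metric signature, let $\cong$ denote the isomorphism equivalence relation on the space $\mathcal M(L)$ of separable $L$-structures, let $X\subseteq\mathcal M(L)$ be an $\cong$-invariant Borel set, and let $\Omega$ be a universal weak modulus for $L$. Then the following are equivalent: (i) $\cong|_X$ is Borel (as a subset of $X\times X$); (ii) the supremum of the $\Omega$-Scott ranks of the elements of $X$ is bounded below $\omega_1$, i.e. there is $\beta<\omega_1$ such that $\alpha_A\le\beta$ for all $A\in X$.
   Context: Moduli. For $n\in\mathbb N$ or $n=\mathbb N$, an $n$-ary modulus is a continuous function $\Delta:[0,\infty)^n\to[0,\infty)$ with $\Delta(0)=0$ and $\Delta(\delta)\le\Delta(\delta+\delta')\le\Delta(\delta)+\Delta(\delta')$. A weak modulus is a function $\Omega:[0,\infty)^{\mathbb N}\to[0,\infty]$ with $\Omega(0)=0$ and $\Omega(\delta)\le\Omega(\delta+\delta')\le\Omega(\delta)+\Omega(\delta')$ that is lower semicontinuous for the product topology and separately continuous in each argument; put $\Omega|_n(\delta_0,\dots,\delta_{n-1})=\Omega(\delta_0,\dots,\delta_{n-1},0,0,\dots)$. $\Omega$ is shift-increasing if for all $i_0<i_1<\cdots$ and all $\delta$, $\Omega(\delta)\le\Omega(\delta')$, where $\delta'_{i_p}=\delta_p$ and $\delta'_k=0$ for $k\notin\{i_0,i_1,\dots\}$. A map $f$ from a product of metric spaces $\prod_{i<n}X_i$ to a metric space respects $\Delta$ if $d(f(x),f(y))\le\Delta((d(x_i,y_i))_{i<n})$ for all $x,y$. Signatures and structures. A metric signature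 $L$ is a set of function and predicate symbols; each symbol $s$ has an arity $n_s$ and an $n_s$-ary modulus $\Delta_s$, and each predicate symbol $P$ also has a compact interval $I_P\subseteq\mathbb R$ (its bound). $L$ always contains a binary predicate symbol $d$ with $\Delta_d(\delta_1,\delta_2)=\delta_1+\delta_2$ and some bound. An $L$-structure $A$ is a complete metric space with maps $F^A:A^{n_F}\to A$ respecting $\Delta_F$ and functions $P^A:A^{n_P}\to I_P$ respecting $\Delta_P$, where $d$ is interpreted as the distance. Isomorphisms are bijections preserving all symbols (including $d$). Basic formulas. Variables are $x_0,x_1,\dots$. $\Delta_{x_i}(\delta)=\delta_i$; $\Delta_{F(\bar\tau)}=\Delta_F\circ(\Delta_{\tau_i})_i$ for terms; an atomic formula $P(\bar\tau)$ has modulus $\Delta_P\circ(\Delta_{\tau_i})_i$ and bound $I_P$. A basic formula is $\phi=f(\phi_0,\dots,\phi_{m-1})$ with $\phi_i$ atomic and $f:\prod_i I_{\phi_i}\to\mathbb R$ continuous; its modulus is $\Delta_\phi=\Delta_f\circ(\Delta_{\phi_i})_i$, where $\Delta_f(\delta)=\sup\{|f(x)-f(y)|:|x_i-y_i|\le\delta_i\}$. $\phi^A$ is the interpretation of $\phi$ in $A$. Universal weak modulus for $L$: a weak modulus $\Omega$ such that (1) for every atomic formula $\phi(x_0,\dots,x_{k-1})$ there is $n$ with $\Delta_\phi(\delta_0,\dots,\delta_{k-1})\le\Omega|_n(0,\dots,0,\delta_0,\dots,\delta_{k-1})$; (2) for all $k\in\mathbb N$, $M>0$ there is $n$ with $M\cdot\Omega|_k(\delta_0,\dots,\delta_{k-1})\le\Omega|_n(0,\dots,0,\delta_0,\dots,\delta_{k-1})$;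 (3) $\Omega|_k(\delta_0,\dots,\delta_{k-1})+\Omega|_n(\gamma_0,\dots,\gamma_{n-1})\le\Omega|_{k+n}(\delta_0,\dots,\delta_{k-1},\gamma_0,\dots,\gamma_{n-1})$ for all $k,n$; (4) $\Omega$ is shift-increasing. Back-and-forth pseudo-distances (with respect to $\Omega$), with values in $[0,\infty]$, for $L$-structures $A,B$, $\bar a\in A^n,\bar b\in B^n$: $r_0(A\bar a,B\bar b)=\sup_\phi|\phi^A(\bar a)-\phi^B(\bar b)|$ over all basic formulas $\phi(x_0,\dots,x_{n-1})$ with $\Delta_\phi\le\Omega|_n$; $r_\alpha=\sup_{\beta<\alpha}r_\beta$ for $\alpha$ limit; $r_{\alpha+1}(A\bar a,B\bar b)=\sup_{c\in A,d\in B}\inf_{c'\in A,d'\in B}\max\bigl(r_\alpha(A\bar ac,B\bar bd'),r_\alpha(A\bar ac',B\bar bd)\bigr)$. The ($\Omega$-)Scott rank $\alpha_A$ is the least ordinal $\alpha$ with $r_\alpha(A\bar a,A\bar b)=r_{\alpha+1}(A\bar a,A\bar b)$ for all $n$ and $\bar a,\bar b\in A^n$. The space $\mathcal M(L)$ ($L$ countable). Replace each $n$-ary function symbol $F$ by an $(n+1)$-ary predicate $D_F(\bar x,y)=d(F(\bar x),y)$ with modulus $\Delta_F(\delta)+\delta'$ and the bound of $d$, and enumerate the resulting predicates as $d=P_0,P_1,\dots$ with arities $n_0,n_1,\dots$. A sequence $(a_i)_{i\in\mathbb N}$ in $A$ is tail-dense if $\{a_i:i>k\}$ is dense in $A$ for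 every $k$. $\mathcal M(L)$ is the set of $p\in\prod_i\mathbb R^{\mathbb N^{n_i}}$ for which there are a separable $L$-structure $A$ and a tail-dense sequence $(a_i)$ in $A$ with $p(i)(j_0,\dots,j_{n_i-1})=P_i^A(a_{j_0},\dots,a_{j_{n_i-1}})$. With the product topology it is a Polish space. An element is identified with the corresponding structure; $\cong$ on $\mathcal M(L)$ is isomorphism of these structures. *)

(* Defs.v *)
From HB Require Import structures.
From mathcomp Require Import all_boot all_order all_algebra.
From mathcomp Require Import all_classical all_reals all_analysis.
Import numFieldNormedType.Exports.

Set Implicit Arguments.
Unset Strict Implicit.
Unset Printing Implicit Defensive.

Import Order.TTheory GRing.Theory Num.Theory.
Local Open Scope classical_set_scope.
Local Open Scope ring_scope.

(* A function on [0, oo)^I (resp. on a product of intervals) is represented by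
   a total function on I -> R of which only the restriction to the nonnegative
   families (resp. to the box) is ever used: every axiom and every inequality
   below is guarded accordingly. *)

Definition nonneg {R : realType} {I : Type} : set (I -> R) :=
  [set delta | forall i, 0 <= delta i].

Definition snoc {T : Type} {n : nat} (a : 'I_n -> T) (c : T) : 'I_n.+1 -> T :=
  fun i => if unlift ord_max i is Some j then a j else c.

Definition concat {T : Type} {k n : nat} (a : 'I_k -> T) (b : 'I_n -> T) :
    'I_(k + n) -> T :=
  fun i => match fintype.split i with inl j => a j | inr j => b j end.

(* (delta_0, ..., delta_{n-1}, 0, 0, ...) *)
Definition zpad {R : realType} {n : nat} (delta : 'I_n -> R) : nat -> R :=
  fun j => if insub j is Some i then delta i else 0.

(* (0, ..., 0, delta_0, ..., delta_{k-1}), with m zeros. *)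
Definition zeros_before {R : realType} (m : nat) {k : nat} (delta : 'I_k -> R) :
    'I_(m + k) -> R :=
  concat (fun=> 0) delta.
Arguments zeros_before {R} m {k}.

(* The supremum computed in [0, oo], so that the supremum of set0 is 0. *)
Definition esup0 {R : realType} (S : set (\bar R)) : \bar R :=
  ereal_sup (0%E |` S).

Record modulus (R : realType) (n : nat) := Modulus {
  modulus_fun :> ('I_n -> R) -> R ;
  modulus_ge0 : forall delta, nonneg delta -> 0 <= modulus_fun delta ;
  modulus_cont :
    {within (nonneg : set {ptws 'I_n -> R}), continuous
      (modulus_fun : {ptws 'I_n -> R} -> R)} ;
  modulus0 : modulus_fun (fun=> 0) = 0 ;
  modulus_le : forall delta delta', nonneg delta -> nonneg delta' ->
    modulus_fun delta <= modulus_fun (delta \+ delta') ;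
  modulus_subadd : forall delta delta', nonneg delta -> nonneg delta' ->
    modulus_fun (delta \+ delta') <= modulus_fun delta + modulus_fun delta'
}.

(* Lower semicontinuity is that of the restriction to [0, oo)^nat: in
   subspace nonneg the points outside nonneg are isolated. *)
Record weak_modulus (R : realType) (Omega : (nat -> R) -> \bar R) : Prop := {
  weak_modulus_ge0 : forall delta, nonneg delta -> (0 <= Omega delta)%E ;
  weak_modulus0 : Omega (fun=> 0) = 0%E ;
  weak_modulus_le : forall delta delta', nonneg delta -> nonneg delta' ->
    (Omega delta <= Omega (delta \+ delta')%R)%E ;
  weak_modulus_subadd : forall delta delta', nonneg delta -> nonneg delta' ->
    (Omega (delta \+ delta')%R <= Omega delta + Omega delta')%E ;
  weak_modulus_lsc :
    lower_semicontinuous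
      (Omega : subspace (nonneg : set {ptws nat -> R}) -> \bar R) ;
  weak_modulus_sep_cont : forall (i : nat) (delta : nat -> R), nonneg delta ->
    {within [set t : R | 0 <= t], continuous
      (fun t : R => Omega (dfwith delta i t))}
}.

Definition weak_restr {R : realType} (Omega : (nat -> R) -> \bar R) (n : nat)
    (delta : 'I_n -> R) : \bar R :=
  Omega (zpad delta).

Definition shift_increasing {R : realType} (Omega : (nat -> R) -> \bar R) :=
  forall i : nat -> nat, {homo i : p q / (p < q)%N} ->
  forall delta delta' : nat -> R, nonneg delta ->
    (forall p, delta' (i p) = delta p) ->
    (forall k, (forall p, i p <> k) -> delta' k = 0) ->
    (Omega delta <= Omega delta')%E.

(* The distinguished predicate d is not listed in other_psym: the predicate
   symbols of the signature are psym L := option (other_psym L), with None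
   standing for d. *)
Record signature (R : realType) := Signature {
  fsym : Type ;
  other_psym : Type ;
  farity : fsym -> nat ;
  other_parity : other_psym -> nat ;
  fmodulus : forall F : fsym, modulus R (farity F) ;
  other_pmodulus : forall P : other_psym, modulus R (other_parity P) ;
  other_lo : other_psym -> R ;
  other_hi : other_psym -> R ;
  other_lo_le_hi : forall P, other_lo P <= other_hi P ;
  d_lo : R ;
  d_hi : R ;
  d_lo_le_hi : d_lo <= d_hi
}.

Definition countable_signature (R : realType) (L : signature R) :=
  countable [set: fsym L] /\ countable [set: other_psym L].

Definition d_modulus_fun (R : realType) (delta : 'I_2 -> R) : R :=
  delta ord0 + delta ord_max.

Lemma d_modulus_cont (R : realType) :
  {within (nonneg : set {ptws 'I_2 -> R}), continuous
    (@d_modulus_fun R : {ptws 'I_2 -> R} -> R)}.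
Proof.
apply: continuous_subspaceT => x.
have pc i : {for x, continuous (fun f : {ptws 'I_2 -> R} => f i : R)}.
  exact: (@proj_continuous 'I_2 (fun=> R) i x).
exact: (@cvgD _ _ _ _ _ _ _ _ _ (pc ord0) (pc ord_max)).
Qed.

Definition d_modulus (R : realType) : modulus R 2.
Proof.
refine (@Modulus R 2 (@d_modulus_fun R) _ (@d_modulus_cont R) _ _ _).
- by move=> delta d0; rewrite addr_ge0.
- by rewrite /d_modulus_fun addr0.
- by move=> e e' e0 e0'; rewrite /d_modulus_fun lerD// lerDl.
- by move=> e e' e0 e0'; rewrite /d_modulus_fun addrACA.
Defined.

Section syntax.
Context {R : realType} (L : signature R).

Definition psym : Type := option (other_psym L).

Definition parity (P : psym) : nat :=
  if P is Some Q then other_parity Q else 2.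

Definition pmodulus (P : psym) : modulus R (parity P) :=
  match P return modulus R (parity P) with
  | Some Q => other_pmodulus Q
  | None => d_modulus R
  end.

Definition bound (P : psym) : set R :=
  if P is Some Q then `[other_lo Q, other_hi Q] else `[d_lo L, d_hi L].

(* Terms and formulas in the variables x_0, ..., x_{n-1}. *)
Inductive term (n : nat) : Type :=
| Var of 'I_n
| App (F : fsym L) of ('I_(farity F) -> term n).

Record atomic (n : nat) := Atomic {
  atomic_sym : psym ;
  atomic_args : 'I_(parity atomic_sym) -> term n
}.

Definition atomic_bound (n : nat) (phi : atomic n) : set R :=
  bound (atomic_sym phi).

Fixpoint term_modulus (n : nat) (t : term n) (delta : 'I_n -> R) : R :=
  match t with
  | Var i => delta i
  | App F ts => fmodulus F (fun i => term_modulus (ts i) delta)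
  end.

Definition atomic_modulus (n : nat) (phi : atomic n) (delta : 'I_n -> R) : R :=
  pmodulus (atomic_sym phi) (fun i => term_modulus (atomic_args i) delta).

Definition box (n m : nat) (phi : 'I_m -> atomic n) : set ('I_m -> R) :=
  [set x | forall i, atomic_bound (phi i) (x i)].

Record basic (n : nat) := Basic {
  basic_size : nat ;
  basic_atoms : 'I_basic_size -> atomic n ;
  basic_fun : ('I_basic_size -> R) -> R ;
  basic_cont :
    {within (box basic_atoms : set {ptws 'I_basic_size -> R}), continuous
      (basic_fun : {ptws 'I_basic_size -> R} -> R)}
}.

(* The least modulus of continuity of the connective f on the box. *)
Definition connective_modulus (n m : nat) (phi : 'I_m -> atomic n)
    (f : ('I_m -> R) -> R) (delta : 'I_m -> R) : \bar R :=
  ereal_sup [set e | exists x y, [/\ box phi x, box phi y,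
    (forall i, `|x i - y i| <= delta i) & e = (`|f x - f y|)%:E]].

Definition basic_modulus (n : nat) (phi : basic n) (delta : 'I_n -> R) : \bar R :=
  connective_modulus (@basic_atoms n phi) (@basic_fun n phi)
    (fun i => atomic_modulus (basic_atoms i) delta).

Record universal_weak_modulus (Omega : (nat -> R) -> \bar R) : Prop := {
  universal_weak : weak_modulus Omega ;
  universal_atomic : forall (k : nat) (phi : atomic k), exists m : nat,
    forall delta : 'I_k -> R, nonneg delta ->
      ((atomic_modulus phi delta)%:E
         <= weak_restr Omega (zeros_before m delta))%E ;
  universal_scale : forall (k : nat) (M : R), 0 < M -> exists m : nat,
    forall delta : 'I_k -> R, nonneg delta ->
      (M%:E * weak_restr Omega delta
         <= weak_restr Omega (zeros_before m delta))%E ;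
  universal_concat : forall (k n : nat) (delta : 'I_k -> R) (gamma : 'I_n -> R),
    nonneg delta -> nonneg gamma ->
      (weak_restr Omega delta + weak_restr Omega gamma
         <= weak_restr Omega (concat delta gamma))%E ;
  universal_shift : shift_increasing Omega
}.

Record structure := Structure {
  carrier :> metricType R ;
  structure_complete :
    forall G : set_system carrier, ProperFilter G -> cauchy G ->
      exists x : carrier, G --> x ;
  fint : forall F : fsym L, ('I_(farity F) -> carrier) -> carrier ;
  other_pint :
    forall P : other_psym L, ('I_(other_parity P) -> carrier) -> R ;
  fint_respects : forall F (x y : 'I_(farity F) -> carrier),
    mdist (fint x) (fint y) <= fmodulus F (fun i => mdist (x i) (y i)) ;
  other_pint_respects : forall P (x y : 'I_(other_parity P) -> carrier),
    `|other_pint x - other_pint y|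
      <= other_pmodulus P (fun i => mdist (x i) (y i)) ;
  other_pint_bound : forall P (x : 'I_(other_parity P) -> carrier),
    other_lo P <= other_pint x <= other_hi P ;
  mdist_bound : forall x y : carrier, d_lo L <= mdist x y <= d_hi L
}.

Definition pint (A : structure) (P : psym) : ('I_(parity P) -> A) -> R :=
  match P return ('I_(parity P) -> A) -> R with
  | Some Q => fun x => other_pint x
  | None => fun x => mdist (x ord0) (x ord_max)
  end.

Definition isomorphic (A B : structure) : Prop :=
  exists f : A -> B, [/\ bijective f,
    (forall F (x : 'I_(farity F) -> A), f (fint x) = fint (f \o x)) &
    (forall P (x : 'I_(parity P) -> A), @pint A P x = @pint B P (f \o x))].

Fixpoint term_eval (A : structure) (n : nat) (a : 'I_n -> A) (t : term n) : A :=
  match t with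
  | Var i => a i
  | App F ts => fint (fun i => term_eval a (ts i))
  end.

Definition atomic_eval (A : structure) (n : nat) (phi : atomic n)
    (a : 'I_n -> A) : R :=
  @pint A (atomic_sym phi) (fun i => term_eval a (atomic_args i)).

Definition basic_eval (A : structure) (n : nat) (phi : basic n)
    (a : 'I_n -> A) : R :=
  basic_fun (fun i => atomic_eval (@basic_atoms n phi i) a).

End syntax.

(* An ordinal is represented by a point w of a well-ordered type W, namely the
   order type of [set v | v < w]; all ordinals (of types in the universe) arise
   in this way. *)
Record wellOrder := WellOrder {
  wo_disp : Order.disp_t ;
  wo_sort :> orderType wo_disp ;
  wo_wf : well_founded (fun v w : wo_sort => (v < w)%O)
}.

Definition is_succ (W : wellOrder) (v w : W) : Prop :=
  (v < w)%O /\ forall u : W, (u < w)%O -> (u <= v)%O.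

Definition countable_ordinal (W : wellOrder) (w : W) : Prop :=
  countable [set v : W | (v < w)%O].

Section back_and_forth.
Context {R : realType} {L : signature R} (Omega : (nat -> R) -> \bar R).

Definition tuple_dist (A B : structure L) : Type :=
  forall n : nat, ('I_n -> A) -> ('I_n -> B) -> \bar R.

Definition bf_zero (A B : structure L) : tuple_dist A B := fun n a b =>
  esup0 [set (`|basic_eval phi a - basic_eval phi b|)%:E | phi in
    [set phi : basic L n | forall delta, nonneg delta ->
      (basic_modulus phi delta <= weak_restr Omega delta)%E]].

Definition bf_step (A B : structure L) (r : tuple_dist A B) : tuple_dist A B :=
  fun n a b =>
  esup0 [set ereal_inf [set maxe (r n.+1 (snoc a c) (snoc b d'))
                                 (r n.+1 (snoc a c') (snoc b d))
                       | c' in [set: A] & d' in [set: B]]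
        | c in [set: A] & d in [set: B]].

Definition bf_rec (A B : structure L) (W : wellOrder) (w : W)
    (r : forall v : W, (v < w)%O -> tuple_dist A B) : tuple_dist A B :=
  match pselect (exists v, is_succ v w) with
  | left h => let: exist v vw := cid h in bf_step (r v vw.1)
  | right _ =>
    if pselect (exists v : W, (v < w)%O) then
      fun n a b => esup0 [set e | exists v (vw : (v < w)%O), e = r v vw n a b]
    else @bf_zero A B
  end.

(* bf w n a b is r_alpha(A a, B b) for alpha the order type of [set v | v < w];
   lemmas bf0, bfS, bf_lim are its defining equations. *)
Definition bf (A B : structure L) (W : wellOrder) : W -> tuple_dist A B :=
  Fix (@wo_wf W) (fun=> tuple_dist A B) (@bf_rec A B W).

Lemma bfE (A B : structure L) (W : wellOrder) (w : W) :
  bf w = bf_rec (fun v (_ : (v < w)%O) => @bf A B W v).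
Proof.
rewrite {1}/bf Fix_eq// => {}w f g fg; congr bf_rec.
apply: functional_extensionality_dep => v.
by apply: functional_extensionality_dep => vw; exact: fg.
Qed.

Lemma bf0 (A B : structure L) (W : wellOrder) (w : W) :
  (forall v : W, ~ (v < w)%O) -> bf w = @bf_zero A B.
Proof.
move=> w0; rewrite bfE /bf_rec; case: pselect => [h|_].
  by exfalso; case: h => v [vw _]; case: (w0 v).
by case: pselect => // h; exfalso; case: h => v; exact: w0.
Qed.

Lemma bfS (A B : structure L) (W : wellOrder) (v w : W) :
  is_succ v w -> bf w = bf_step (@bf A B W v).
Proof.
move=> vw; rewrite bfE /bf_rec; case: pselect => [h|]; last by case; exists v.
case: (cid h) => u [uw uP]; congr (bf_step (bf _)); apply: le_anti.
by rewrite uP ?vw.1//= vw.2.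
Qed.

Lemma bf_lim (A B : structure L) (W : wellOrder) (w : W) :
  (exists v : W, (v < w)%O) -> (forall v, ~ is_succ v w) ->
  forall n a b,
  bf w a b = esup0 [set @bf A B W v n a b | v in [set v : W | (v < w)%O]].
Proof.
move=> w0 wlim n a b; rewrite bfE /bf_rec; case: pselect => [h|_].
  by exfalso; case: h => v vw; case: (wlim v).
case: pselect => //= _; congr esup0; apply/seteqP; split=> [e [v [vw ->]]|e [v vw <-]].
  by exists v.
by exists v, vw.
Qed.

(* r_{alpha+1} is written bf_step (bf alpha), so that alpha need not have a
   successor in W. *)
Definition bf_stable (A : structure L) (W : wellOrder) (alpha : W) : Prop :=
  forall n (a b : 'I_n -> A), bf alpha a b = bf_step (bf alpha) a b.

Definition is_scott_rank (A : structure L) (W : wellOrder) (alpha : W) : Prop :=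
  bf_stable A alpha /\ forall gamma : W, bf_stable A gamma -> (alpha <= gamma)%O.

End back_and_forth.

Section space_of_structures.
Context {R : realType} (L : signature R).

(* The symbols of the relational signature: those of L and the D_F. They index
   the product directly instead of through an enumeration P_0, P_1, ... *)
Definition rsym : Type := (psym L + fsym L)%type.

Definition rarity (s : rsym) : nat :=
  match s with inl P => parity P | inr F => (farity F).+1 end.

Definition code_space : topologicalType :=
  prod_topology (fun s : rsym => {ptws ('I_(rarity s) -> nat) -> R}).

Definition code_of (A : structure L) (a : nat -> A) : code_space := fun s =>
  match s return ('I_(rarity s) -> nat) -> R with
  | inl P => fun j => @pint R L A P (a \o j)
  | inr F => fun j =>
      mdist (fint (fun i : 'I_(farity F) => a (j (widen_ord (leqnSn _) i))))
            (a (j ord_max))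
  end.

Definition separable (T : topologicalType) : Prop :=
  exists2 D : set T, countable D & dense D.

Definition tail_dense (T : topologicalType) (a : nat -> T) : Prop :=
  forall k : nat, dense (a @` [set i | (k < i)%N]).

Definition codes (p : code_space) (A : structure L) (a : nat -> A) : Prop :=
  [/\ separable A, tail_dense a & p = code_of a].

Definition structure_space : set code_space :=
  [set p | exists A a, @codes p A a].

(* The structure coded by p is only determined up to isomorphism, so the
   relation does not depend on the choice of A and B. *)
Definition code_iso (p q : code_space) : Prop :=
  exists A a B b, [/\ @codes p A a, @codes q B b & isomorphic A B].

Definition iso_invariant (X : set code_space) : Prop :=
  forall p q, X p -> structure_space q -> code_iso p q -> X q.

Definition iso_on (X : set code_space) : set (code_space * code_space)%type :=
  [set pq | [/\ X pq.1, X pq.2 & code_iso pq.1 pq.2]].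

End space_of_structures.
Arguments structure_space {R} L.

(* The Borel sigma-algebra of Y, with the topology induced by T. *)
Definition borel_in (T : topologicalType) (Y : set T) : set (set T) :=
  <<s Y, [set Y `&` U | U in [set U : set T | open U]] >>.

Definition scott_ranks_bounded (R : realType) (L : signature R)
    (Omega : (nat -> R) -> \bar R) (X : set (code_space L)) : Prop :=
  exists (W : wellOrder) (beta : W), countable_ordinal beta /\
    forall p, X p -> forall (A : structure L) (a : nat -> A), codes p a ->
      exists2 alpha : W, is_scott_rank Omega A alpha & (alpha <= beta)%O.

(* Main.v *)
(* Stability of A at beta is inherited at every pair of tuples of isomorphic
   structures. Hence, if beta bounds the ranks of the structures in X, then A and B
   in X are isomorphic iff r_beta(A, B) <= 1 and all pairs of tuples from the two
   coded sequences satisfy one more round of the game at rank beta: this back and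
   forth produces enumerations all of whose finite parts are at r_0-distance at
   most 2, and such enumerations induce an isomorphism because atomic formulas in
   late variables may be multiplied by arbitrarily large constants without ceasing
   to respect Omega. The condition is Borel, as r_gamma is Borel for countable gamma.

   Conversely, if isomorphism is Borel on X, the set of pairs (p, q) with p in X
   and q not isomorphic to p is analytic. Finite approximations to a point of this
   set, a witness for it and a back-and-forth matching form a well-founded tree on a
   countable alphabet, so there is a countable w such that A in X and
   r_w(A, B) <= 1 imply that A and B are isomorphic. Let alpha > w be closed under
   enough operations. A generic descending sequence of balls of rank below alpha
   around tuples of A defines a structure B with r_alpha(A, B) <= 1, which is thus
   isomorphic to A; genericity implies that every tuple of A is isolated by some
   ball. Amplifying such a ball by the universality of Omega, one deduces
   that the game at rank alpha can be continued, i.e. that the rank of A is at most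
   alpha. *)
From HB Require Import structures.
Require Import Defs.
From mathcomp Require Import wochoice.
From mathcomp Require Import all_boot all_order all_algebra.
From mathcomp Require Import all_classical all_reals all_analysis.
From mathcomp Require Import lra zify.
Import numFieldNormedType.Exports.

Set Implicit Arguments.
Unset Strict Implicit.
Unset Printing Implicit Defensive.

Import Order.TTheory GRing.Theory Num.Theory.
Local Open Scope classical_set_scope.
Local Open Scope ring_scope.

(** * Gauges *)

(** A formula respects [Om \o sh N] when it respects [Om] after its variables are renamed to start
    at $x_N$. For large [N] this includes any given multiple of a given atomic formula, so a bounded
    error at late places becomes an arbitrarily small one; hence the game is studied for all gauges
    [Om \o sh N] together.

    The delicate point of the converse is the error budget. Let u and v be at distance e, which need
    not be small, and let c be the point to be answered. A ball isolating the tuple (u, c) is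
    entered only with an error below its fixed radius d, while the answer to c may cost hardly more
    than e. One inequality of error e has to yield both. For this the multiplied formula is
    diminished by an anchor: the value of $\Omega$ at the distances between the first n entries and
    their copies inside the isolating tuple. The error of the formula is then divided by the factor,
    and, as this error cannot be negative, the anchor on the side of v exceeds that on the side of u
    by at most e. *)

Definition restr {T : Type} (n : nat) (a : nat -> T) : 'I_n -> T := fun i => a i.
Arguments restr {T} n a i /.

Section gauges.
Context {R : realType}.
Implicit Types (delta : nat -> R) (Th : (nat -> R) -> \bar R).

(** Arguments of moduli are families on [nat] cut down by [tr], so that one type serves all
    arities. *)
Definition tr n delta : nat -> R := fun i => if (i < n)%N then delta i else 0.

Definition sh m delta : nat -> R :=
  fun i => if (i < m)%N then 0 else delta (i - m)%N.

(** The family $\delta'$ that [shift_increasing] associates with the sequence [f]. *)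
Definition push (f : nat -> nat) delta : nat -> R := fun k =>
  if pselect (exists p, f p = k) is left h then delta (projT1 (cid h)) else 0.

Lemma pushE f delta p : injective f -> push f delta (f p) = delta p.
Proof.
move=> fi; rewrite /push; case: pselect => [h|]; last by case; exists p.
by rewrite (fi _ _ (projT2 (cid h))).
Qed.

Lemma push0 f delta k : (forall p, f p <> k) -> push f delta k = 0.
Proof. by move=> fk; rewrite /push; case: pselect => // h; case: (fk _ (projT2 (cid h))). Qed.

Lemma push_ge0 f delta : (forall i, 0 <= delta i) -> forall i, 0 <= push f delta i.
Proof. by move=> d0 i; rewrite /push; case: pselect. Qed.

Lemma tr_ge0 n delta : (forall i, 0 <= delta i) -> forall i, 0 <= tr n delta i.
Proof. by move=> d0 i; rewrite /tr; case: ifP. Qed.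

Lemma sh_ge0 n delta : (forall i, 0 <= delta i) -> forall i, 0 <= sh n delta i.
Proof. by move=> d0 i; rewrite /sh; case: ifP. Qed.

Lemma zpad_restr n delta : zpad (restr n delta) = tr n delta.
Proof.
apply/funext => j; rewrite /zpad /tr; case: ltnP => jn.
  by rewrite insubT.
by rewrite insubN// -leqNgt.
Qed.

Lemma zpad_ge0 n (delta : 'I_n -> R) : nonneg delta -> nonneg (zpad delta).
Proof. by move=> d0 i; rewrite /zpad; case: insubP. Qed.

Lemma zpadE n (delta : 'I_n -> R) (i : 'I_n) : zpad delta i = delta i.
Proof. by rewrite /zpad valK. Qed.

Lemma zpad0 n (delta : 'I_n -> R) j : (n <= j)%N -> zpad delta j = 0.
Proof. by move=> nj; rewrite /zpad insubN// -leqNgt. Qed.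

Lemma tr_zpad n (delta : 'I_n -> R) : tr n (zpad delta) = zpad delta.
Proof.
apply/funext => j; rewrite /tr; case: ltnP => // nj; by rewrite zpad0.
Qed.

Lemma restr_zpad n (delta : 'I_n -> R) : restr n (zpad delta) = delta.
Proof. by apply/funext => i; rewrite /restr zpadE. Qed.

(** What the game uses of $\Omega$, in a form that passes to [Om \o sh N]. The field [gauge_small]
    is continuity at zero in finitely many variables jointly. *)
Record gauge Th : Prop := {
  gauge_ge0 : forall delta, nonneg delta -> (0 <= Th delta)%E ;
  gauge0 : Th (fun=> 0) = 0%E ;
  gauge_le : forall delta delta', nonneg delta ->
    (forall i, delta i <= delta' i) -> (Th delta <= Th delta')%E ;
  gauge_subadd : forall delta delta', nonneg delta -> nonneg delta' ->
    (Th (delta \+ delta')%R <= Th delta + Th delta')%E ;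
  gauge_small : forall n (e : R), 0 < e -> exists2 eta : R, 0 < eta &
    forall delta, nonneg delta -> (forall i, (i < n)%N -> delta i <= eta) ->
    (Th (tr n delta) <= e%:E)%E ;
  gauge_shift : shift_increasing Th
}.

Lemma weak_modulus_small Om i (e : R) : weak_modulus Om -> 0 < e ->
  exists2 eta : R, 0 < eta & forall t, 0 <= t -> t <= eta ->
  (Om (dfwith (fun=> 0%R) i t) <= e%:E)%E.
Proof.
move=> OmW e0.
have /subspace_continuousP/(_ 0 (lexx _)) := @weak_modulus_sep_cont _ _ OmW i (fun=> 0) (fun=> lexx _).
rewrite /from_subspace/=; have -> : dfwith (fun=> 0 : R) i 0 = fun=> 0.
  apply/funext => j; have [->|ij] := eqVneq j i; first by rewrite dfwithin.
  by rewrite dfwithout// eq_sym.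
rewrite (weak_modulus0 OmW) => H.
have := H [set x | (x < e%:E)%E] _.
case.
  by apply: open_ereal_lt'; rewrite lte_fin.
move=> d /= d0 Hd; exists (d / 2); first by rewrite divr_gt0.
move=> t t0 td; apply/ltW/Hd => //=.
rewrite sub0r normrN ger0_norm//; lra.
Qed.

Lemma weak_modulus_gauge Om : weak_modulus Om -> shift_increasing Om -> gauge Om.
Proof.
move=> OmW Omsh; split => //.
- exact: weak_modulus_ge0.
- exact: weak_modulus0.
- move=> d d' d0 dd'.
  have -> : d' = d \+ (fun i => d' i - d i) by apply/funext => i /=; rewrite addrC subrK.
  by apply: weak_modulus_le => // i; rewrite subr_ge0.
- exact: weak_modulus_subadd.
- elim=> [|n IH] e e0.
    exists 1 => // d _ _; rewrite (_ : tr 0 d = fun=> 0); last exact/funext.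
    by rewrite (weak_modulus0 OmW) lee_fin ltW.
  have [|eta1 eta10 H1] := IH (e / 2); first by rewrite divr_gt0.
  have [|eta2 eta20 H2] := @weak_modulus_small Om n (e / 2) OmW; first by rewrite divr_gt0.
  exists (Num.min eta1 eta2); first by rewrite lt_min eta10.
  move=> d d0 dle.
  (* Subadditivity splits off coordinate [n], to which separate continuity at zero applies. *)
  have -> : tr n.+1 d = (tr n d \+ dfwith (fun=> 0) n (d n)).
    apply/funext => i /=; rewrite /tr ltnS.
    have [->|ni] := eqVneq i n; first by rewrite leqnn ltnn dfwithin add0r.
    by rewrite dfwithout 1?eq_sym// addr0 ltn_neqAle ni.
  have d1 : nonneg (dfwith (fun=> 0) n (d n)).
    move=> i; have [->|ni] := eqVneq i n; first by rewrite dfwithin.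
    by rewrite dfwithout 1?eq_sym.
  apply: le_trans (weak_modulus_subadd OmW (tr_ge0 _ d0) d1) _.
  rewrite [in leRHS](_ : e = e / 2 + e / 2); last by rewrite -splitr.
  rewrite EFinD; apply: leeD.
    by apply: H1 => // i ni; have := dle i (ltnW ni); rewrite le_min => /andP[].
  by apply: H2 => //; have := dle n (ltnSn n); rewrite le_min => /andP[].
Qed.

Lemma gauge_sh Th N : gauge Th -> gauge (Th \o sh N).
Proof.
move=> gT; split => /=.
- by move=> d d0; apply: (gauge_ge0 gT); exact: sh_ge0.
- rewrite (_ : sh N _ = fun=> 0) ?(gauge0 gT)//.
  by apply/funext => i; rewrite /sh; case: ifP.
- move=> d d' d0 dd'; apply: (gauge_le gT); first exact: sh_ge0.
  by move=> i; rewrite /sh; case: ifP.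
- move=> d d' d0 d0'; rewrite (_ : sh N (d \+ d') = sh N d \+ sh N d').
    by apply: (gauge_subadd gT); exact: sh_ge0.
  by apply/funext => i /=; rewrite /sh; case: ifP; rewrite ?addr0.
- move=> n e e0; have [eta eta0 H] := gauge_small gT (N + n) e0.
  exists eta => // d d0 dle.
  rewrite (_ : sh N (tr n d) = tr (N + n) (sh N d)).
    apply: H; first exact: sh_ge0.
    move=> i iNn; rewrite /sh; case: ltnP => iN; first exact: ltW.
    by apply: dle; lia.
  apply/funext => i; rewrite /sh /tr; case: ltnP => iN; first by case: ifP.
  by rewrite ltn_subLR.
- move=> i ih d d' d0 di dk.
  (* The given sequence acts beyond the first [N] places, which stay fixed. *)
  pose j k := (if (k < N)%N then k else N + i (k - N))%N.
  refine (@gauge_shift Th gT j _ _ _ _ _ _); rewrite /j {j}.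
  + move=> p q pq /=; case: (ltnP p N) => pN; case: (ltnP q N) => qN; try lia.
    have := ih (p - N)%N (q - N)%N; lia.
  + exact: sh_ge0.
  + move=> p; rewrite /sh; case: (ltnP p N) => [->//|pN].
    by rewrite ltnNge leq_addr/= addKn di.
  + move=> k hk; rewrite /sh; case: (ltnP k N) => // kN; apply: dk => p ip.
    by apply: (hk (N + p)%N); rewrite ltnNge leq_addr/= addKn ip subnKC.
Qed.

(** A small enough fraction of the tuple has value at most 1, and by subadditivity a multiple by $k$
    has value at most $k$. *)
Lemma gauge_tr_fin Th n delta : gauge Th -> nonneg delta ->
  Th (tr n delta) \is a fin_num.
Proof.
move=> gT d0; rewrite ge0_fin_numE; last by apply: (gauge_ge0 gT); exact: tr_ge0.
have [eta eta0 H] := gauge_small gT n ltr01.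
pose S := \sum_(i < n) delta i.
have Sle i : (i < n)%N -> delta i <= S.
  move=> iln; rewrite /S (bigD1 (Ordinal iln))//= lerDl; apply: sumr_ge0 => *; exact: d0.
have S0 : 0 <= S by apply: sumr_ge0 => *; exact: d0.
have [k kS] : exists k : nat, S <= k%:R * eta.
  exists (Num.bound (S / eta)).
  rewrite -ler_pdivrMr//; apply/ltW.
  by apply: archi_boundP; rewrite divr_ge0// ltW.
pose u : nat -> R := fun i => delta i / k.+1%:R.
have u0 : nonneg u by move=> i; rewrite divr_ge0.
have Hk j : (Th (tr n (fun i => u i *+ j)%R) <= j%:R%:E)%E.
  elim: j => [|j IH].
    rewrite (_ : tr _ _ = fun=> 0) ?(gauge0 gT)//.
    by apply/funext => i; rewrite /tr mulr0n; case: ifP.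
  rewrite (_ : tr _ _ = tr n (fun i => u i *+ j) \+ tr n u); last first.
    by apply/funext => i; rewrite /tr/= mulrSr; case: ifP; rewrite ?addr0.
  apply: le_trans (gauge_subadd gT (tr_ge0 _ _) (tr_ge0 _ u0)) _.
    by move=> i; rewrite mulrn_wge0.
  rewrite -natr1 EFinD; apply: leeD => //; apply: H => // i iln.
  rewrite /u ler_pdivrMr// mulrC (le_trans (Sle _ iln))// (le_trans kS)//.
  by rewrite ler_wpM2r ?ler_nat// ltW.
have -> : delta = fun i => u i *+ k.+1.
  by apply/funext => i; rewrite /u -[RHS]mulr_natr divfK.
by apply: le_lt_trans (Hk _) _; rewrite ltry.
Qed.

End gauges.
Arguments sh {R}.

(** * Formulas and gauges *)

Section formulas.
Context {R : realType} {L : signature R}.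
Implicit Types (Th : (nat -> R) -> \bar R) (A B : structure L).

Lemma modulus_mono n (D : modulus R n) (x y : 'I_n -> R) :
  nonneg x -> (forall i, x i <= y i) -> D x <= D y.
Proof.
move=> x0 xy; have -> : y = x \+ (fun i => y i - x i).
  by apply/funext => i /=; rewrite addrC subrK.
by apply: modulus_le => // i; rewrite subr_ge0.
Qed.

Lemma term_modulus_ge0 n (t : term L n) (delta : 'I_n -> R) :
  nonneg delta -> 0 <= term_modulus t delta.
Proof. by move=> d0; elim: t => [i|F ts IH] /=; [exact: d0|exact: modulus_ge0]. Qed.

Lemma term_modulus_mono n (t : term L n) (x y : 'I_n -> R) :
  nonneg x -> (forall i, x i <= y i) -> term_modulus t x <= term_modulus t y.
Proof.
move=> x0 xy; elim: t => [i|F ts IH] /=; first exact: xy.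
by apply: modulus_mono => // i; exact: term_modulus_ge0.
Qed.

Lemma atomic_modulus_mono n (phi : atomic L n) (x y : 'I_n -> R) :
  nonneg x -> (forall i, x i <= y i) -> atomic_modulus phi x <= atomic_modulus phi y.
Proof.
move=> x0 xy; apply: modulus_mono => i; first exact: term_modulus_ge0.
exact: term_modulus_mono.
Qed.

Lemma mdist_dist (T : metricType R) (x y x' y' : T) :
  `|mdist x y - mdist x' y'| <= mdist x x' + mdist y y'.
Proof.
have h1 := metric_triangle x x' y; have h2 := metric_triangle x' y' y.
have h3 := metric_triangle x' x y'; have h4 := metric_triangle x y y'.
rewrite (metric_sym y' y) in h2; rewrite (metric_sym x' x) in h3.
by rewrite ler_norml; apply/andP; split; lra.
Qed.

Lemma term_eval_respects A n (t : term L n) (a a' : 'I_n -> A) :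
  mdist (term_eval a t) (term_eval a' t)
    <= term_modulus t (fun i => mdist (a i) (a' i)).
Proof.
elim: t => [i|F ts IH] //=.
apply: le_trans (fint_respects _ _) _; apply: modulus_mono => // i.
exact: mdist_ge0.
Qed.

Lemma pint_respects A (P : psym L) (x y : 'I_(parity P) -> A) :
  `|pint x - pint y| <= pmodulus P (fun i => mdist (x i) (y i)).
Proof. by case: P x y => [P|] x y /=; [exact: other_pint_respects|exact: mdist_dist]. Qed.

Lemma pint_bound A (P : psym L) (x : 'I_(parity P) -> A) : bound P (pint x).
Proof.
case: P x => [P|] x /=; rewrite in_itv/=; first exact: other_pint_bound.
exact: mdist_bound.
Qed.

Lemma atomic_eval_respects A n (phi : atomic L n) (a a' : 'I_n -> A) :
  `|atomic_eval phi a - atomic_eval phi a'|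
    <= atomic_modulus phi (fun i => mdist (a i) (a' i)).
Proof.
apply: le_trans (pint_respects _ _) _; apply: modulus_mono => i.
  exact: mdist_ge0.
exact: term_eval_respects.
Qed.

Lemma box_eval A n m (phi : 'I_m -> atomic L n) (a : 'I_n -> A) :
  box phi (fun i => atomic_eval (phi i) a).
Proof. by move=> i; exact: pint_bound. Qed.

Definition respects Th n (phi : basic L n) : Prop :=
  forall delta, nonneg delta -> (basic_modulus phi delta <= weak_restr Th delta)%E.

(** Trades the supremum over the box for pointwise inequalities, and tuples for families on
    [nat]. *)
Lemma respectsP Th n (phi : basic L n) : respects Th phi <->
  forall delta : nat -> R, nonneg delta ->
  forall x y, box (@basic_atoms _ _ _ phi) x -> box (@basic_atoms _ _ _ phi) y ->
  (forall i, `|x i - y i| <= atomic_modulus (basic_atoms i) (restr n delta)) ->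
  (`|basic_fun x - basic_fun y|%:E <= Th (tr n delta))%E.
Proof.
split=> [H delta d0 x y bx bY xy|H delta d0].
  have := H (restr n delta) (fun i => d0 i); rewrite /weak_restr zpad_restr.
  by apply: le_trans; apply: ereal_sup_ubound; exists x, y.
apply: ub_ereal_sup => _ [x [y [bx bY xy ->]]].
have := H _ (zpad_ge0 d0) _ _ bx bY; rewrite tr_zpad; apply => i.
by rewrite restr_zpad.
Qed.

Fixpoint rename_term n m (f : 'I_n -> 'I_m) (t : term L n) : term L m :=
  match t with
  | Var i => Var L (f i)
  | App F ts => App (fun i => rename_term f (ts i))
  end.

Definition rename_atomic n m (f : 'I_n -> 'I_m) (phi : atomic L n) : atomic L m :=
  Atomic (fun i => rename_term f (@atomic_args _ _ _ phi i)).

Lemma term_eval_rename A n m (f : 'I_n -> 'I_m) (t : term L n) (a : 'I_m -> A) :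
  term_eval a (rename_term f t) = term_eval (a \o f) t.
Proof. by elim: t => [i|F ts IH] //=; congr fint; apply/funext => i. Qed.

Lemma term_modulus_rename n m (f : 'I_n -> 'I_m) (t : term L n) (delta : 'I_m -> R) :
  term_modulus (rename_term f t) delta = term_modulus t (delta \o f).
Proof. by elim: t => [i|F ts IH] //=; congr (modulus_fun _ _); apply/funext => i. Qed.

Lemma atomic_eval_rename A n m (f : 'I_n -> 'I_m) (phi : atomic L n) (a : 'I_m -> A) :
  atomic_eval (rename_atomic f phi) a = atomic_eval phi (a \o f).
Proof.
by rewrite /atomic_eval/=; congr pint; apply/funext => i; exact: term_eval_rename.
Qed.

Lemma atomic_modulus_rename n m (f : 'I_n -> 'I_m) (phi : atomic L n) (delta : 'I_m -> R) :
  atomic_modulus (rename_atomic f phi) delta = atomic_modulus phi (delta \o f).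
Proof.
rewrite /atomic_modulus/=; congr (modulus_fun _ _); apply/funext => i.
exact: term_modulus_rename.
Qed.

Definition rename_basic n m (f : 'I_n -> 'I_m) (phi : basic L n) : basic L m :=
  @Basic _ _ _ _ (fun i => rename_atomic f (@basic_atoms _ _ _ phi i)) _
    (@basic_cont _ _ _ phi).

Lemma basic_eval_rename A n m (f : 'I_n -> 'I_m) (phi : basic L n) (a : 'I_m -> A) :
  basic_eval (rename_basic f phi) a = basic_eval phi (a \o f).
Proof.
rewrite /basic_eval/=; congr (basic_fun _); apply/funext => i.
exact: atomic_eval_rename.
Qed.

Lemma gauge_reindex Th n m (i : nat -> nat) (delta : nat -> R) : gauge Th ->
  (forall p q, (p < q)%N -> (q < n)%N -> (i p < i q)%N) ->
  (forall p, (p < n)%N -> (i p < m)%N) -> nonneg delta ->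
  (Th (tr n (delta \o i)) <= Th (tr m delta))%E.
Proof.
move=> gT ih im d0.
(* [shift_increasing] asks for a sequence increasing on all of [nat]; past [n] it continues beyond
   [m], where [tr n] only contributes zeros. *)
pose j p := if (p < n)%N then i p else (m + p)%N.
have jh : {homo j : p q / (p < q)%N}.
  move=> p q pq; rewrite /j; case: (ltnP p n) => pn; case: (ltnP q n) => qn.
  - exact: ih.
  - by have := im _ pn; lia.
  - lia.
  - lia.
have ji : injective j.
  by move=> p q jpq; case: (ltngtP p q) => // /jh; rewrite jpq ltnn.
have tr0 := tr_ge0 n (delta := delta \o i) (fun k => d0 (i k)).
apply: le_trans (@gauge_shift _ Th gT j jh (tr n (delta \o i)) (push j (tr n (delta \o i))) _ _ _) _ => //.
- by move=> p; rewrite pushE.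
- by move=> k; exact: push0.
apply: (gauge_le gT); first exact: push_ge0.
move=> k; have [[p <-]|np] := pselect (exists p, j p = k); last first.
  rewrite push0; last by move=> p jp; apply: np; exists p.
  exact: tr_ge0.
rewrite pushE// /tr /j; case: ifP => pn /=; first by rewrite im.
by case: ifP.
Qed.

(** Variables are renamed in increasing order only, because $\Omega$ need not be symmetric. *)
Lemma respects_rename Th n m (i : nat -> nat) (f : 'I_n -> 'I_m) (phi : basic L n) :
  gauge Th -> (forall p q, (p < q)%N -> (q < n)%N -> (i p < i q)%N) ->
  (forall p : 'I_n, f p = i p :> nat) ->
  respects Th phi -> respects Th (rename_basic f phi).
Proof.
move=> gT ih fi /respectsP H; apply/respectsP => delta d0 x y bx bY xy.
apply: le_trans (H (delta \o i) _ x y bx bY _) _.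
- by move=> k; exact: d0.
- move=> k; apply: le_trans (xy k) _; rewrite atomic_modulus_rename.
  apply: atomic_modulus_mono => [l|l]; rewrite /= ?d0// fi//.
- apply: gauge_reindex => // p pn.
  by rewrite -(fi (Ordinal pn)).
Qed.

Lemma basic_respects Th A n (phi : basic L n) (a a' : nat -> A) (delta : nat -> R) :
  respects Th phi -> nonneg delta ->
  (forall i, (i < n)%N -> mdist (a i) (a' i) <= delta i) ->
  (`|basic_eval phi (restr n a) - basic_eval phi (restr n a')|%:E <= Th (tr n delta))%E.
Proof.
move=> /respectsP H d0 ad; apply: H => //; try exact: box_eval.
move=> i; apply: le_trans (atomic_eval_respects _ _ _) _.
apply: atomic_modulus_mono => j /=; first exact: mdist_ge0.
exact: ad.
Qed.

End formulas.

(** * Back-and-forth distances *)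

(** Tuples are initial segments of sequences; of the overwritten tail only the term at [n]
    matters. *)
Definition upd {T : Type} (a : nat -> T) (n : nat) (c : T) : nat -> T :=
  fun i => if (i < n)%N then a i else c.

Lemma restr_upd T (a : nat -> T) n c : restr n.+1 (upd a n c) = snoc (restr n a) c.
Proof.
apply/funext => i; rewrite /snoc /upd /=; case: unliftP => [j ->|->].
  by rewrite lift_max ltn_ord.
by rewrite ltnn.
Qed.

Lemma comp_upd T T' (x : T -> T') (i : nat -> T) n k : x \o upd i n k = upd (x \o i) n (x k).
Proof. by apply/funext => p; rewrite /upd /=; case: ifP. Qed.

Lemma restr_eq T (a b : nat -> T) n : (forall i, (i < n)%N -> a i = b i) ->
  restr n a = restr n b.
Proof. by move=> ab; apply/funext => i /=; exact: ab. Qed.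

Section ereal_bounds.
Context {R : realType}.
Implicit Types (S : set (\bar R)) (e : R).

Lemma esup0_leP S e : (esup0 S <= e%:E)%E <->
  0 <= e /\ forall x, S x -> (x <= e%:E)%E.
Proof.
split=> [H|[e0 H]].
  split; first by rewrite -lee_fin; apply: le_trans H; apply: ereal_sup_ubound; left.
  by move=> x Sx; apply: le_trans H; apply: ereal_sup_ubound; right.
by apply: ub_ereal_sup => x [->|]; [rewrite lee_fin|exact: H].
Qed.

Lemma ereal_inf_leP S e : (ereal_inf S <= e%:E)%E <->
  forall e', e < e' -> exists2 x, S x & (x <= e'%:E)%E.
Proof.
split=> [H e' ee'|H].
  have /ereal_inf_lt[x Sx xe] : (ereal_inf S < e'%:E)%E.
    by apply: le_lt_trans H _; rewrite lte_fin.
  by exists x => //; exact: ltW.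
apply/lee_addgt0Pr => d d0.
have [|x Sx xe] := H (e + d); first by rewrite ltrDl.
by apply: le_trans xe; exact: ereal_inf_lbound.
Qed.

End ereal_bounds.

Section back_and_forth.
Context {R : realType} {L : signature R} (W : wellOrder).
Implicit Types (Th : (nat -> R) -> \bar R) (A B C : structure L) (g : W).

(** The distances are handled through comparisons with reals, which avoids arithmetic in
    $[0,\infty]$; in [zigzag] the infimum becomes a quantifier over all larger errors. *)
Definition bfle Th g A B n (a : nat -> A) (b : nat -> B) (e : R) : Prop :=
  (bf Th g (restr n a) (restr n b) <= e%:E)%E.

Definition bf0le Th A B n (a : nat -> A) (b : nat -> B) (e : R) : Prop :=
  forall phi : basic L n, respects Th phi ->
  `|basic_eval phi (restr n a) - basic_eval phi (restr n b)| <= e.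

Definition zigzag Th g A B n (a : nat -> A) (b : nat -> B) (e : R) : Prop :=
  forall e', e < e' ->
  (forall c, exists d, bfle Th g n.+1 (upd a n c) (upd b n d) e') /\
  (forall d, exists c, bfle Th g n.+1 (upd a n c) (upd b n d) e').

Lemma bf_zero_leP Th A B n (a : nat -> A) (b : nat -> B) e :
  (bf_zero Th (restr n a) (restr n b) <= e%:E)%E <-> 0 <= e /\ bf0le Th n a b e.
Proof.
rewrite esup0_leP; split=> -[e0 H]; split=> //.
  by move=> phi rphi; rewrite -lee_fin; apply: H; exists phi.
by move=> _ [phi rphi <-]; rewrite lee_fin; exact: H.
Qed.

Lemma bf_step_leP Th g A B n (a : nat -> A) (b : nat -> B) e :
  inhabited A -> inhabited B ->
  (bf_step (bf Th g) (restr n a) (restr n b) <= e%:E)%E <->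
  0 <= e /\ zigzag Th g n a b e.
Proof.
move=> [a0] [b0]; rewrite esup0_leP; split=> -[e0 H]; split=> //.
  have HH c d e' : e < e' -> exists c' d',
      bfle Th g n.+1 (upd a n c) (upd b n d') e' /\
      bfle Th g n.+1 (upd a n c') (upd b n d) e'.
    move=> ee'; have /ereal_inf_leP/(_ _ ee')[_ [c' _ [d' _ <-]]] :=
      H _ (ex_intro2 _ _ c I (ex_intro2 _ _ d I erefl)).
    by rewrite ge_max => /andP[? ?]; exists c', d'; rewrite /bfle !restr_upd.
  move=> e' ee'; split=> [c|d].
    by have [_ [d [? _]]] := HH c b0 _ ee'; exists d.
  by have [c [_ [_ ?]]] := HH a0 d _ ee'; exists c.
move=> _ [c _ [d _ <-]]; apply/ereal_inf_leP => e' ee'.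
have [/(_ c)[d' h1] /(_ d)[c' h2]] := H _ ee'.
exists (maxe (bf Th g (snoc (restr n a) c) (snoc (restr n b) d'))
  (bf Th g (snoc (restr n a) c') (snoc (restr n b) d))).
  by exists c' => //; exists d'.
by rewrite ge_max -!restr_upd; apply/andP; split.
Qed.

Lemma bf0le_upd Th A B n (a : nat -> A) (b : nat -> B) c d e : gauge Th ->
  bf0le Th n.+1 (upd a n c) (upd b n d) e -> bf0le Th n a b e.
Proof.
move=> gT H phi rphi.
have := H (rename_basic (widen_ord (leqnSn n)) phi)
  (@respects_rename _ _ Th _ _ id _ phi gT _ _ rphi).
rewrite !basic_eval_rename.
have E T (x : nat -> T) y : restr n.+1 (upd x n y) \o widen_ord (leqnSn n) = restr n x.
  by apply/funext => i; rewrite /= /upd ltn_ord.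
by rewrite !E; exact.
Qed.

(** Ranks zero, successor and limit share this description because the distances increase with the
    rank. Later inductions on ranks all go through it. *)
Lemma bfleP Th g A B n (a : nat -> A) (b : nat -> B) e :
  gauge Th -> inhabited A -> inhabited B ->
  bfle Th g n a b e <-> [/\ 0 <= e, bf0le Th n a b e &
     forall g', (g' < g)%O -> zigzag Th g' n a b e].
Proof.
move=> gT iA iB.
elim/(well_founded_ind (@wo_wf W)): g n a b e => g IH n a b e.
have mono g1 g2 n' (a' : nat -> A) (b' : nat -> B) e' : (g1 <= g2)%O -> (g2 < g)%O ->
    bfle Th g2 n' a' b' e' -> bfle Th g1 n' a' b' e'.
  move=> g12 g2g /(IH _ g2g)[e0 h0 h]; apply/(IH _ (le_lt_trans g12 g2g)).
  by split=> // g' g'1; apply: h; exact: lt_le_trans g12.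
have [[v vg]|ns] := pselect (exists v, is_succ v g).
  rewrite /bfle (bfS _ _ _ vg) bf_step_leP//; split=> [[e0 H]|[e0 _ /(_ _ vg.1)]]//.
  split=> //.
    (* Any pair of extended tuples controls the formulas in fewer variables, so one round gives back
       the condition of rank zero. *)
    move: (iA) (iB) => [x] [y] phi rphi; apply/ler_addgt0Pr => d d0.
    have [|/(_ x)[y' /(IH _ vg.1)[_ h _]] _] := H (e + d); first by rewrite ltrDl.
    exact: bf0le_upd h _ _.
  move=> g' g'g e' ee'; have [h1 h2] := H _ ee'.
  split=> [c|d]; [have [d h] := h1 c; exists d|have [c h] := h2 d; exists c].
    by apply: (mono g' v) => //; [exact: vg.2|exact: vg.1].
  by apply: (mono g' v) => //; [exact: vg.2|exact: vg.1].
have [[v0 v0g]|n0] := pselect (exists v, (v < g)%O); last first.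
  rewrite /bfle bf0; last by move=> v vg; apply: n0; exists v.
  rewrite bf_zero_leP; split=> [[]|[]]// e0 h; split=> // g' g'g.
  by case: n0; exists g'.
rewrite /bfle bf_lim//; last 2 first.
- by exists v0.
- by move=> v vg; apply: ns; exists v.
have lim v : (v < g)%O -> exists2 u, (v < u)%O & (u < g)%O.
  move=> vg; apply: contrapT => H; apply: ns; exists v; split=> // u ug.
  by rewrite leNgt; apply/negP => vu; apply: H; exists u.
rewrite esup0_leP; split=> [[e0 H]|[e0 h0 h]].
  have H' v : (v < g)%O -> bfle Th v n a b e by move=> vg; apply: H; exists v.
  split=> //; first by have /(IH _ v0g)[] := H' _ v0g.
  move=> g' /lim[u g'u ug]; have /(IH _ ug)[_ _] := H' _ ug; exact.
split=> // _ [v vg <-]; apply/(IH _ vg); split=> // g' g'v; apply: h.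
exact: lt_trans vg.
Qed.

Lemma bfle_ge0 Th g A B n (a : nat -> A) (b : nat -> B) e :
  gauge Th -> inhabited A -> inhabited B -> bfle Th g n a b e -> 0 <= e.
Proof. by move=> gT iA iB /bfleP[]. Qed.

Lemma bfle_weaken Th g g' A B n (a : nat -> A) (b : nat -> B) e e' :
  gauge Th -> inhabited A -> inhabited B -> (g' <= g)%O -> e <= e' ->
  bfle Th g n a b e -> bfle Th g' n a b e'.
Proof.
move=> gT iA iB gg ee /bfleP[]// e0 h0 h; apply/bfleP => //; split.
- exact: le_trans ee.
- by move=> phi rphi; exact: le_trans (h0 _ rphi) ee.
move=> g1 g1g e1 ee1; apply: h; first exact: lt_le_trans gg.
exact: le_lt_trans ee1.
Qed.

Lemma bfle_congr Th g A B n (a a' : nat -> A) (b b' : nat -> B) e :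
  (forall i, (i < n)%N -> a i = a' i) -> (forall i, (i < n)%N -> b i = b' i) ->
  bfle Th g n a b e -> bfle Th g n a' b' e.
Proof. by move=> aa bb; rewrite /bfle (restr_eq aa) (restr_eq bb). Qed.

Lemma bfle_sym Th g A B n (a : nat -> A) (b : nat -> B) e :
  gauge Th -> inhabited A -> inhabited B -> bfle Th g n a b e -> bfle Th g n b a e.
Proof.
move=> gT iA iB.
elim/(well_founded_ind (@wo_wf W)): g n a b e => g IH n a b e /bfleP[]// e0 h0 h.
apply/bfleP => //; split=> //; first by move=> phi /h0; rewrite distrC.
move=> g' g'g e' /(h _ g'g)[h1 h2]; split=> [c|d].
  by have [d hd] := h2 c; exists d; exact: IH.
by have [c hc] := h1 d; exists c; exact: IH.
Qed.

Lemma bfle_trans Th g A B C n (a : nat -> A) (b : nat -> B) (c : nat -> C) e1 e2 :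
  gauge Th -> inhabited A -> inhabited B -> inhabited C ->
  bfle Th g n a b e1 -> bfle Th g n b c e2 -> bfle Th g n a c (e1 + e2).
Proof.
move=> gT iA iB iC.
elim/(well_founded_ind (@wo_wf W)): g n a b c e1 e2 => g IH n a b c e1 e2.
move=> /bfleP[]// e10 h10 h1 /bfleP[]// e20 h20 h2; apply/bfleP => //; split.
- exact: addr_ge0.
- move=> phi rphi; rewrite (_ : _ - _ = (basic_eval phi (restr n a) - basic_eval phi (restr n b)) +
    (basic_eval phi (restr n b) - basic_eval phi (restr n c))); last by lra.
  by apply: le_trans (ler_normD _ _) _; apply: lerD; [exact: h10|exact: h20].
move=> g' g'g e' ee'; pose d := (e' - (e1 + e2)) / 2.
have d0 : 0 < d by rewrite divr_gt0// subr_gt0.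
have -> : e' = (e1 + d) + (e2 + d) by rewrite /d; lra.
have [|h1l h1r] := h1 _ g'g (e1 + d); first by rewrite ltrDl.
have [|h2l h2r] := h2 _ g'g (e2 + d); first by rewrite ltrDl.
split=> [x|z].
  by have [y xy] := h1l x; have [z yz] := h2l y; exists z; exact: IH xy yz.
by have [y yz] := h2r z; have [x xy] := h1r y; exists x; exact: IH xy yz.
Qed.

(** Each move is answered by the same point, so new coordinates add distance zero and one [delta]
    works at all ranks. *)
Lemma bfle_near Th g A n (a a' : nat -> A) (delta : nat -> R) e :
  gauge Th -> inhabited A -> nonneg delta ->
  (forall i, (i < n)%N -> mdist (a i) (a' i) <= delta i) ->
  (Th (tr n delta) <= e%:E)%E -> bfle Th g n a a' e.
Proof.
move=> gT iA; elim/(well_founded_ind (@wo_wf W)): g n a a' delta e.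
move=> g IH n a a' delta e d0 ad de; apply/bfleP => //.
have e0 : 0 <= e.
  by rewrite -lee_fin; apply: le_trans de; apply: (gauge_ge0 gT); exact: tr_ge0.
split=> //.
  move=> phi rphi; rewrite -lee_fin; apply: le_trans de.
  exact: basic_respects.
move=> g' g'g e' ee'.
have H c : bfle Th g' n.+1 (upd a n c) (upd a' n c) e'.
  apply: (IH _ g'g _ _ _ (tr n delta)); first exact: tr_ge0.
    move=> i; rewrite ltnS /upd /tr; case: ltnP => [iln _|]; first exact: ad.
    by rewrite mdistxx.
  rewrite (_ : tr n.+1 (tr n delta) = tr n delta).
    by apply: le_trans de _; rewrite lee_fin ltW.
  apply/funext => i; rewrite /tr; case: ifP => //; case: ifP => // h1 /negP h2.
  by exfalso; apply: h2; rewrite ltnS ltnW.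
by split=> c; exists c.
Qed.

(** Lets a reply be moved into a dense sequence at arbitrarily small cost. *)
Lemma bfle_upd_near Th g n e : gauge Th -> 0 < e -> exists2 eta : R, 0 < eta &
  forall A (x : nat -> A) c c', inhabited A -> mdist c c' <= eta ->
  bfle Th g n.+1 (upd x n c) (upd x n c') e.
Proof.
move=> gT e0; have [eta eta0 sm] := gauge_small gT n.+1 e0; exists eta => // A x c c' iA cc'.
apply: (@bfle_near _ _ _ _ _ _ (fun=> eta)) => //; first by move=> _; exact: ltW.
  by move=> p _; rewrite /upd; case: ifP => // _; rewrite mdistxx ltW.
by apply: sm => // _; exact: ltW.
Qed.

Lemma bfle_refl Th g A n (a : nat -> A) : gauge Th -> inhabited A -> bfle Th g n a a 0.
Proof.
move=> gT iA; apply: (@bfle_near _ _ _ _ _ _ (fun=> 0)) => //.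
  by move=> i _; rewrite mdistxx.
by rewrite (_ : tr n _ = fun=> 0) ?(gauge0 gT)//; apply/funext => i; rewrite /tr; case: ifP.
Qed.

Lemma bfle_reindex Th g A B n m (i : nat -> nat) (a : nat -> A) (b : nat -> B) e :
  gauge Th -> inhabited A -> inhabited B ->
  (forall p q, (p < q)%N -> (q < n)%N -> (i p < i q)%N) ->
  (forall p, (p < n)%N -> (i p < m)%N) ->
  bfle Th g m a b e -> bfle Th g n (a \o i) (b \o i) e.
Proof.
move=> gT iA iB.
elim/(well_founded_ind (@wo_wf W)): g n m i a b e => g IH n m i a b e ih im.
move=> /bfleP[]// e0 h0 h; apply/bfleP => //; split=> //.
  move=> phi rphi; pose f (p : 'I_n) : 'I_m := Ordinal (im _ (ltn_ord p)).
  have := h0 (rename_basic f phi) (@respects_rename _ _ Th _ _ i f phi gT ih (fun=> erefl) rphi).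
  by rewrite !basic_eval_rename.
(* A move in the subtuple is played at place [m], as the next move in the long tuple. *)
pose j p := if (p < n)%N then i p else m.
have E T (x : nat -> T) y p : (p < n.+1)%N -> (upd x m y \o j) p = upd (x \o i) n y p.
  move=> _; rewrite /upd /j /=; case: (ltnP p n) => pn; first by rewrite im.
  by rewrite ltnn.
have K c d e' g' : (g' < g)%O -> bfle Th g' m.+1 (upd a m c) (upd b m d) e' ->
    bfle Th g' n.+1 (upd (a \o i) n c) (upd (b \o i) n d) e'.
  move=> g'g H; apply: (bfle_congr (E _ a c) (E _ b d)).
  apply: (IH _ g'g _ m.+1 j (upd a m c) (upd b m d)) => // [p q pq|p]; rewrite ltnS /j.
    move=> qn; rewrite (leq_trans pq qn); case: ifP => [?|_]; first exact: ih.
    by apply: im; exact: leq_trans qn.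
  by case: (ltnP p n) => // pn _; rewrite ltnS ltnW// im.
move=> g' g'g e' ee'; have [h1 h2] := h _ g'g _ ee'; split=> [c|d].
  by have [d hd] := h1 c; exists d; exact: K.
by have [c hc] := h2 d; exists c; exact: K.
Qed.

Lemma bfle_take Th g A B n m (a : nat -> A) (b : nat -> B) e :
  gauge Th -> inhabited A -> inhabited B -> (n <= m)%N ->
  bfle Th g m a b e -> bfle Th g n a b e.
Proof.
move=> gT iA iB nm; apply: (@bfle_reindex _ _ _ _ _ _ id) => // p pn.
exact: leq_trans nm.
Qed.

Lemma bfle_gauge_le Th Th' g A B n (a : nat -> A) (b : nat -> B) e :
  gauge Th -> gauge Th' -> inhabited A -> inhabited B ->
  (forall m delta, nonneg delta -> (Th (tr m delta) <= Th' (tr m delta))%E) ->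
  bfle Th' g n a b e -> bfle Th g n a b e.
Proof.
move=> gT gT' iA iB TT.
elim/(well_founded_ind (@wo_wf W)): g n a b e => g IH n a b e /bfleP[]// e0 h0 h.
apply/bfleP => //; split=> //.
  move=> phi /respectsP rphi; apply: h0; apply/respectsP => d d0 x y bx bY xy.
  exact: le_trans (rphi _ d0 _ _ bx bY xy) (TT _ _ d0).
move=> g' g'g e' /(h _ g'g)[h1 h2]; split=> [c|d].
  by have [d hd] := h1 c; exists d; exact: IH.
by have [c hc] := h2 d; exists c; exact: IH.
Qed.

End back_and_forth.

(** * Coordinates of codes *)

Lemma cvg_prod_topology (I : Type) (T : I -> topologicalType)
    (F : set_system (prod_topology T)) (p : prod_topology T) : Filter F ->
  (forall i, (fun f : prod_topology T => f i) @ F --> p i) -> F --> p.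
Proof.
move=> FF Fp; apply/cvg_sup => i U.
have /= -> := @nbhsE (initial_topology (fun f : forall i, T i => f i)) p.
case=> B [[C oC <-] Cp] /filterS; apply.
by apply: (Fp i); apply: open_nbhs_nbhs; split.
Qed.

Section fine_filter.
Context {T : Type} {R : realType} (N : R -> set T).
Hypothesis N_le : forall e e', 0 < e -> e <= e' -> N e `<=` N e'.

(** If this filter converges to a point, every neighbourhood of the point contains some [N e]. In a
    product the convergence is checked coordinatewise, which extracts boxes from the product
    topology. *)
Definition fine_filter : set_system T := [set V | exists2 e : R, 0 < e & N e `<=` V].

Lemma fine_filter_filter : Filter fine_filter.
Proof.
split; first by exists 1.
  move=> P Q [e e0 eP] [e' e'0 eQ]; exists (Num.min e e'); first by rewrite lt_min e0.
  move=> t Nt; split; [apply: eP|apply: eQ]; apply: N_le Nt;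
    rewrite ?lt_min ?e0// ge_min lexx ?orbT//.
by move=> P Q PQ [e e0 eP]; exists e => //; exact: subset_trans eP PQ.
Qed.

End fine_filter.

(** * Continuity of connectives and moduli in epsilon-delta form *)

Section connectives.
Context {R : realType}.

Lemma ptws_nbhs_box m (x : {ptws 'I_m -> R}) (U : set {ptws 'I_m -> R}) : nbhs x U ->
  exists2 e : R, 0 < e & forall y : 'I_m -> R, (forall i, `|y i - x i| < e) -> U y.
Proof.
pose N (e : R) : set {ptws 'I_m -> R} := [set y | forall i, `|y i - x i| < e].
have NF : Filter (fine_filter N).
  by apply: fine_filter_filter => e e' e0 ee y Ny i; exact: lt_le_trans ee.
have : fine_filter N --> x.
  apply: cvg_prod_topology => i V /nbhs_ballP[e /= e0 eV]; exists e => // y Ny.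
  by apply: eV; rewrite /ball/= distrC; exact: Ny.
by move=> H /H [e e0 eU]; exists e.
Qed.

Lemma ptws_within_cvg m (D : set {ptws 'I_m -> R}) (f : {ptws 'I_m -> R} -> R)
    (x : {ptws 'I_m -> R}) e :
  {within D, continuous f} -> D x -> 0 < e ->
  exists2 eta : R, 0 < eta & forall y : 'I_m -> R, D y ->
    (forall i, `|y i - x i| < eta) -> `|f y - f x| < e.
Proof.
move=> /subspace_continuousP cf Dx e0.
have /(_ (ball (f x) e)) := cf x Dx.
case/(_ _)/ptws_nbhs_box; first exact: nbhsx_ballx.
move=> eta eta0 H; exists eta => // y Dy yx.
by have := H y yx Dy; rewrite /ball/= distrC.
Qed.

Lemma modulus_small n (D : modulus R n) e : 0 < e ->
  exists2 eta : R, 0 < eta & forall x : 'I_n -> R, nonneg x ->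
    (forall i, x i <= eta) -> D x <= e.
Proof.
move=> e0.
have [|eta eta0 H] := ptws_within_cvg (x := fun=> 0) (modulus_cont (m := D)) _ e0.
  by move=> i.
exists (eta / 2); first by rewrite divr_gt0.
move=> x x0 xe; apply: ltW; apply: le_lt_trans (ler_norm _) _.
rewrite -[D x]subr0 -[X in _ - X](modulus0 D); apply: H => // i.
by rewrite subr0 ger0_norm// (le_lt_trans (xe i))// ltr_pdivrMr// ltr_pMr// ltr1n.
Qed.

Context {L : signature R}.

Lemma fin_min_gt0 (n : nat) (eta : 'I_n -> R) : (forall i, 0 < eta i) ->
  exists2 e : R, 0 < e & forall i, e <= eta i.
Proof.
move=> eta0; exists (\big[Num.min/1]_i eta i).
  by apply: lt_bigmin => // i _; exact: eta0.
by move=> i; exact: bigmin_le.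
Qed.

Lemma term_modulus_small n (t : term L n) (e : R) : 0 < e ->
  exists2 eta : R, 0 < eta & forall x : 'I_n -> R, nonneg x ->
    (forall i, x i <= eta) -> term_modulus t x <= e.
Proof.
elim: t e => [i|F ts IH] e e0 /=; first by exists e.
have [eta eta0 H] := modulus_small (fmodulus F) e0.
have /choice[z zP] i : exists z : R, 0 < z /\ forall x : 'I_n -> R, nonneg x ->
    (forall i, x i <= z) -> term_modulus (ts i) x <= eta.
  by have [z z0 zP] := IH i _ eta0; exists z.
have [d d0 dz] := fin_min_gt0 (fun i => (zP i).1).
exists d => // x x0 xd; apply: H => i; first exact: term_modulus_ge0.
by apply: (zP i).2 => // j; exact: le_trans (dz i).
Qed.

Lemma atomic_modulus_small n (phi : atomic L n) (e : R) : 0 < e ->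
  exists2 eta : R, 0 < eta & forall x : 'I_n -> R, nonneg x ->
    (forall i, x i <= eta) -> atomic_modulus phi x <= e.
Proof.
move=> e0.
have [eta eta0 H] := modulus_small (pmodulus (atomic_sym phi)) e0.
have /choice[z zP] i : exists z : R, 0 < z /\ forall x : 'I_n -> R, nonneg x ->
    (forall i, x i <= z) -> term_modulus (atomic_args (a:=phi) i) x <= eta.
  by have [z z0 zP] := term_modulus_small (atomic_args (a:=phi) i) eta0; exists z.
have [d d0 dz] := fin_min_gt0 (fun i => (zP i).1).
exists d => // x x0 xd; apply: H => i; first exact: term_modulus_ge0.
by apply: (zP i).2 => // j; exact: le_trans (dz i).
Qed.

End connectives.

Section codes.
Context {R : realType} {L : signature R}.

Definition coordinate : Type := {s : rsym L & 'I_(rarity s) -> nat}.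

Definition cval (k : coordinate) (p : code_space L) : R := p (projT1 k) (projT2 k).

Definition dcoord (i j : nat) : coordinate :=
  existT (fun s : rsym L => 'I_(rarity s) -> nat) (inl None)
    (fun k : 'I_2 => if k == ord0 then i else j).

Definition pcoord (P : psym L) (j : 'I_(parity P) -> nat) : coordinate :=
  existT (fun s : rsym L => 'I_(rarity s) -> nat) (inl P) j.

Definition fcoord (F : Defs.fsym L) (j : 'I_(farity F) -> nat) (y : nat) : coordinate :=
  existT (fun s : rsym L => 'I_(rarity s) -> nat) (inr F) (snoc j y).

Lemma widen_lift_max n (i : 'I_n) : widen_ord (leqnSn n) i = lift ord_max i.
Proof. by apply/val_inj; apply: esym; exact: lift_max. Qed.

Lemma snoc_lift T n (a : 'I_n -> T) c i : snoc a c (lift ord_max i) = a i.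
Proof. by rewrite /snoc liftK. Qed.

Lemma snoc_max T n (a : 'I_n -> T) c : snoc a c ord_max = c.
Proof. by rewrite /snoc unlift_none. Qed.

Lemma snoc_eta T n (a : 'I_n.+1 -> T) :
  snoc (fun i => a (widen_ord (leqnSn n) i)) (a ord_max) = a.
Proof.
apply/funext => i; case: (unliftP ord_max i) => [j ->|->].
  by rewrite snoc_lift widen_lift_max.
exact: snoc_max.
Qed.

Lemma cval_d (A : structure L) (a : nat -> A) i j :
  cval (dcoord i j) (code_of a) = mdist (a i) (a j).
Proof. by []. Qed.

Lemma cval_p (A : structure L) (a : nat -> A) (P : psym L) (j : 'I_(parity P) -> nat) :
  cval (pcoord j) (code_of a) = pint (a \o j).
Proof. by []. Qed.

Lemma cval_f (A : structure L) (a : nat -> A) (F : Defs.fsym L) (j : 'I_(farity F) -> nat) y :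
  cval (fcoord j y) (code_of a) = mdist (fint (a \o j)) (a y).
Proof.
rewrite /cval/= snoc_max; congr (mdist (fint _) _); apply/funext => i /=.
by rewrite widen_lift_max snoc_lift.
Qed.

Lemma coord_countable : countable_signature L ->
  exists en : nat -> coordinate, forall k, exists i, en i = k.
Proof.
move=> [cF cP].
have [f fi] : exists f : Defs.fsym L -> nat, injective f.
  by have /countable_injP[f fi] := cF; exists f => x y; apply: fi; rewrite inE.
have [g gi] : exists g : other_psym L -> nat, injective g.
  by have /countable_injP[g gi] := cP; exists g => x y; apply: gi; rewrite inE.
pose h (s : rsym L) : nat + option nat :=
  match s with inr F => inl (f F) | inl None => inr None | inl (Some P) => inr (Some (g P)) end.
have hi : injective h.
  move=> [[x|]|x] [[y|]|y] //=; first by case=> /gi ->.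
  by case=> /fi ->.
pose c (k : coordinate) : nat := pickle (h (projT1 k), [seq projT2 k i | i <- enum 'I_(rarity (projT1 k))]).
have ci : injective c.
  move=> [s j] [s' j'] /(pcan_inj pickleK)/= [/hi ss]; subst s' => jj.
  congr existT; apply/funext => i.
  by move/eq_in_map : jj; apply; rewrite mem_enum.
exists (fun n => if pselect (exists k, c k = n) is left H then projT1 (cid H) else dcoord 0 0).
move=> k; exists (c k); case: pselect => [H|]; last by case; exists k.
exact: ci (projT2 (cid H)).
Qed.

Lemma code_nbhs_coord (en : nat -> coordinate) : (forall k, exists i, en i = k) ->
  forall (p : code_space L) (U : set (code_space L)), nbhs p U ->
  exists K : nat, exists2 e : R, 0 < e & forall q,
    (forall i, (i < K)%N -> `|cval (en i) q - cval (en i) p| < e) -> U q.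
Proof.
move=> en_surj p U.
(* One parameter bounds both the error and the number of coordinates tested, those with $i \le
   1/e$. *)
pose N (e : R) : set (code_space L) :=
  [set q | forall i, i%:R * e <= 1 -> `|cval (en i) q - cval (en i) p| < e].
have NF : Filter (fine_filter N).
  apply: fine_filter_filter => e e' e0 ee y Ny i ie; apply: lt_le_trans (ee).
  by apply: Ny; apply: le_trans ie; rewrite ler_wpM2l.
have : fine_filter N --> p.
  apply: cvg_prod_topology => s; apply: cvg_prod_topology => j V.
  move=> /nbhs_ballP[e /= e0 eV]; have [i ik] := en_surj (existT _ s j).
  exists (Num.min e i.+1%:R^-1); first by rewrite lt_min e0/= invr_gt0.
  move=> y Ny; apply: eV; rewrite /ball/= distrC.
  suff ie : i%:R * Num.min e i.+1%:R^-1 <= 1.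
    by have := Ny i ie; rewrite ik lt_min => /andP[].
  rewrite (le_trans (y := i%:R * i.+1%:R^-1))//.
    by rewrite ler_wpM2l// ge_min lexx orbT.
  by rewrite ler_pdivrMr// mul1r ler_nat.
move=> H /H [e e0 eU]; exists (Num.bound e^-1); exists e => // q Hq; apply: eU => i ie.
apply: Hq; rewrite -(ltr_nat R); apply: le_lt_trans (archi_boundP _).
  by rewrite -(mulr1 e^-1) ler_pdivlMl// mulrC.
by rewrite invr_ge0 ltW.
Qed.

Lemma cval_continuous k : continuous (cval k : code_space L -> R).
Proof.
move=> p; rewrite /cval.
have h1 := @proj_continuous {classic rsym L} (fun s : rsym L => {ptws ('I_(rarity s) -> nat) -> R}) (projT1 k) p.
have h2 := @proj_continuous {classic ('I_(rarity (projT1 k)) -> nat)} (fun=> R) (projT2 k) (p (projT1 k)).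
exact: cvg_comp h1 h2.
Qed.

End codes.

(** * Isomorphisms and continuity of formulas *)

Section isomorphisms.
Context {R : realType} {L : signature R}.
Implicit Types (A B C : structure L).

Lemma isomorphic_sym A B : isomorphic A B -> isomorphic B A.
Proof.
move=> [f [[g fg gf] fF fP]]; exists g; split; first by exists f.
- move=> F x; rewrite -[RHS]fg fF; congr (g (fint _)).
  by apply/funext => i /=; rewrite gf.
- by move=> P x; rewrite fP; congr pint; apply/funext => i /=; rewrite gf.
Qed.

Lemma isomorphic_trans A B C : isomorphic A B -> isomorphic B C -> isomorphic A C.
Proof.
move=> [f [bf fF fP]] [g [bg gF gP]]; exists (g \o f); split.
- exact: bij_comp.
- by move=> F x /=; rewrite fF gF.
- by move=> P x; rewrite fP gP.
Qed.

Lemma iso_mdist A B (f : A -> B) :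
  (forall P (x : 'I_(parity P) -> A), @pint _ L A P x = @pint _ L B P (f \o x)) ->
  forall x y, mdist (f x) (f y) = mdist x y.
Proof. by move=> fP x y; have := fP None (fun k : 'I_2 => if k == ord0 then x else y); rewrite /= => ->. Qed.

Lemma iso_basic_eval A B (f : A -> B) :
  (forall F (x : 'I_(farity F) -> A), f (fint x) = fint (f \o x)) ->
  (forall P (x : 'I_(parity P) -> A), @pint _ L A P x = @pint _ L B P (f \o x)) ->
  forall n (phi : basic L n) (a : 'I_n -> A), basic_eval phi (f \o a) = basic_eval phi a.
Proof.
move=> fF fP n phi a; rewrite /basic_eval; congr (basic_fun _); apply/funext => i.
rewrite /atomic_eval fP; congr pint; apply/funext => j /=.
by elim: (atomic_args _) => [k|F ts IH] //=; rewrite fF; congr fint; apply/funext.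
Qed.

Lemma bfle_iso Th (W : wellOrder) (g : W) A B (f : A -> B) n (a : nat -> A) :
  gauge Th -> inhabited A -> bijective f ->
  (forall F (x : 'I_(farity F) -> A), f (fint x) = fint (f \o x)) ->
  (forall P (x : 'I_(parity P) -> A), @pint _ L A P x = @pint _ L B P (f \o x)) ->
  bfle Th g n a (f \o a) 0.
Proof.
move=> gT iA [f' ff' f'f] fF fP; have iB : inhabited B by case: iA => x; split; exact: (f x).
elim/(well_founded_ind (@wo_wf W)): g n a => g IH n a; apply/bfleP => //; split=> //.
  move=> phi _; rewrite (_ : restr n (f \o a) = f \o restr n a)//.
  by rewrite (iso_basic_eval fF fP) subrr normr0.
move=> g' g'g e' e0.
have K c : bfle Th g' n.+1 (upd a n c) (upd (f \o a) n (f c)) e'.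
  have -> : upd (f \o a) n (f c) = f \o upd a n c.
    by apply/funext => i; rewrite /upd /=; case: ifP.
  by apply: bfle_weaken (lexx _) (ltW e0) (IH _ g'g _ _).
split=> [c|d]; first by exists (f c).
by exists (f' d); rewrite -{2}(f'f d).
Qed.

Lemma tail_denseP A (a : nat -> A) : tail_dense a <->
  forall x (e : R) N, 0 < e -> exists2 k, (N <= k)%N & mdist x (a k) < e.
Proof.
split=> [ta x e N e0|H k O [x Ox] oO].
  have [y [bxy [k /= Nk ak]]] := ta N (interior (ball x e))
    (ex_intro _ x (nbhsx_ballx x e e0)) (@open_interior _ _).
  exists k; first exact: ltnW.
  by have := interior_subset bxy; rewrite -ak ballEmdist.
have /nbhs_ballP[e /= e0 eO] := open_nbhs_nbhs (conj oO Ox).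
have [i ki xi] := H x e k.+1 e0; exists (a i); split; last by exists i.
by apply: eO; rewrite ballEmdist.
Qed.

Lemma tail_dense_near A (a : nat -> A) : tail_dense a ->
  forall x (e : R), 0 < e -> exists k, mdist x (a k) < e.
Proof. by move=> /tail_denseP ta x e e0; have [k _ ?] := ta x e 0%N e0; exists k. Qed.

End isomorphisms.

Section continuity_of_formulas.
Context {R : realType} {L : signature R} (en : nat -> coordinate (L := L)).
Hypothesis en_surj : forall k, exists i, en i = k.
Implicit Types (A B : structure L) (p q : code_space L).

Definition near_code (K : nat) (eta : R) p q : Prop :=
  forall i, (i < K)%N -> `|cval (en i) q - cval (en i) p| < eta.

Lemma near_code_le K K' eta eta' p q : (K <= K')%N -> eta' <= eta ->
  near_code K' eta' p q -> near_code K eta p q.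
Proof. by move=> KK ee H i iK; apply: lt_le_trans (H _ _) ee; exact: leq_trans KK. Qed.

Lemma near_code_refl K eta p : 0 < eta -> near_code K eta p p.
Proof. by move=> e0 i _; rewrite subrr normr0. Qed.

Section around.
Context (A : structure L) (a : nat -> A).
Hypothesis a_dense : forall (x : A) (e : R), 0 < e -> exists k, mdist x (a k) < e.

(* Near the code of [A], the value of a term stays near the same point of the dense
   sequence, in every structure. *)
Lemma term_near n (t : term L n) (j : nat -> nat) (e : R) : 0 < e ->
  exists k K, exists2 eta : R, 0 < eta & forall B (b : nat -> B),
    near_code K eta (code_of a) (code_of b) ->
    mdist (term_eval (restr n (b \o j)) t) (b k) < e.
Proof.
elim: t e => [i|F ts IH] e e0 /=.
  by exists (j i), 0%N, 1 => // B b _; rewrite mdistxx.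
have e30 : 0 < e / 3 by rewrite divr_gt0.
have [z z0 Hz] := modulus_small (fmodulus F) e30.
have /choice[k kP] i := IH i _ z0.
have /choice[K KP] := kP.
have /choice[eta etaP] i : exists eta : R, 0 < eta /\ forall B (b : nat -> B),
    near_code (K i) eta (code_of a) (code_of b) ->
    mdist (term_eval (restr n (b \o j)) (ts i)) (b (k i)) < z.
  by have [eta ? ?] := KP i; exists eta.
have [y yP] := a_dense (fint (a \o k)) e30.
have [l lP] := en_surj (fcoord k y).
have [d d0 dP] := fin_min_gt0 (fun i => (etaP i).1).
exists y, (maxn l.+1 (\max_i K i)), (Num.min d (e / 3)).
  by rewrite lt_min d0.
move=> B b nb.
have := nb l (leq_maxl _ _); rewrite lP !cval_f lt_min => /andP[_ h2].
have h1 : mdist (fint (fun i => term_eval (restr n (b \o j)) (ts i))) (fint (b \o k)) <= e / 3.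
  apply: le_trans (fint_respects _ _) _; apply: Hz => [i|i]; first exact: mdist_ge0.
  apply/ltW/(etaP i).2; apply: near_code_le nb.
    by apply: leq_trans (leq_maxr _ _); exact: leq_bigmax.
  by rewrite ge_min dP.
have h3 := metric_triangle (fint (fun i => term_eval (restr n (b \o j)) (ts i))) (fint (b \o k)) (b y).
have := ler_norm (mdist (fint (b \o k)) (b y) - mdist (fint (a \o k)) (a y)).
lra.
Qed.

Lemma atomic_near n (phi : atomic L n) (j : nat -> nat) (e : R) : 0 < e ->
  exists K, exists2 eta : R, 0 < eta & forall B (b : nat -> B),
    near_code K eta (code_of a) (code_of b) ->
    `|atomic_eval phi (restr n (b \o j)) - atomic_eval phi (restr n (a \o j))| < e.
Proof.
move=> e0; have e30 : 0 < e / 3 by rewrite divr_gt0.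
have [z z0 Hz] := modulus_small (pmodulus (atomic_sym phi)) e30.
have /choice[k kP] i := term_near (atomic_args (a:=phi) i) j z0.
have /choice[K KP] := kP.
have /choice[eta etaP] i : exists eta : R, 0 < eta /\ forall B (b : nat -> B),
    near_code (K i) eta (code_of a) (code_of b) ->
    mdist (term_eval (restr n (b \o j)) (atomic_args (a:=phi) i)) (b (k i)) < z.
  by have [eta ? ?] := KP i; exists eta.
have [l lP] := en_surj (pcoord k).
have [d d0 dP] := fin_min_gt0 (fun i => (etaP i).1).
have h B (b : nat -> B) : near_code (maxn l.+1 (\max_i K i)) (Num.min d (e / 3)) (code_of a) (code_of b) ->
    `|atomic_eval phi (restr n (b \o j)) - pint (b \o k)| <= e / 3.
  move=> nb; apply: le_trans (pint_respects _ _) _; apply: Hz => i; first exact: mdist_ge0.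
  apply/ltW/(etaP i).2; apply: near_code_le nb.
    by apply: leq_trans (leq_maxr _ _); exact: leq_bigmax.
  by rewrite ge_min dP.
have m0 : 0 < Num.min d (e / 3) by rewrite lt_min d0.
exists (maxn l.+1 (\max_i K i)), (Num.min d (e / 3)) => // B b nb.
(* Both structures are compared with the predicate at the same indices [k], that is, with one
   coordinate of their codes. *)
have h1 := h B b nb; have h2 := h A a (@near_code_refl _ _ _ m0).
have := nb l (leq_maxl _ _); rewrite lP !cval_p lt_min => /andP[_ h3].
move: h1 h2 h3; rewrite !ler_norml !ltr_norml => /andP[? ?] /andP[? ?] /andP[? ?].
by apply/andP; split; lra.
Qed.

(** Values of formulas are continuous in the code, uniformly over all structures [B]; this is how
    formulas pass to limits of codes. *)
Lemma basic_near n (phi : basic L n) (j : nat -> nat) (e : R) : 0 < e ->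
  exists K, exists2 eta : R, 0 < eta & forall B (b : nat -> B),
    near_code K eta (code_of a) (code_of b) ->
    `|basic_eval phi (restr n (b \o j)) - basic_eval phi (restr n (a \o j))| < e.
Proof.
move=> e0.
have [z z0 Hz] := ptws_within_cvg (basic_cont (b := phi))
  (box_eval (@basic_atoms _ _ _ phi) (restr n (a \o j))) e0.
have /choice[K KP] i := atomic_near (basic_atoms (b:=phi) i) j z0.
have /choice[eta etaP] i : exists eta : R, 0 < eta /\ forall B (b : nat -> B),
    near_code (K i) eta (code_of a) (code_of b) ->
    `|atomic_eval (basic_atoms (b:=phi) i) (restr n (b \o j)) -
     atomic_eval (basic_atoms (b:=phi) i) (restr n (a \o j))| < z.
  by have [eta ? ?] := KP i; exists eta.
have [d d0 dP] := fin_min_gt0 (fun i => (etaP i).1).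
exists (\max_i K i), d => // B b nb; apply: Hz => [|i]; first exact: box_eval.
apply: (etaP i).2; apply: near_code_le nb => //; exact: leq_bigmax.
Qed.

End around.
End continuity_of_formulas.

(** * Consequences of universality *)

Section universal.
Context {R : realType} {L : signature R} (Om : (nat -> R) -> \bar R).
Hypothesis OmU : universal_weak_modulus L Om.

Lemma universal_gauge : gauge Om.
Proof.
apply: weak_modulus_gauge; [exact: universal_weak OmU|exact: universal_shift OmU].
Qed.

Lemma zpad_zeros_before m k (delta : 'I_k -> R) :
  zpad (zeros_before m delta) = sh m (zpad delta).
Proof.
apply/funext => i; rewrite /sh; case: ltnP => im.
  rewrite (_ : i = @lshift m k (Ordinal im))// zpadE /zeros_before /concat.
  by rewrite (unsplitK (inl (Ordinal im))).
case: (ltnP i (m + k)) => imk; last by rewrite !zpad0// leq_subRL.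
have h : (i - m < k)%N by rewrite ltn_subLR.
rewrite [in LHS](_ : i = @rshift m k (Ordinal h)); last by rewrite /= subnKC.
rewrite zpadE /zeros_before /concat (unsplitK (inr (Ordinal h))).
exact: esym (zpadE delta (Ordinal h)).
Qed.

Lemma universal_scale_nat (k : nat) (M : R) : 0 < M -> exists m : nat,
  forall delta : nat -> R, nonneg delta ->
    (M%:E * Om (tr k delta) <= Om (sh m (tr k delta)))%E.
Proof.
move=> M0; have [m H] := universal_scale OmU k M0; exists m => delta d0.
have := H (restr k delta) (fun i => d0 i).
by rewrite /weak_restr zpad_zeros_before zpad_restr.
Qed.

Lemma sh_tr m k (delta : nat -> R) : sh m (tr k delta) = tr (m + k) (sh m delta).
Proof.
apply/funext => i; rewrite /sh /tr; case: ltnP => im; first by case: ifP.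
by rewrite ltn_subLR.
Qed.

Lemma universal_concat_nat (k n : nat) (delta gamma : nat -> R) :
  nonneg delta -> nonneg gamma ->
  (Om (tr k delta) + Om (tr n gamma) <=
   Om (tr k delta \+ sh k (tr n gamma))%R)%E.
Proof.
move=> d0 g0; have := universal_concat OmU (delta := restr k delta) (gamma := restr n gamma)
  (fun i => d0 i) (fun i => g0 i).
rewrite /weak_restr !zpad_restr; congr (_ <= Om _)%E; apply/funext => i /=.
rewrite {2}/tr /sh; case: ltnP => ik.
  rewrite addr0 (_ : i = @lshift k n (Ordinal ik))// zpadE /concat.
  by rewrite (unsplitK (inl (Ordinal ik))) /tr /= ik.
rewrite [tr k delta i]/tr ltnNge ik add0r; case: (ltnP (i - k) n) => h; last first.
  by rewrite zpad0//; lia.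
rewrite [in LHS](_ : i = @rshift k n (Ordinal h)); last by rewrite /= subnKC.
by rewrite zpadE /concat (unsplitK (inr (Ordinal h))).
Qed.

Lemma sh_sh m n (delta : nat -> R) : sh m (sh n delta) = sh (m + n) delta.
Proof.
apply/funext => i; rewrite /sh; case: ltnP => im; first by rewrite ltn_addr.
by rewrite ltn_subLR// subnDA.
Qed.

(** Conditions (1) and (2) on $\Omega$ combined: late variables absorb any factor. *)
Lemma universal_atomic_scaled k (phi : atomic L k) (M : R) : 0 < M ->
  exists N, forall delta : nat -> R, nonneg delta ->
  ((M * atomic_modulus phi (restr k delta))%:E <= Om (sh N (tr k delta)))%E.
Proof.
move=> M0; have [m1 H1] := universal_atomic OmU phi.
have [m2 H2] := universal_scale_nat (m1 + k) M0.
exists (m2 + m1)%N => delta d0; rewrite -sh_sh.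
have := H2 (sh m1 delta) (sh_ge0 _ d0); rewrite -sh_tr; apply: le_trans.
have := H1 (restr k delta) (fun i => d0 i).
rewrite /weak_restr zpad_zeros_before zpad_restr => h.
by rewrite EFinM lee_pmul2l.
Qed.

Lemma gauge_sh_reindex Th N n m (i : nat -> nat) (delta : nat -> R) : gauge Th ->
  (forall p q, (p < q)%N -> (q < n)%N -> (i p < i q)%N) ->
  (forall p, (p < n)%N -> (N <= i p < m)%N) -> nonneg delta ->
  (Th (sh N (tr n (delta \o i))) <= Th (tr m delta))%E.
Proof.
move=> gT ih im d0; pose j q := if (q < N)%N then q else i (q - N)%N.
(* The empty tuple is treated apart, since [N <= m] is read off from [i 0]. *)
case: n ih im => [|n] ih im.
  rewrite (_ : sh N _ = fun=> 0) ?(gauge0 gT)//.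
    exact: gauge_ge0 (tr_ge0 _ d0).
  by apply/funext => q; rewrite /sh /tr; case: ifP.
have Nm : (N <= m)%N by have := im 0%N; lia.
apply: le_trans (@gauge_reindex _ _ (N + n.+1) m j delta gT _ _ d0).
- apply: (gauge_le gT); first by apply: sh_ge0; apply: tr_ge0 => q; exact: d0.
  move=> q; rewrite sh_tr /tr; case: ifP => // _; rewrite /sh /j /=; case: ifP => // _; exact: d0.
- move=> p q pq qn; rewrite /j; case: (ltnP p N) => pN; case: (ltnP q N) => qN //.
  + by have := im (q - N)%N; lia.
  + lia.
  + by apply: ih; lia.
- move=> p pn; rewrite /j; case: (ltnP p N) => pN; first exact: leq_trans Nm.
  by have := im (p - N)%N; lia.
Qed.

Definition atom_basic n (M : R) (phi : atomic L n) : basic L n.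
Proof.
refine (@Basic R L n 1 (fun=> phi) (fun x => M * x ord0) _).
apply: continuous_subspaceT => x.
have pc : {for x, continuous (fun f : {ptws 'I_1 -> R} => f ord0 : R)}.
  exact: (@proj_continuous 'I_1 (fun=> R) ord0 x).
exact: (@cvgMr _ _ _ _ _ _ _ pc).
Defined.

End universal.

(** * Isomorphism from bounded distance *)

Section limits.
Context {R : realType} {L : signature R}.

Lemma structure_cauchy_seq (A : structure L) (u : nat -> A) :
  (forall e : R, 0 < e -> exists N, forall m n, (N <= m)%N -> (N <= n)%N ->
     mdist (u m) (u n) < e) ->
  exists l : A, forall e : R, 0 < e -> exists N, forall n, (N <= n)%N -> mdist (u n) l < e.
Proof.
move=> uC; have [l ul] : exists l : A, u @ \oo --> l.
  apply: structure_complete; apply: cauchy_exP => e e0.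
  have [N HN] := uC e e0; exists (u N); exists N => // n /= Nn.
  by rewrite ballEmdist; exact: HN.
exists l => e e0; have [N _ HN] := ul _ (nbhsx_ballx l e e0).
exists N => n Nn; have := HN n Nn; by rewrite ballEmdist metric_sym.
Qed.

End limits.

Section asymptotic_isomorphism.
Context {R : realType} {L : signature R} (Om : (nat -> R) -> \bar R).
Hypothesis OmU : universal_weak_modulus L Om.

Lemma atom_basic_respects Th n (phi : atomic L n) (M : R) : 0 <= M ->
  (forall delta, nonneg delta ->
     ((M * atomic_modulus phi (restr n delta))%:E <= Th (tr n delta))%E) ->
  respects Th (atom_basic M phi).
Proof.
move=> M0 H; apply/respectsP => d d0 x y _ _ xy.
apply: le_trans (H d d0); rewrite lee_fin /= -mulrBr normrM ger0_norm//.
by rewrite ler_wpM2l// xy.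
Qed.

Section one_side.
Context (A B : structure L) (a : nat -> A) (b : nat -> B) (C : R).
Hypotheses (C0 : 0 < C) (ab : forall n, bf0le Om n a b C).

(** Multiplied by [C / e] and read at late places, the formula still respects [Om], so its values
    differ by at most [C]. *)
Lemma tail_atomic_close k (phi : atomic L k) (e : R) : 0 < e ->
  exists N, forall i : nat -> nat,
    (forall p q, (p < q)%N -> (q < k)%N -> (i p < i q)%N) ->
    (forall p, (p < k)%N -> (N <= i p)%N) ->
    `|atomic_eval phi (restr k (a \o i)) - atomic_eval phi (restr k (b \o i))| <= e.
Proof.
move=> e0; have M0 : 0 < C / e by rewrite divr_gt0.
have [N HN] := universal_atomic_scaled OmU phi M0.
exists N => i ih iN; pose n := (\max_(p < k) i p).+1.
have ilt p : (p < k)%N -> (i p < n)%N.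
  by move=> pk; rewrite /n ltnS (leq_bigmax (Ordinal pk)).
pose f (p : 'I_k) : 'I_n := Ordinal (ilt _ (ltn_ord p)).
have r : respects Om (atom_basic (C / e) (rename_atomic f phi)).
  apply: atom_basic_respects => [|d d0]; first exact: ltW.
  rewrite atomic_modulus_rename.
  apply: le_trans (HN (d \o i) (fun j => d0 (i j))) _.
  apply: gauge_sh_reindex => //; first exact: universal_gauge OmU.
  by move=> p pk; rewrite iN// ilt.
have := ab r; rewrite /basic_eval/= !atomic_eval_rename -mulrBr normrM.
by rewrite [`|C / e|]gtr0_norm// mulrAC ler_pdivrMr// ler_pM2l.
Qed.

(* The graph of the isomorphism to be constructed. *)
Definition asymp (x : A) (y : B) : Prop := forall (e : R) N, 0 < e ->
  exists k, [/\ (N <= k)%N, mdist (a k) x < e & mdist (b k) y < e].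

(** The indices are chosen one after another, each beyond the previous ones, so that they can be
    substituted for variables in order. *)
Lemma asymp_indices k (x : nat -> A) (y : nat -> B) (e : R) N : 0 < e ->
  (forall p, (p < k)%N -> asymp (x p) (y p)) ->
  exists i : nat -> nat, [/\ forall p q, (p < q)%N -> (q < k)%N -> (i p < i q)%N,
    forall p, (p < k)%N -> (N <= i p)%N &
    forall p, (p < k)%N -> mdist (a (i p)) (x p) < e /\ mdist (b (i p)) (y p) < e].
Proof.
move=> e0; elim: k => [|k IH] xy; first by exists id.
have [i [ih iN iE]] := IH (fun p pk => xy p (ltnW pk)).
have [l [Nl ax bY]] := xy k (ltnSn k) e (maxn N (\max_(p < k) i p).+1) e0.
move: Nl; rewrite geq_max => /andP[Nl il].
exists (upd i k l); split=> [p q pq|p|p]; rewrite /upd ltnS leq_eqVlt => /orP[/eqP qk|qk].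
- rewrite qk ltnn -{1}qk pq; apply: leq_trans il; rewrite ltnS.
  by rewrite qk in pq; exact: (leq_bigmax (Ordinal pq)).
- by rewrite qk (ltn_trans pq qk); exact: ih.
- by rewrite qk ltnn.
- by rewrite qk; exact: iN.
- by rewrite qk ltnn.
- by rewrite qk; exact: iE.
Qed.

Lemma asymp_atomic k (phi : atomic L k) (x : nat -> A) (y : nat -> B) :
  (forall p, (p < k)%N -> asymp (x p) (y p)) ->
  atomic_eval phi (restr k x) = atomic_eval phi (restr k y).
Proof.
move=> xy; apply/eqP; rewrite -subr_eq0 -normr_le0; apply/ler_addgt0Pl => e e0.
rewrite addr0; have e30 : 0 < e / 3 by rewrite divr_gt0.
have [N HN] := tail_atomic_close phi e30.
have [z z0 Hz] := atomic_modulus_small phi e30.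
have [i [ih iN iE]] := asymp_indices N z0 xy.
have h1 := HN i ih iN.
have h2 : `|atomic_eval phi (restr k (a \o i)) - atomic_eval phi (restr k x)| <= e / 3.
  apply: le_trans (atomic_eval_respects _ _ _) _; apply: Hz => p; first exact: mdist_ge0.
  by apply/ltW; exact: (iE p (ltn_ord p)).1.
have h3 : `|atomic_eval phi (restr k (b \o i)) - atomic_eval phi (restr k y)| <= e / 3.
  apply: le_trans (atomic_eval_respects _ _ _) _; apply: Hz => p; first exact: mdist_ge0.
  by apply/ltW; exact: (iE p (ltn_ord p)).2.
move: h1 h2 h3; rewrite !ler_norml => /andP[? ?] /andP[? ?] /andP[? ?].
by apply/andP; split; lra.
Qed.

Definition sym_atomic (P : psym L) : atomic L (parity P) := Atomic (fun i => Var L i).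

(** The formula $d(F(x), y)$, whose vanishing will show that the constructed map commutes with
    [F]. *)
Definition graph_atomic (F : Defs.fsym L) : atomic L (farity F).+1 :=
  @Atomic R L (farity F).+1 None (fun k : 'I_2 =>
    if k == ord0 then App (fun i => Var L (lift ord_max i)) else Var L ord_max).

Lemma asymp_mdist x x' y y' : asymp x y -> asymp x' y' -> mdist x x' = mdist y y'.
Proof.
move=> xy xy'.
by apply: (@asymp_atomic 2 (sym_atomic None) (fun i => if i == 0%N then x else x')
  (fun i => if i == 0%N then y else y')) => -[|[|]].
Qed.

(** Take a subsequence of [a] converging to [x]. Late distances in [b] are close to those in [a], so
    the same indices give a Cauchy sequence in [B], whose limit is the required point. *)
Lemma asymp_total : tail_dense a -> forall x, exists y, asymp x y.
Proof.
move=> /tail_denseP ta x.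
have inv0 k : 0 < k.+1%:R^-1 :> R by rewrite invr_gt0.
have /choice[g gP] (kN : nat * nat) : exists l, (kN.2 <= l)%N /\ mdist x (a l) < kN.1.+1%:R^-1.
  by have [l ? ?] := ta x _ kN.2 (inv0 kN.1); exists l.
pose s := fix s k := if k is k'.+1 then g (k, (s k').+1) else g (0, 0)%N.
have s_lt k : (s k < s k.+1)%N by have [] := gP (k.+1, (s k).+1).
have s_mono : {homo s : p q / (p < q)%N} by apply: homo_ltn => //; exact: ltn_trans.
have s_ge k : (k <= s k)%N by elim: k => // k IH; exact: leq_ltn_trans (s_lt k).
have s_near k : mdist x (a (s k)) < k.+1%:R^-1.
  by case: k => [|k]; [have [] := gP (0, 0)%N|have [] := gP (k.+1, (s k).+1)].
have near e : 0 < e -> exists N, forall k, (N <= k)%N -> mdist x (a (s k)) < e.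
  move=> e0; exists (Num.bound e^-1) => k Nk; apply: lt_trans (s_near k) _.
  rewrite invf_plt ?posrE//; apply: lt_le_trans (archi_boundP _) _.
    by rewrite invr_ge0 ltW.
  by rewrite ler_nat ltnW.
have [e e0|y yP] := structure_cauchy_seq (u := b \o s).
  have e20 : 0 < e / 2 by rewrite divr_gt0.
  have e40 : 0 < e / 4 by rewrite divr_gt0.
  have [N HN] := tail_atomic_close (sym_atomic None) e40.
  have [N' HN'] := near _ e40.
  have K m n : (maxn N N' <= m)%N -> (m < n)%N -> mdist (b (s m)) (b (s n)) < e.
    rewrite geq_max => /andP[Nm N'm] mn.
    have h0 := HN (fun i => if i == 0%N then s m else s n) _ _.
    have {h0} : `|mdist (a (s m)) (a (s n)) - mdist (b (s m)) (b (s n))| <= e / 4.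
      apply: h0 => [p q|p _].
        by case: q => [|[|q]]//; case: p => [|p]// _ _ /=; exact: s_mono.
      case: ifP => _; first exact: leq_trans Nm (s_ge m).
      by apply: leq_trans (s_ge n); apply: leq_trans Nm (ltnW mn).
    have h1 := HN' m N'm; have h2 := HN' n (leq_trans N'm (ltnW mn)).
    have h3 := metric_triangle (a (s m)) x (a (s n)).
    rewrite (metric_sym _ x) in h3.
    rewrite ler_norml => /andP[? ?]; lra.
  exists (maxn N N') => m n Nm Nn; case: (ltngtP m n) => mn.
  - exact: K.
  - by rewrite metric_sym; exact: K.
  - by rewrite mn mdistxx.
exists y => e N e0; have [N1 H1] := near _ e0; have [N2 H2] := yP _ e0.
exists (s (maxn N (maxn N1 N2))); split.
- by apply: leq_trans (s_ge _); rewrite leq_maxl.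
- by rewrite metric_sym; apply: H1; rewrite leq_max leq_max leqnn orbT.
- by apply: H2; rewrite !leq_max leqnn !orbT.
Qed.

End one_side.

Lemma asymp_sym (A B : structure L) (a : nat -> A) (b : nat -> B) (x : A) (y : B) :
  asymp a b x y -> asymp b a y x.
Proof. by move=> xy e N e0; have [k []] := xy e N e0; exists k. Qed.

Theorem tail_isomorphic (A B : structure L) (a : nat -> A) (b : nat -> B) C :
  tail_dense a -> tail_dense b -> (forall n, bf0le Om n a b C) -> isomorphic A B.
Proof.
move=> ta tb abC; pose C' := Num.max C 1.
have C'0 : 0 < C' by rewrite lt_max ltr01 orbT.
have ab n : bf0le Om n a b C'.
  by move=> phi /abC H; apply: le_trans H _; rewrite le_max lexx.
have ba n : bf0le Om n b a C' by move=> phi /ab; rewrite distrC.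
have /choice[f fP] := asymp_total C'0 ab ta.
have /choice[g gP] := asymp_total C'0 ba tb.
have gP' y := asymp_sym (gP y).
exists f; split.
(* Points with a common [asymp] partner are at distance zero. *)
- exists g => [x|y]; apply: mdist_positivity.
    by rewrite (asymp_mdist C'0 ab (gP' (f x)) (fP x)) mdistxx.
  by rewrite -(asymp_mdist C'0 ab (fP (g y)) (gP' y)) mdistxx.
- move=> F x; apply: mdist_positivity; rewrite metric_sym.
  pose u := fun k : nat => if insub k is Some i then x i else fint x.
  have := @asymp_atomic _ _ _ _ _ C'0 ab _ (graph_atomic F) u (f \o u) (fun p _ => fP _).
  rewrite /atomic_eval/=.
  have ux : (fun i => u (lift ord_max i)) = x.
    by apply/funext => i; rewrite /u lift_max valK.
  have uF : u (farity F) = fint x by rewrite /u insubN// -leqNgt.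
  rewrite ux uF mdistxx => /esym <-; congr (mdist (fint _) _).
  by apply/funext => i /=; rewrite -[in LHS]ux.
- move=> P x.
  pose u := fun k : nat => if insub k is Some i then x i else a 0%N.
  have ux : (fun i : 'I_(parity P) => u i) = x by apply/funext => i; rewrite /= /u valK.
  have := @asymp_atomic _ _ _ _ _ C'0 ab _ (sym_atomic P) u (f \o u) (fun p _ => fP _).
  by rewrite /atomic_eval/= ux => ->; congr pint; apply/funext => i /=; rewrite -[in RHS]ux.
Qed.

(** Even stages list [a] and odd stages list [b], so both enumerations are tail-dense. *)
Lemma interleaved_isomorphic (A B : structure L) (a : nat -> A) (b : nat -> B)
    (i j : nat -> nat) (C : R) : tail_dense a -> tail_dense b ->
  (forall l, if odd l then j l = l./2 else i l = l./2) ->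
  (forall n, bf0le Om n (a \o i) (b \o j) C) -> isomorphic A B.
Proof.
move=> /tail_denseP ta /tail_denseP tb book; apply: tail_isomorphic.
- apply/tail_denseP => x e N e0; have [k Nk xk] := ta x e N e0; exists k.*2.
    by rewrite -addnn (leq_trans Nk)// leq_addr.
  by have := book k.*2; rewrite odd_double doubleK /= => ->.
- apply/tail_denseP => x e N e0; have [k Nk xk] := tb x e N e0; exists k.*2.+1.
    by rewrite -addnn ltnW// ltnS (leq_trans Nk)// leq_addr.
  by have := book k.*2.+1; rewrite /= odd_double /= uphalf_double => ->.
Qed.

End asymptotic_isomorphism.

(** * A well-order of type omega_1 *)

Section linear_order.
Context {T : choiceType} (le : rel T).
Hypotheses (le_anti : antisymmetric le) (le_tr : transitive le) (le_tot : total le).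

(** An alias that keeps the proofs in the type, where the order instance can find them. *)
Definition linear_carrier of antisymmetric le & transitive le & total le : Type := T.
Local Notation carrier := (linear_carrier le_anti le_tr le_tot).

HB.instance Definition _ := Choice.on carrier.

Let lt : rel carrier := fun x y => (y != x) && le x y.
Let meet : carrier -> carrier -> carrier := fun x y => if lt x y then x else y.
Let join : carrier -> carrier -> carrier := fun x y => if lt x y then y else x.

HB.instance Definition _ := @Order.isOrder.Build (Order.Disp tt tt) carrier
  le lt meet join (fun _ _ => erefl) (fun _ _ => erefl) (fun _ _ => erefl)
  le_anti le_tr le_tot.

Lemma linear_leE (x y : carrier) : (x <= y)%O = le x y. Proof. by []. Qed.

End linear_order.

Lemma ordinal_enum (W : wellOrder) (w : W) : countable_ordinal w ->
  exists f : nat -> W, forall v, (v < w)%O -> exists n, f n = v.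
Proof.
move=> /countable_injP[f fi].
exists (fun n => if pselect (exists2 v, (v < w)%O & f v = n) is left h
  then projT1 (cid2 h) else w).
move=> v vw; exists (f v); case: pselect => [h|]; last by case; exists v.
by case: (cid2 h) => /= u uw fuv; apply: fi; rewrite ?inE.
Qed.

Section omega1.

(** Each law follows from least elements of sets with at most three points. *)
Lemma well_order_linear (T : eqType) (le : rel T) : well_order le ->
  [/\ antisymmetric le, transitive le & total le].
Proof.
move=> wo.
have refl x : le x x.
  have [|z [[]]] := wo (pred1 x); first by exists x; rewrite inE.
  by rewrite inE => /eqP -> /(_ x); rewrite inE; move/(_ (eqxx _)).
have tot : total le.
  move=> x y; have [|z [[]]] := wo (pred2 x y); first by exists x; rewrite !inE eqxx.
  rewrite !inE => /orP[]/eqP-> H _; apply/orP; [left|right]; apply: H;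
    by rewrite !inE eqxx ?orbT.
have anti : antisymmetric le.
  move=> x y /andP[xy yx]; have [|z [_ zu]] := wo (pred2 x y).
    by exists x; rewrite !inE eqxx.
  have <- : z = x.
    apply: zu; split; rewrite ?inE ?eqxx// => w; rewrite !inE => /orP[]/eqP->//.
  apply: zu; split; rewrite ?inE ?eqxx ?orbT// => w; rewrite !inE => /orP[]/eqP->//.
split=> // y x z xy yz.
have /orP[//|zx] := tot x z.
have [|w [[]]] := wo (pred3 x y z); first by exists x; rewrite !inE eqxx.
rewrite !inE => /or3P[]/eqP-> H _.
- by apply: H; rewrite !inE eqxx !orbT.
- have yx : le y x by apply: H; rewrite !inE eqxx.
  by rewrite (anti x y) ?xy.
- have zy : le z y by apply: H; rewrite !inE eqxx !orbT.
  by rewrite (anti z y) ?zy.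
Qed.

(* These properties characterise the order type omega_1. *)
Record omega1_like (W : wellOrder) : Prop := {
  omega1_inhabited : inhabited W ;
  omega1_countable : forall w : W, countable_ordinal w ;
  omega1_bound : forall f : nat -> W, exists w : W, forall n, (f n < w)%O
}.

Lemma uncountable_set_nat : ~ countable [set: set nat].
Proof.
move=> /countable_injP[f fi].
have finj A B : f A = f B -> A = B by apply: fi; rewrite inE.
pose D : set nat := [set n | exists2 A, f A = n & ~ A n].
have [DD|nD] := pselect (D (f D)).
  by case: (DD) => A /finj -> .
by apply: (nD); exists D.
Qed.

(** The points with countably many predecessors in a well-order of [set nat]. Were they countable in
    number, the first point beyond them would also have countably many predecessors. *)
Lemma omega1_exists : exists W : wellOrder, omega1_like W.
Proof.
have [le wo] := well_ordering_principle (set nat).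
have [anti tr tot] := well_order_linear wo.
pose P (x : set nat) := `[< countable [set y | le y x] >].
pose S := {x : set nat | P x}.
pose leS : rel S := fun x y => le (val x) (val y).
have antiS : antisymmetric leS by move=> x y /anti /val_inj.
have trS : transitive leS by move=> y x z; exact: tr.
have totS : total leS by move=> x y; exact: tot.
pose C : orderType _ := linear_carrier antiS trS totS.
have wf : well_founded (fun v w : C => (v < w)%O).
  move=> x0; apply: contrapT => nx0.
  pose bad : {pred set nat} := fun x => `[< exists2 y : C, ~ Acc (fun v w : C => (v < w)%O) y & val y = x >].
  have [|z [[]]] := wo bad; first by exists (val x0); apply/asboolP; exists x0.
  rewrite /in_mem /= => /asboolP[y ny <-] H _; apply: ny; split=> w wy.
  apply: contrapT => nw; have : le (val y) (val w) by apply: H; apply/asboolP; exists w.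
  move: wy; rewrite lt_neqAle => /andP[/eqP wy]; rewrite linear_leE /leS => wy' yw.
  by apply: wy; apply: val_inj; apply: anti; rewrite wy' yw.
pose W := @WellOrder _ C wf; exists W.
have segs (w : W) : countable [set v : W | (v <= w)%O].
  have /asboolP/countable_injP[f fi] := valP w.
  apply/countable_injP; exists (f \o val) => x y.
  rewrite !inE /= => xw yw fxy; apply: val_inj; apply: fi => //; rewrite inE/=; exact.
have Sunc : ~ countable [set: W].
  move=> Sc.
  have /countable_injP[f fi] := Sc.
  have finj x y : f x = f y -> x = y by apply: fi; rewrite inE.
  (* Points outside [S] get index 0, which is therefore free for the first of them. *)
  pose g (x : set nat) := if pselect (P x) is left h then (f (exist _ x h)).+1 else 0%N.
  have gP x y : P x -> P y -> g x = g y -> x = y.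
    by move=> Px Py; rewrite /g; case: pselect => // hx; case: pselect => // hy [/finj[]].
  have [allP|] := pselect (forall x, P x).
    apply: uncountable_set_nat; apply/countable_injP; exists g => x y _ _; exact: gP.
  move=> /existsNP[x0 nx0].
  have [|m [[]]] := wo (fun x => ~~ P x); first by exists x0; apply/negP.
  rewrite /in_mem /= => nPm H _; move/negP: (nPm); apply; apply/asboolP.
  have h y : le y m -> y = m \/ P y.
    move=> ym; have [Py|nPy] := boolP (P y); first by right.
    by left; apply: anti; rewrite ym /=; exact: H.
  apply/countable_injP; exists g => x y; rewrite !inE /= => /h xm /h ym.
  have gm : g m = 0%N by rewrite /g; case: pselect => // Pm; rewrite Pm in nPm.
  have gn z : P z -> g z <> 0%N by rewrite /g; case: pselect.
  case: xm => [->|Px]; case: ym => [->|Py] //; last exact: gP.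
    by rewrite gm => /esym /(gn _ Py).
  by rewrite gm => /(gn _ Px).
split=> [|w|f].
- apply: contrapT => nW; apply: Sunc; rewrite (_ : [set: W] = set0); first exact: countable0.
  by apply/seteqP; split=> // w _; apply: nW; split.
- have /countable_injP[f fi] := segs w; apply/countable_injP; exists f => x y.
  by rewrite !inE /= => /ltW xw /ltW yw; apply: fi; rewrite inE.
- apply: contrapT => nb; apply: Sunc.
have -> : [set: W] = \bigcup_n [set v : W | (v <= f n)%O].
  apply/seteqP; split=> w // _; apply: contrapT => H; apply: nb; exists w => n.
  by rewrite ltNge; apply/negP => wf'; apply: H; exists n.
by apply: bigcup_countable => // n _; exact: segs.
Qed.

End omega1.

Section omega1_theory.
Context (W : wellOrder) (WO : omega1_like W).

Lemma omega1_succ : exists s : W -> W, forall w, (w < s w)%O.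
Proof.
have /choice[s sP] (w : W) : exists v, (w < v)%O.
  by have [v vP] := omega1_bound WO (fun=> w); exists v; exact: vP 0%N.
by exists s.
Qed.

Lemma omega1_sup_image (f : W -> nat -> W) (w : W) :
  exists u, forall v n, (v <= w)%O -> (f v n < u)%O.
Proof.
have [e eP] := ordinal_enum (omega1_countable WO w).
(* The enumeration [e] covers the points below [w]; the Boolean adds [w] itself. *)
have [u uP] := omega1_bound WO (fun k => if unpickle k is Some (b, i, n)
  then f (if b : bool then e i else w) n else w).
exists u => v n; rewrite le_eqVlt => /orP[/eqP->|/eP[i <-]].
  by have := uP (pickle (false, 0%N, n)); rewrite pickleK.
by have := uP (pickle (true, i, n)); rewrite pickleK.
Qed.

(** The least strict upper bound of a chain each of whose terms exceeds all values of [f] at points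
    up to the previous term. *)
Lemma omega1_closed (f : W -> nat -> W) (w0 : W) : exists2 alpha : W, (w0 < alpha)%O &
  forall v n, (v < alpha)%O -> (f v n < alpha)%O.
Proof.
have /choice[g gP] (w : W) : exists u, (w < u)%O /\ forall v n, (v <= w)%O -> (f v n < u)%O.
  have [u uP] := omega1_sup_image f w; have [s sP] := omega1_succ.
  exists (Order.max (s w) u); split; first by rewrite lt_max sP.
  by move=> v n vw; rewrite lt_max uP// orbT.
pose a k := iter k g w0.
have [b0 b0P] := omega1_bound WO a.
have [b [bP bmin]] : exists b, (forall k, (a k < b)%O) /\ forall c, (forall k, (a k < c)%O) -> (b <= c)%O.
  apply: contrapT => nb.
  suff H c : ~ forall k, (a k < c)%O by exact: H b0P.
  elim/(well_founded_ind (@wo_wf W)): c => c IH ac; apply: nb; exists c; split=> // d ad.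
  by rewrite leNgt; apply/negP => /IH; exact.
exists b => [|v n vb]; first exact: bP 0%N.
have [k vk] : exists k, (v <= a k)%O.
  apply: contrapT => H; have := bmin v; rewrite leNgt vb => /(_ _)/negP; apply=> // k.
  by rewrite ltNge; apply/negP => vk; apply: H; exists k.
by apply: lt_trans (bP k.+1); exact: (gP (a k)).2.
Qed.

End omega1_theory.

(** * Amplification *)

Lemma basic_cont_eps (R : realType) m (D : set {ptws 'I_m -> R}) (f : {ptws 'I_m -> R} -> R) :
  (forall x, D x -> forall e : R, 0 < e -> exists2 eta : R, 0 < eta &
     forall y : 'I_m -> R, D y -> (forall i, `|y i - x i| < eta) -> `|f y - f x| < e) ->
  {within D, continuous f}.
Proof.
move=> H; apply/subspace_continuousP => x Dx U /nbhs_ballP[e /= e0 eU].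
have [eta eta0 etaP] := H x Dx e e0.
have : nbhs x [set y : {ptws 'I_m -> R} | forall i, `|y i - x i| < eta].
  apply: (@filter_forall {ptws 'I_m -> R} 'I_m (fun i y => `|y i - x i| < eta) (nbhs x) (nbhs_filter x)) => i.
  have pc : {for x, continuous (fun f : {ptws 'I_m -> R} => f i : R)}.
    exact: (@proj_continuous 'I_m (fun=> R) i x).
  have h : (fun y : {ptws 'I_m -> R} => is_true (`|y i - x i| < eta)) =
      (fun f : {ptws 'I_m -> R} => f i : R) @^-1` ball (x i) eta.
    by apply/seteqP; split=> y; rewrite /ball/= distrC.
  have nb : nbhs x ((fun f : {ptws 'I_m -> R} => f i : R) @^-1` ball (x i) eta).
    exact: pc (nbhsx_ballx (x i) eta eta0).
  by rewrite -h in nb.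
apply: filterS => y yx Dy; apply: eU; rewrite /ball/= distrC; exact: etaP.
Qed.

Section weights.
Context {R : realType} {L : signature R} (Om : (nat -> R) -> \bar R).
Hypothesis OmU : universal_weak_modulus L Om.
Let gOm := universal_gauge OmU.

Definition gauge_value n (delta : nat -> R) : R := fine (Om (tr n delta)).

Lemma gauge_valueE n delta : nonneg delta -> Om (tr n delta) = (gauge_value n delta)%:E.
Proof. by move=> d0; rewrite fineK// gauge_tr_fin. Qed.

Lemma gauge_value_ge0 n delta : nonneg delta -> 0 <= gauge_value n delta.
Proof. by move=> d0; rewrite -lee_fin -gauge_valueE// (gauge_ge0 gOm)//; exact: tr_ge0. Qed.

Lemma gauge_value_le n delta delta' : nonneg delta ->
  (forall i, (i < n)%N -> delta i <= delta' i) -> gauge_value n delta <= gauge_value n delta'.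
Proof.
move=> d0 dd; have : nonneg (fun i => if (i < n)%N then delta' i else delta i).
  by move=> i; case: ifP => // /dd; exact: le_trans.
move=> d'0; rewrite (_ : gauge_value n delta' = gauge_value n (fun i => if (i < n)%N then delta' i else delta i)).
  rewrite -lee_fin -!gauge_valueE//; apply: (gauge_le gOm); first exact: tr_ge0.
  by move=> i; rewrite /tr; case: ifP => // h; exact: dd.
by rewrite /gauge_value; congr (fine (Om _)); apply/funext => i; rewrite /tr; case: ifP => // ->.
Qed.

Lemma gauge_valueD n delta delta' : nonneg delta -> nonneg delta' ->
  gauge_value n (delta \+ delta') <= gauge_value n delta + gauge_value n delta'.
Proof.
move=> d0 d0'; rewrite -lee_fin EFinD -!gauge_valueE//; last by move=> i; rewrite addr_ge0.
rewrite (_ : tr n (delta \+ delta') = tr n delta \+ tr n delta').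
  by apply: (gauge_subadd gOm); exact: tr_ge0.
by apply/funext => i /=; rewrite /tr; case: ifP; rewrite ?addr0.
Qed.

Lemma gauge_value_dist n x y delta : nonneg x -> nonneg y -> nonneg delta ->
  (forall i, (i < n)%N -> `|x i - y i| <= delta i) ->
  `|gauge_value n x - gauge_value n y| <= gauge_value n delta.
Proof.
have half u v : nonneg u -> nonneg v -> nonneg delta ->
    (forall i, (i < n)%N -> `|u i - v i| <= delta i) -> gauge_value n u - gauge_value n v <= gauge_value n delta.
  move=> u0 v0 d0 uv; rewrite lerBlDl; apply: le_trans (gauge_valueD _ v0 d0).
  apply: gauge_value_le => // i iln /=; have := uv i iln; rewrite ler_norml => /andP[_]; lra.
move=> x0 y0 d0 xy; rewrite ler_norml; apply/andP; split; last exact: half.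
by rewrite lerNl opprB; apply: half => // i iln; rewrite distrC xy.
Qed.

Lemma sh_trS N j (x : nat -> R) :
  sh N (tr j.+1 x) = sh N (tr j x) \+ sh (N + j) (tr 1 (fun=> x j)).
Proof.
apply/funext => k; rewrite /sh /tr /=.
case: (ltnP k N) => kN; first by rewrite ltn_addr// addr0.
rewrite -(subnKC kN) addKn ltn_add2l subnDl; move: (k - N)%N => {kN}k.
rewrite ltnS ltnS leqn0 subn_eq0; case: (ltngtP k j) => [||->]; rewrite ?addr0 ?add0r//.
Qed.

(* Sparse enough positions [i] for which the weight of each variable is
   multiplied by [M]; they exist by conditions (2) and (3) on universal weak
   moduli. *)
Lemma weights (n N : nat) (M : R) : 0 < M -> exists i : nat -> nat,
  [/\ (n <= i 0)%N, {homo i : p q / (p < q)%N} &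
   forall j delta, nonneg delta ->
   (Om (tr n delta) + M%:E * Om (sh N (tr j (delta \o i))) <= Om (tr (i j) delta))%E].
Proof.
move=> M0.
have /choice[g gP] (j : nat) : exists g : nat, forall t : R, 0 <= t ->
    (M%:E * Om (sh (N + j) (tr 1 (fun=> t))) <= Om (sh g (tr 1 (fun=> t))))%E.
  (* Condition (2) is used for tuples supported at the single place [N + j], where [sh N] reads
     variable [j]. *)
  have [m mP] := universal_scale_nat OmU (N + j).+1 M0.
  exists (m + (N + j))%N => t t0.
  have := mP (sh (N + j) (fun=> t)) (sh_ge0 _ (fun=> t0)).
  by rewrite -addn1 -sh_tr sh_sh.
(* [l j] is the first place free after [j] variables, and [g j] the gap left before the next one. *)
pose l := fix l j := if j is j'.+1 then (l j' + g j').+1 else n.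
pose i j := (l j + g j)%N.
have key j delta : nonneg delta ->
    (Om (tr n delta) + M%:E * Om (sh N (tr j (delta \o i))) <= Om (tr (l j) delta))%E.
  move=> d0; elim: j => [|j IH].
    rewrite (_ : sh N _ = fun=> 0); last by apply/funext => k; rewrite /sh /tr; case: ifP.
    by rewrite (gauge0 gOm) mule0 adde0.
  have di0 : nonneg (delta \o i) by move=> k; exact: d0.
  have t0 : nonneg (fun _ : nat => delta (i j)) by move=> _; exact: d0.
  apply: (@le_trans _ _ (Om (tr (l j) delta) + Om (sh (g j) (tr 1 (fun=> delta (i j)))))%E).
    apply: le_trans (leeD IH (gP j _ (d0 (i j)))).
    rewrite -addeA; apply: leeD => //; rewrite -ge0_muleDr; last 2 first.
    - by apply: (gauge_ge0 gOm); apply: sh_ge0; exact: tr_ge0.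
    - by apply: (gauge_ge0 gOm); apply: sh_ge0; exact: tr_ge0.
    apply: lee_wpmul2l; first by rewrite lee_fin ltW.
    rewrite sh_trS.
    by apply: (gauge_subadd gOm); apply: sh_ge0; exact: tr_ge0.
  rewrite sh_tr.
  have s0 : nonneg (sh (g j) (fun=> delta (i j))) by exact: sh_ge0.
  (* Condition (3) joins the two summands, which live on disjoint blocks of places. *)
  apply: le_trans (universal_concat_nat OmU _ _ d0 s0) _.
  rewrite -sh_tr sh_sh; apply: (gauge_le gOm).
    by move=> k; apply: addr_ge0; [exact: tr_ge0|apply: sh_ge0; exact: tr_ge0].
  have -> : (l j.+1 = (i j).+1)%N by [].
  move=> k; rewrite {2}/tr /sh /tr /=; case: (ltngtP k (i j)) => kij.
  - rewrite addr0 ltnS; have -> : (k <= i j)%N by exact: ltnW.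
    by case: ifP => // _; exact: d0.
  - rewrite ltnS leqn0 subn_eq0.
    have -> : (k <= l j + g j)%N = false by apply/negbTE; rewrite -ltnNge.
    rewrite (_ : (k < l j)%N = false) ?addr0; last by rewrite /i in kij; lia.
    by case: ifP => // _; exact: d0.
  - have ijl : (i j < l j)%N = false by apply/negbTE; rewrite -leqNgt; exact: leq_addr.
    by rewrite kij subnn !ltnSn ijl add0r.
have i_lt j : (i j < i j.+1)%N by rewrite /i /=; lia.
exists i; split; first by rewrite /i/= leq_addr.
  by apply: homo_ltn => //; exact: ltn_trans.
move=> j delta d0; apply: le_trans (key j delta d0) _.
apply: (gauge_le gOm); first exact: tr_ge0.
move=> k; rewrite /tr; case: ifP => [kl|_]; last by case: ifP => // _; exact: d0.
by rewrite (leq_trans kl) // /i leq_addr.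
Qed.

End weights.

Section forth.
Context {R : realType} {L : signature R} (W : wellOrder).

(** Plays the terms of [a'] in turn. Each costs one step of [s] in rank and half of the remaining
    slack in error. *)
Lemma forth_many Th (s : W -> W) (A B : structure L) : gauge Th ->
  inhabited A -> inhabited B -> (forall w, (w < s w)%O) ->
  forall k g m (a : nat -> A) (b : nat -> B) e e' (a' : nat -> A), e < e' ->
  (forall i, (i < m)%N -> a' i = a i) ->
  bfle Th (iter k s g) m a b e -> exists2 b' : nat -> B,
    (forall i, (i < m)%N -> b' i = b i) & bfle Th g (m + k) a' b' e'.
Proof.
move=> gT iA iB sP; elim=> [|k IH] g m a b e e' a' ee' aa' ab.
  exists b => //; rewrite addn0; apply: (@bfle_congr _ _ _ _ _ _ _ _ a a' b b) => //.
    by move=> i im; rewrite aa'.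
  exact: bfle_weaken (lexx _) (ltW ee') ab.
move: ab => /bfleP[]// _ _ /(_ _ (sP _)) H.
have [|/(_ (a' m))[d hd] _] := H ((e + e') / 2); first lra.
have [||b' bb' H'] := IH g m.+1 _ _ _ e' a' _ _ hd; first lra.
- move=> i; rewrite ltnS leq_eqVlt /upd => /orP[/eqP->|im]; first by rewrite ltnn.
  by rewrite im aa'.
exists b'; last by rewrite addnS -addSn.
by move=> i im; rewrite bb' ?(ltn_trans im)// /upd im.
Qed.

End forth.

Section amplification.
Context {R : realType} {L : signature R} (Om : (nat -> R) -> \bar R).
Hypothesis OmU : universal_weak_modulus L Om.
Let gOm := universal_gauge OmU.

Definition pair_atomic m (p q : 'I_m) : atomic L m :=
  @Atomic R L m None (fun k : 'I_2 => if k == ord0 then Var L p else Var L q).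

Lemma gauge_le_sh Th N (delta : nat -> R) : gauge Th -> nonneg delta ->
  (Th delta <= Th (sh N delta))%E.
Proof.
move=> gT d0; apply: (@gauge_shift _ _ gT (addn N)) => //.
- by move=> p q; rewrite ltn_add2l.
- by move=> p; rewrite /sh ltnNge leq_addr/= addKn.
- by move=> k H; rewrite /sh; case: ltnP => // Nk; case: (H (k - N)%N); rewrite subnKC.
Qed.

Section combined_formula.
Context (j n m : nat) (phi : basic L j) (f : 'I_j -> 'I_m) (u v : 'I_n -> 'I_m) (s : R).
Local Notation m0 := (@basic_size _ _ _ phi).

Definition combined_atoms : 'I_(m0 + n) -> atomic L m :=
  concat (fun i => rename_atomic f (@basic_atoms _ _ _ phi i)) (fun q => pair_atomic (u q) (v q)).

(** Points of the box need not be distances and may be negative, hence the cut at zero. *)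
Definition combined_dist (z : 'I_(m0 + n) -> R) : nat -> R :=
  fun q => Num.max 0 (zpad (fun k : 'I_n => z (rshift m0 k)) q).

Definition combined_fun (z : 'I_(m0 + n) -> R) : R :=
  s * @basic_fun _ _ _ phi (fun i => z (lshift n i)) - gauge_value Om n (combined_dist z).

Lemma combined_lshift i : combined_atoms (lshift n i) = rename_atomic f (@basic_atoms _ _ _ phi i).
Proof. by rewrite /combined_atoms /concat (unsplitK (inl i)). Qed.

Lemma combined_rshift q : combined_atoms (rshift m0 q) = pair_atomic (u q) (v q).
Proof. by rewrite /combined_atoms /concat (unsplitK (inr q)). Qed.

Lemma combined_box z : box combined_atoms z ->
  box (@basic_atoms _ _ _ phi) (fun i => z (lshift n i)).
Proof. by move=> bz i; have := bz (lshift n i); rewrite combined_lshift. Qed.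

Lemma combined_dist_ge0 z : nonneg (combined_dist z).
Proof. by move=> q; rewrite /combined_dist le_max lexx. Qed.

Lemma combined_dist_lip z z' (delta : nat -> R) : nonneg delta ->
  (forall q : 'I_n, `|z (rshift m0 q) - z' (rshift m0 q)| <= delta q) ->
  `|gauge_value Om n (combined_dist z) - gauge_value Om n (combined_dist z')| <= gauge_value Om n delta.
Proof.
move=> d0 zz; apply: (gauge_value_dist OmU) => // [||i iln]; try exact: combined_dist_ge0.
apply: le_trans (zz (Ordinal iln)).
rewrite /combined_dist -[i]/(nat_of_ord (Ordinal iln)) !zpadE.
move: (z _) (z' _) => a b; rewrite /Num.max; case: ltP => a0; case: ltP => b0; rewrite ?subr0 ?sub0r ?subrr ?normr0 ?normrN ?normr_ge0 //.
  rewrite gtr0_norm// ler_normr; apply/orP; left; lra.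
rewrite gtr0_norm// ler_normr; apply/orP; right; lra.
Qed.

Lemma combined_cont : {within (box combined_atoms : set {ptws 'I_(m0 + n) -> R}), continuous
  (combined_fun : {ptws 'I_(m0 + n) -> R} -> R)}.
Proof.
apply: basic_cont_eps => z bz e e0.
have s0 : 0 < `|s| + 1 by rewrite ltr_wpDl.
have e1 : 0 < e / 2 / (`|s| + 1) by rewrite !divr_gt0.
have [eta1 eta10 H1] := ptws_within_cvg (@basic_cont _ _ _ phi) (combined_box bz) e1.
have e2 : 0 < e / 2 by rewrite divr_gt0.
have [eta2 eta20 H2] := gauge_small gOm n e2.
exists (Num.min eta1 eta2); first by rewrite lt_min eta10.
move=> y bY yz.
have yz1 i : `|y (lshift n i) - z (lshift n i)| < eta1.
  by apply: lt_le_trans (yz _) _; rewrite ge_min lexx.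
have h1 := H1 _ (combined_box bY) yz1.
have h2 : `|gauge_value Om n (combined_dist y) - gauge_value Om n (combined_dist z)| <= e / 2.
  apply: le_trans (_ : gauge_value Om n (fun=> eta2) <= _).
    apply: combined_dist_lip => [_|q]; first exact: ltW.
    by apply/ltW/(lt_le_trans (yz _)); rewrite ge_min lexx orbT.
  by rewrite -lee_fin -(gauge_valueE OmU)//; [apply: H2 => // i; exact: ltW|move=> i; exact: ltW].
rewrite /combined_fun; set P := basic_fun _ in h1 *; set Q := basic_fun _ in h1 *.
have h3 : `|s * P - s * Q| < e / 2.
  rewrite -mulrBr normrM; apply: le_lt_trans (_ : (`|s| + 1) * `|P - Q| < _).
    by apply: ler_wpM2r => //; rewrite lerDl.
  by rewrite mulrC -ltr_pdivlMr.
rewrite (_ : _ - _ = (s * P - s * Q) - (gauge_value Om n (combined_dist y) - gauge_value Om n (combined_dist z))); last by lra.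
apply: le_lt_trans (ler_normB _ _) _; lra.
Qed.

Definition combined_basic : basic L m := @Basic _ _ _ _ combined_atoms _ combined_cont.

Lemma combined_eval (A : structure L) (x : 'I_m -> A) :
  basic_eval combined_basic x = s * basic_eval phi (x \o f) -
    gauge_value Om n (zpad (fun q => mdist (x (u q)) (x (v q)))).
Proof.
rewrite /basic_eval /= /combined_fun; congr (s * basic_fun _ - gauge_value Om n _).
  by apply/funext => i; rewrite combined_lshift atomic_eval_rename.
apply/funext => q; rewrite /combined_dist /zpad; case: insubP => [i _ _|_].
  by rewrite combined_rshift max_r// mdist_ge0.
by rewrite max_l.
Qed.

End combined_formula.

Definition zero_atoms j : 'I_0 -> atomic L j.
Proof. by case. Defined.

Lemma zero_cont j : {within (box (@zero_atoms j) : set {ptws 'I_0 -> R}), continuous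
  ((fun=> 0) : {ptws 'I_0 -> R} -> R)}.
Proof.
apply: basic_cont_eps => x _ e e0; exists 1 => // y _ _.
by rewrite subrr normr0.
Qed.

(** A formula respecting every gauge: it gives the sign of the bound in [amplify0]. *)
Definition zero_basic j : basic L j := @Basic R L j 0 (@zero_atoms j) (fun=> 0) (@zero_cont j).

Section amplify.
Context (n N : nat) (M : R) (I i : nat -> nat).
Hypotheses (M0 : 0 < M) (Imono : forall p q, (p < q)%N -> (q < n)%N -> (I p < I q)%N)
  (i0 : (n <= i 0)%N) (imono : {homo i : p q / (p < q)%N})
  (iw : forall j delta, nonneg delta ->
   (Om (tr n delta) + (M + 1)%:E * Om (sh N (tr j (delta \o i))) <= Om (tr (i j) delta))%E).

Lemma respects_combined j m (phi : basic L j) (f : 'I_j -> 'I_m) (u v : 'I_n -> 'I_m) (s : R) :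
  respects (Om \o sh N) phi -> `|s| <= M -> (forall p : 'I_j, f p = i p :> nat) ->
  (forall q : 'I_n, (u q = q :> nat) /\ (v q = i (I q) :> nat) /\ (I q < j)%N) ->
  (forall p, (p < j)%N -> (i p < m)%N) -> (n <= m)%N ->
  respects Om (combined_basic phi f u v s).
Proof.
move=> /respectsP rphi sM fi uv im nm; apply/respectsP => d d0 z z' bz bz' zz.
have di0 : nonneg (d \o i) by move=> k; exact: d0.
set t := fine (Om (sh N (tr j (d \o i)))).
have tE : Om (sh N (tr j (d \o i))) = t%:E by rewrite /t sh_tr (gauge_valueE OmU)//; exact: sh_ge0.
have h1 : `|@basic_fun _ _ _ phi (fun k => z (lshift n k)) -
    @basic_fun _ _ _ phi (fun k => z' (lshift n k))| <= t.
  rewrite -lee_fin -tE.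
  apply: (rphi (d \o i) di0 _ _ (combined_box bz) (combined_box bz')) => k.
  apply: le_trans (zz (lshift n k)) _; rewrite /= combined_lshift atomic_modulus_rename.
  by apply: atomic_modulus_mono => l; rewrite /= ?fi ?d0.
have h2 : `|gauge_value Om n (combined_dist z) - gauge_value Om n (combined_dist z')| <= gauge_value Om n d + t.
  apply: le_trans (_ : gauge_value Om n (d \+ (d \o i \o I)) <= _).
    apply: combined_dist_lip => [k|q]; first by rewrite /= addr_ge0.
    apply: le_trans (zz (rshift _ q)) _; rewrite /= combined_rshift.
    by rewrite /atomic_modulus /= /d_modulus_fun /= (uv q).1 (uv q).2.1.
  have dI0 : nonneg (d \o i \o I) by move=> k; exact: d0.
  apply: le_trans (gauge_valueD OmU n d0 dI0) _.
  rewrite lerD2l -lee_fin -(gauge_valueE OmU)// -tE.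
  apply: le_trans (gauge_reindex (m := j) gOm Imono _ di0) _.
    by move=> p pn; have [_ []] := uv (Ordinal pn).
  by apply: gauge_le_sh => //; exact: tr_ge0.
(* Of the weight [M + 1], the part [M] pays for [s * phi] and 1 for the copies [i (I q)] in the
   anchor; the first [n] variables are paid for by [gauge_value Om n d]. *)
have h3 : gauge_value Om n d + (M + 1) * t <= gauge_value Om m d.
  rewrite -lee_fin -!(gauge_valueE OmU)// EFinD EFinM -tE -(gauge_valueE OmU)//.
  (* Cut at [m], because the bound on weights reads all places below [i j], possibly beyond the
     variables of the formula. *)
  pose d' k := if (k < m)%N then d k else 0.
  have d'0 : nonneg d' by move=> k; rewrite /d'; case: ifP.
  have := iw j d'0.
  rewrite (_ : tr n d' = tr n d); last first.
    by apply/funext => k; rewrite /tr /d'; case: ifP => // kn; rewrite (leq_trans kn).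
  rewrite (_ : tr j (d' \o i) = tr j (d \o i)); last first.
    by apply/funext => k; rewrite /tr /d' /=; case: ifP => // kj; rewrite im.
  move=> h; apply: le_trans h _; apply: (gauge_le gOm); first exact: tr_ge0.
  by move=> k; rewrite /tr /d'; case: ifP => //; case: ifP.
rewrite (gauge_valueE OmU)// lee_fin; apply: le_trans h3; rewrite /= /combined_fun.
rewrite (_ : _ - _ - _ = s * (@basic_fun _ _ _ phi (fun k => z (lshift n k)) -
    @basic_fun _ _ _ phi (fun k => z' (lshift n k))) -
    (gauge_value Om n (combined_dist z) - gauge_value Om n (combined_dist z'))); last by lra.
apply: le_trans (ler_normB _ _) _; rewrite normrM.
have h4 := ler_pM (normr_ge0 _) (normr_ge0 _) sM h1; lra.
Qed.

Definition anchor (A : structure L) (x : nat -> A) : R :=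
  gauge_value Om n (fun q => mdist (x q) (x (i (I q)))).

Context (W : wellOrder) (s : W -> W) (sP : forall w, (w < s w)%O).

Lemma amplify0 (g : W) (A B : structure L) j m (x : nat -> A) (x' : nat -> B) e :
  inhabited A -> inhabited B ->
  (forall p, (p < n)%N -> (I p < j)%N) -> (n <= m)%N ->
  (forall p, (p < j)%N -> (i p < m)%N) -> bfle Om g m x x' e ->
  0 <= (e + anchor x - anchor x') / M /\
  bf0le (Om \o sh N) j (x \o i) (x' \o i) ((e + anchor x - anchor x') / M).
Proof.
move=> iA iB Ij nm im /bfleP[]// e0 h0 _.
pose f (p : 'I_j) : 'I_m := Ordinal (im _ (ltn_ord p)).
pose u (q : 'I_n) : 'I_m := widen_ord nm q.
pose v (q : 'I_n) : 'I_m := Ordinal (im _ (Ij _ (ltn_ord q))).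
have vE (C : structure L) (y : nat -> C) :
    gauge_value Om n (zpad (fun q => mdist (restr m y (u q)) (restr m y (v q)))) = anchor y.
  rewrite /anchor /gauge_value tr_zpad -zpad_restr; congr (fine (Om (zpad _))).
have key phi : respects (Om \o sh N) phi ->
    `|basic_eval phi (restr j (x \o i)) - basic_eval phi (restr j (x' \o i))| <=
      (e + anchor x - anchor x') / M.
  move=> rphi; rewrite ler_pdivlMr// mulrC.
  have H t : `|t| <= M -> `|t * basic_eval phi (restr j (x \o i)) - anchor x -
      (t * basic_eval phi (restr j (x' \o i)) - anchor x')| <= e.
    move=> tM; rewrite -!vE -!(combined_eval (m := m) phi f u v t).
    by apply: h0; apply: respects_combined => // q; rewrite Ij.
  have nM : `|M| <= M by rewrite gtr0_norm.
  have := H M nM; have := H (- M); rewrite normrN => /(_ nM).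
  rewrite !ler_norml => /andP[_ k1] /andP[_ k2].
  rewrite -[M in M * _]gtr0_norm// -normrM ler_norml; apply/andP; split; lra.
split=> //.
have rz : respects (Om \o sh N) (zero_basic j).
  apply/respectsP => d d0 z z' _ _ _; rewrite [basic_fun]/= subrr normr0.
  by apply: (gauge_ge0 gOm); apply: sh_ge0; exact: tr_ge0.
exact: le_trans (key _ rz).
Qed.

Lemma anchor_congr (A : structure L) (x y : nat -> A) m :
  (n <= m)%N -> (forall p, (p < n)%N -> (i (I p) < m)%N) ->
  (forall p, (p < m)%N -> x p = y p) -> anchor x = anchor y.
Proof.
move=> nm im xy; rewrite /anchor /gauge_value; congr (fine (Om _)); apply/funext => k.
by rewrite /tr; case: ifP => // kn; rewrite !xy ?im//; exact: leq_trans nm.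
Qed.

End amplify.

(* Let [t] be at most [M] in absolute value. For a formula [phi] respecting
   [Om \o sh N], the formula [t * phi - anchor], with [phi] read at the positions
   [i], respects [Om]: the anchor absorbs the mismatch between the first [n]
   variables and those at [i \o I]. Taking [t = M] and [t = - M] bounds the
   variation of [phi] by that of the anchor over [M]. *)
Theorem amplify (W : wellOrder) (WO : omega1_like W) (g : W) : exists g' : W,
  forall (n N : nat) (M : R) (I i : nat -> nat), 0 < M ->
  (forall p q, (p < q)%N -> (q < n)%N -> (I p < I q)%N) ->
  {homo i : p q / (p < q)%N} ->
  (forall j delta, nonneg delta ->
   (Om (tr n delta) + (M + 1)%:E * Om (sh N (tr j (delta \o i))) <= Om (tr (i j) delta))%E) ->
  forall (A B : structure L) j m (x : nat -> A) (x' : nat -> B) e,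
  inhabited A -> inhabited B ->
  (forall p, (p < n)%N -> (I p < j)%N) -> (n <= m)%N ->
  (forall p, (p < j)%N -> (i p < m)%N) -> (m <= i j)%N ->
  bfle Om g' m x x' e ->
  bfle (Om \o sh N) g j (x \o i) (x' \o i) ((e + anchor n I i x - anchor n I i x') / M).
Proof.
have [s sP] := omega1_succ WO.
elim/(well_founded_ind (@wo_wf W)): g => g IH.
have /choice[h hP] (g1 : W) : exists g1' : W, (g1 < g)%O -> _ := 
  match pselect (g1 < g)%O with
  | left H => let: ex_intro g1' H' := IH g1 H in ex_intro _ g1' (fun _ => H')
  | right H => ex_intro _ g1 (fun H' => match H H' with end)
  end.
(* From rank [g'] one can play any number [k] of moves and still have the rank [h v] that
   amplification at [v] requires. *)
have [g' g'P] := omega1_sup_image WO (fun v k => iter k s (h v)) g.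
exists g' => n N M I i M0 Imono imono iw A B j m x x' e iA iB Ij nm im mi xx'.
have gN : gauge (Om \o sh N) by exact: gauge_sh.
have [c0 cP] := amplify0 M0 Imono iw iA iB Ij nm im xx'.
apply/bfleP => //; split=> // g1 g1g e1 ce1.
have iIm p : (p < n)%N -> (i (I p) < m)%N by move=> /Ij /im.
(* Move [j] of the subtuple sits at place [i j], which is reached by first filling the places from
   [m] on. *)
pose k := ((i j).+1 - m)%N.
have mk : (m + k = (i j).+1)%N by rewrite subnKC// leqW.
(* The error that amplification turns into exactly [e1]; the anchors only read places below [m], so
   the new moves do not change them. *)
pose e2 := e1 * M - anchor n I i x + anchor n I i x'.
have ee2 : e < e2 by move: ce1; rewrite /e2 ltr_pdivrMr//; lra.
have fin (a' : nat -> A) (b' : nat -> B) : (forall p, (p < m)%N -> a' p = x p) ->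
    (forall p, (p < m)%N -> b' p = x' p) -> bfle Om (h g1) (m + k) a' b' e2 ->
    bfle (Om \o sh N) g1 j.+1 (upd (x \o i) j (a' (i j))) (upd (x' \o i) j (b' (i j))) e1.
  move=> a'x b'x H.
  have := hP g1 g1g n N M I i M0 Imono imono iw A B j.+1 (m + k)%N _ _ _ iA iB _ _ _ _ H.
  rewrite (anchor_congr nm iIm a'x) (anchor_congr nm iIm b'x).
  rewrite (_ : (e2 + _ - _) / M = e1); last first.
    by rewrite /e2 (_ : _ + _ - _ = e1 * M) ?mulfK ?gt_eqF//; lra.
  move=> H'; apply: bfle_congr (H' _ _ _ _) => [p|p||||].
  - rewrite ltnS leq_eqVlt /upd /= => /orP[/eqP->|pj]; first by rewrite ltnn.
    by rewrite pj a'x// im.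
  - rewrite ltnS leq_eqVlt /upd /= => /orP[/eqP->|pj]; first by rewrite ltnn.
    by rewrite pj b'x// im.
  - by move=> p pn; rewrite ltnS ltnW// Ij.
  - by rewrite (leq_trans nm)// leq_addr.
  - by move=> p; rewrite mk !ltnS leq_eqVlt => /orP[/eqP->//|/imono/ltnW].
  - by rewrite mk; exact: imono.
have xx2 : bfle Om (iter k s (h g1)) m x x' e.
  by apply: bfle_weaken xx' => //; apply/ltW/g'P/ltW.
split=> [c|d].
  have a'x p : (p < m)%N -> (if (p < m)%N then x p else c) = x p by move=> ->.
  have [b' b'y H] := forth_many gOm iA iB sP ee2 a'x xx2.
  by exists (b' (i j)); have := fin _ _ a'x b'y H; rewrite ltnNge mi.
have b'x p : (p < m)%N -> (if (p < m)%N then x' p else d) = x' p by move=> ->.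
have [a' a'x H] := forth_many gOm iB iA sP ee2 b'x (bfle_sym gOm iA iB xx2).
by exists (a' (i j)); have := fin _ _ a'x b'x (bfle_sym gOm iB iA H); rewrite ltnNge mi.
Qed.

End amplification.

(** * Completion *)

Section completion.
Context {R : realType}.

Lemma inv_natS_gt0 (k : nat) : 0 < k.+1%:R^-1 :> R.
Proof. by rewrite invr_gt0. Qed.

Lemma inv_natS_small (e : R) : 0 < e ->
  exists N, forall k, (N <= k)%N -> k.+1%:R^-1 < e.
Proof.
move=> e0; exists (Num.bound e^-1) => k Nk.
rewrite invf_plt ?posrE//; apply: lt_le_trans (archi_boundP _) _.
  by rewrite invr_ge0 ltW.
by rewrite ler_nat ltnW.
Qed.

(* Completeness and limits for a distance on a type without topology, so that
   they apply both to the reals and to the completion below. *)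
Record complete_distance (Z : Type) (D : Z -> Z -> R) : Prop := {
  cdist_xx : forall x, D x x = 0 ;
  cdist_eq : forall x y, D x y = 0 -> x = y ;
  cdist_sym : forall x y, D x y = D y x ;
  cdist_triangle : forall x y z, D x z <= D x y + D y z ;
  cdist_complete : forall u : nat -> Z,
    (forall e, 0 < e -> exists N, forall m n, (N <= m)%N -> (N <= n)%N -> D (u m) (u n) <= e) ->
    exists l, forall e, 0 < e -> exists N, forall n, (N <= n)%N -> D (u n) l <= e
}.

Lemma cdist_ge0 Z (D : Z -> Z -> R) x y : complete_distance D -> 0 <= D x y.
Proof.
move=> cD; have := cdist_triangle cD x y x; rewrite (cdist_xx cD) (cdist_sym cD y); lra.
Qed.

Lemma real_complete_distance : complete_distance (fun x y : R => `|x - y|).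
Proof.
split.
- by move=> x; rewrite subrr normr0.
- by move=> x y /normr0P; rewrite subr_eq0 => /eqP.
- by move=> x y; rewrite distrC.
- by move=> x y z; rewrite -[x - z](subrKA y); exact: ler_normD.
move=> u uC.
have /cvg_ex[/= l ul] : cvgn (u : nat -> R^o).
  apply: cauchy_cvg; apply: cauchy_exP => e e0.
  have [|N HN] := uC (e / 2); first by rewrite divr_gt0.
  exists (u N); exists N => // n /= Nn; rewrite /ball/=.
  apply: le_lt_trans (HN N n (leqnn _) Nn) _; lra.
exists l => e e0; have [N _ HN] := ul _ (nbhsx_ballx l e e0).
by exists N => n Nn; have := HN n Nn; rewrite /ball/= distrC => /ltW.
Qed.

Section pseudo_metric.
Context (rho : nat -> nat -> R).

Definition pseudo_dist : Prop := [/\ forall i, rho i i = 0,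
  forall i j, rho i j = rho j i & forall i j k, rho i k <= rho i j + rho j k].

Hypothesis rhoP : pseudo_dist.

Let rho_xx i : rho i i = 0. Proof. by case: rhoP. Qed.
Let rho_sym i j : rho i j = rho j i. Proof. by case: rhoP. Qed.
Let rho_triangle i j k : rho i k <= rho i j + rho j k. Proof. by case: rhoP. Qed.

(* A point of the completion is encoded by its distances to the points of nat. *)
Definition completion_pred (f : nat -> R) : bool :=
  `[< forall e, 0 < e -> exists i, forall j, `|f j - rho i j| <= e >].

Definition completion of pseudo_dist : Type := {f : nat -> R | completion_pred f}.
Local Notation K := (completion rhoP).

HB.instance Definition _ := gen_eqMixin K.
HB.instance Definition _ := gen_choiceMixin K.

(** The supremum distance of the Kuratowski embedding. *)
Definition completion_dist (f g : K) : R := sup (range (fun j => `|val f j - val g j|)).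

Lemma completion_approx (f : K) e : 0 < e -> exists i, forall j, `|val f j - rho i j| <= e.
Proof. by case: f => f /= /asboolP; exact. Qed.

Lemma completion_bounded (f g : K) : exists M, forall j, `|val f j - val g j| <= M.
Proof.
have [i fi] := completion_approx f ltr01; have [k gk] := completion_approx g ltr01.
exists (2 + rho i k) => j; have := fi j; have := gk j.
have := rho_triangle i k j; have := rho_triangle k i j; rewrite (rho_sym k i).
rewrite !ler_norml => h1 h2 /andP[h3 h4] /andP[h5 h6]; apply/andP; split; lra.
Qed.

Lemma completion_dist_ge (f g : K) j : `|val f j - val g j| <= completion_dist f g.
Proof.
apply: ub_le_sup; last by exists j.
by have [M HM] := completion_bounded f g; exists M => _ [k _ <-].
Qed.

Lemma completion_dist_le (f g : K) M :
  (forall j, `|val f j - val g j| <= M) -> completion_dist f g <= M.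
Proof.
move=> H; apply: ge_sup; first by exists `|val f 0%N - val g 0%N|; exists 0%N.
by move=> _ [k _ <-].
Qed.

Lemma completion_dist_xx f : completion_dist f f = 0.
Proof.
apply/eqP; rewrite eq_le; apply/andP; split.
  by apply: completion_dist_le => j; rewrite subrr normr0.
by apply: le_trans (completion_dist_ge f f 0%N).
Qed.

Lemma completion_dist_eq f g : completion_dist f g = 0 -> f = g.
Proof.
move=> fg; apply: val_inj; apply/funext => j; apply/eqP.
by rewrite -subr_eq0 -normr_le0 -fg completion_dist_ge.
Qed.

Lemma completion_dist_sym f g : completion_dist f g = completion_dist g f.
Proof.
rewrite /completion_dist; congr (sup (image _ _)).
by apply/funext => j; rewrite distrC.
Qed.

Lemma completion_dist_triangle g f h :
  completion_dist f h <= completion_dist f g + completion_dist g h.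
Proof.
apply: completion_dist_le => j; rewrite -[val f j - _](subrKA (val g j)).
apply: le_trans (ler_normD _ _) _; apply: lerD; exact: completion_dist_ge.
Qed.

HB.instance Definition _ := @isMetric.Build R K completion_dist
  completion_dist_xx completion_dist_eq completion_dist_sym completion_dist_triangle.

Lemma completion_point_subproof i : completion_pred (rho i).
Proof. by apply/asboolP => e e0; exists i => j; rewrite subrr normr0 ltW. Qed.

Definition completion_point (i : nat) : K :=
  exist (fun f : nat -> R => completion_pred f) _ (completion_point_subproof i).

Lemma completion_point_dist i j :
  mdist (completion_point i) (completion_point j) = rho i j.
Proof.
apply/eqP; rewrite eq_le; apply/andP; split.
  apply: completion_dist_le => k /=; rewrite ler_norml.
  have := rho_triangle i j k; have := rho_triangle j i k; rewrite (rho_sym j i).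
  by move=> h1 h2; apply/andP; split; lra.
have := completion_dist_ge (completion_point i) (completion_point j) j.
by rewrite /= rho_xx subr0; apply: le_trans; exact: ler_norm.
Qed.

Lemma completion_point_dense (f : K) e : 0 < e -> exists i, mdist f (completion_point i) <= e.
Proof.
by move=> /(completion_approx f)[i fi]; exists i; exact: completion_dist_le.
Qed.

(** Pointwise limits of Cauchy sequences are uniform limits, hence still approximated by the
    functions [rho i]. *)
Lemma completion_complete : complete_distance (fun f g : K => mdist f g).
Proof.
split; [exact: completion_dist_xx|exact: completion_dist_eq|exact: completion_dist_sym| |].
  by move=> f g h; exact: completion_dist_triangle.
move=> u uC.
have /choice[l lP] j : exists l : R, forall e, 0 < e -> exists N, forall n, (N <= n)%N ->
    `|val (u n) j - l| <= e.
  apply: (cdist_complete real_complete_distance (u := fun n => val (u n) j)) => e /uC[N HN].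
  exists N => m n Nm Nn; apply: le_trans (HN m n Nm Nn); exact: completion_dist_ge.
have ul e N : 0 < e -> (forall m n, (N <= m)%N -> (N <= n)%N -> mdist (u m) (u n) <= e) ->
    forall n j, (N <= n)%N -> `|val (u n) j - l j| <= e.
  move=> e0 HN n j Nn; apply/ler_addgt0Pl => d d0.
  have [N' HN'] := lP j d d0.
  rewrite -[val (u n) j - _](subrKA (val (u (maxn N N')) j)).
  apply: le_trans (ler_normD _ _) _; rewrite addrC; apply: lerD.
    by apply: HN'; rewrite leq_maxr.
  apply: le_trans (completion_dist_ge _ _ _) _; apply: HN => //; exact: leq_maxl.
have lK : completion_pred l.
  apply/asboolP => e e0; have e20 : 0 < e / 2 by rewrite divr_gt0.
  have [N HN] := uC _ e20; have [i ui] := completion_approx (u N) e20.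
  exists i => j; have := ul _ _ e20 HN N j (leqnn _); have := ui j.
  by rewrite !ler_norml => /andP[? ?] /andP[? ?]; apply/andP; split; lra.
exists (exist (fun f : nat -> R => completion_pred f) l lK : K) => e e0; have [N HN] := uC e e0.
by exists N => n Nn; apply: completion_dist_le => j; exact: ul HN n j Nn.
Qed.

End pseudo_metric.

(** Centres of balls of radius $1/(k+1)$ belonging to the filter form a Cauchy sequence, and the
    filter has the same limit. *)
Lemma complete_distance_filter (T : metricType R) :
  complete_distance (fun x y : T => mdist x y) ->
  forall G : set_system T, ProperFilter G -> cauchy G -> exists x : T, G --> x.
Proof.
move=> cT G GF /cauchyP Gc.
have /choice[x xP] (k : nat) : exists x : T, G (ball x k.+1%:R^-1).
  exact: Gc (inv_natS_gt0 k).
have near m n : mdist (x m) (x n) <= m.+1%:R^-1 + n.+1%:R^-1.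
  have [y [ym yn]] := filter_ex (filterI (xP m) (xP n)).
  move: ym yn; rewrite !ballEmdist /= => ym yn.
  by apply: le_trans (metric_triangle _ y _) _; rewrite (metric_sym y); apply: lerD; apply: ltW.
have [e e0|l lP] := cdist_complete cT (u := x).
  have [|N HN] := inv_natS_small (e := e / 2); first by rewrite divr_gt0.
  exists N => m n Nm Nn; apply: le_trans (near m n) _.
  by rewrite [leRHS]splitr; apply: lerD; apply/ltW; exact: HN.
exists l => U /nbhs_ballP[e /= e0 eU].
have e20 : 0 < e / 2 by rewrite divr_gt0.
have e30 : 0 < e / 3 by rewrite divr_gt0.
have [N HN] := inv_natS_small e20; have [N' HN'] := lP _ e30.
apply: filterS (xP (maxn N N')) => y; rewrite ballEmdist/= => xy.
apply: eU; rewrite ballEmdist/=.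
have h1 := HN (maxn N N') (leq_maxl _ _); have h2 := HN' (maxn N N') (leq_maxr _ _).
have {h1}xy := lt_trans xy h1; have := metric_triangle l (x (maxn N N')) y.
by rewrite (metric_sym l (x _)); lra.
Qed.

(** * Extension of uniformly continuous maps from a dense sequence *)

Section extension.
Context (T : metricType R) (pt : nat -> T) (Z : Type) (D : Z -> Z -> R).
Hypotheses (pt_dense : forall x e, 0 < e -> exists i, mdist x (pt i) <= e)
  (cD : complete_distance D).
Context (n : nat) (De : modulus R n) (g : ('I_n -> nat) -> Z).
Hypothesis g_respects : forall x x', D (g x) (g x') <= De (fun i => mdist (pt (x i)) (pt (x' i))).

Lemma extension_exists : exists G : ('I_n -> T) -> Z,
  (forall t e, 0 < e -> exists2 eta, 0 < eta & forall x : 'I_n -> nat,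
     (forall i, mdist (t i) (pt (x i)) <= eta) -> D (g x) (G t) <= e).
Proof.
suff /choice[G GP] t : exists z, forall e, 0 < e -> exists2 eta, 0 < eta &
    forall x : 'I_n -> nat, (forall i, mdist (t i) (pt (x i)) <= eta) -> D (g x) z <= e.
  by exists G.
have /choice[u uP] (k : nat) : exists x : 'I_n -> nat,
    forall i, mdist (t i) (pt (x i)) <= k.+1%:R^-1.
  have /choice[x xP] (i : 'I_n) := pt_dense (t i) (inv_natS_gt0 k).
  by exists x.
have near e : 0 < e -> exists2 eta, 0 < eta & forall x x' : 'I_n -> nat,
    (forall i, mdist (t i) (pt (x i)) <= eta) -> (forall i, mdist (t i) (pt (x' i)) <= eta) ->
    D (g x) (g x') <= e.
  move=> e0; have [eta eta0 H] := modulus_small De e0.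
  exists (eta / 2); first by rewrite divr_gt0.
  move=> x x' xt x't; apply: le_trans (g_respects x x') _; apply: H => i.
    exact: mdist_ge0.
  have := metric_triangle (pt (x i)) (t i) (pt (x' i)).
  have := xt i; have := x't i; rewrite (metric_sym (pt (x i)) (t i)); lra.
have [e e0|z zP] := cdist_complete cD (u := g \o u).
  have [eta eta0 H] := near e e0; have [N HN] := inv_natS_small eta0.
  exists N => k l Nk Nl; apply: H => i; apply: le_trans (uP _ i) _; apply/ltW; exact: HN.
exists z => e e0; have e20 : 0 < e / 2 by rewrite divr_gt0.
have [eta eta0 H] := near _ e20; have [N HN] := inv_natS_small eta0.
have [N' HN'] := zP _ e20; exists eta => // x xt.
have h1 := HN' (maxn N N') (leq_maxr _ _).
have h2 : D (g x) (g (u (maxn N N'))) <= e / 2.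
  apply: H => // i; apply: le_trans (uP _ i) _; apply/ltW; apply: HN; exact: leq_maxl.
have := cdist_triangle cD (g x) (g (u (maxn N N'))) z; rewrite /= in h1; lra.
Qed.

Context (G : ('I_n -> T) -> Z).
Hypothesis GP : forall t e, 0 < e -> exists2 eta, 0 < eta & forall x : 'I_n -> nat,
     (forall i, mdist (t i) (pt (x i)) <= eta) -> D (g x) (G t) <= e.

Lemma extension_val x : G (pt \o x) = g x.
Proof.
apply: esym; apply: (cdist_eq cD); apply/eqP; rewrite eq_le (cdist_ge0 _ _ cD) andbT.
apply/ler_addgt0Pl => e e0; rewrite addr0; have [eta eta0 H] := GP (pt \o x) e0.
by apply: H => i; rewrite mdistxx ltW.
Qed.

Lemma extension_near t t' e : 0 < e -> exists x x',
  [/\ D (g x) (G t) <= e, D (g x') (G t') <= e &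
   forall i, mdist (pt (x i)) (pt (x' i)) <= mdist (t i) (t' i) + e].
Proof.
move=> e0; have [eta eta0 H] := GP t e0; have [eta' eta'0 H'] := GP t' e0.
have m0 : 0 < Num.min (Num.min eta eta') (e / 2) by rewrite !lt_min eta0 eta'0 divr_gt0.
have /choice[x xP] (i : 'I_n) := pt_dense (t i) m0.
have /choice[x' x'P] (i : 'I_n) := pt_dense (t' i) m0.
exists x, x'; split=> [||i].
- by apply: H => i; have := xP i; rewrite !le_min => /andP[/andP[]].
- by apply: H' => i; have := x'P i; rewrite !le_min => /andP[/andP[]].
have := xP i; have := x'P i; rewrite !le_min => /andP[_ h1] /andP[_ h2].
have := metric_triangle (pt (x i)) (t i) (pt (x' i)).
have := metric_triangle (t i) (t' i) (pt (x' i)); rewrite (metric_sym (pt (x i)) (t i)); lra.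
Qed.

Lemma extension_respects t t' : D (G t) (G t') <= De (fun i => mdist (t i) (t' i)).
Proof.
apply/ler_addgt0Pl => e e0; have e40 : 0 < e / 4 by rewrite divr_gt0.
have [eta eta0 H] := modulus_small De e40.
have m0 : 0 < Num.min eta (e / 4) by rewrite lt_min eta0.
have [x [x' [h1 h2 h3]]] := extension_near t t' m0.
have h4 : D (g x) (g x') <= De (fun i => mdist (t i) (t' i)) + e / 4.
  apply: le_trans (g_respects x x') _.
  apply: le_trans (_ : De ((fun i => mdist (t i) (t' i)) \+ (fun=> Num.min eta (e / 4))) <= _).
    by apply: modulus_mono => // i; exact: mdist_ge0.
  apply: le_trans (modulus_subadd _ _ _) _.
  - by move=> i; exact: mdist_ge0.
  - by move=> i; exact: ltW.
  by rewrite lerD2l; apply: H => i; [exact: ltW|rewrite ge_min lexx].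
move: h1 h2; rewrite !le_min => /andP[_ h1] /andP[_ h2].
have := cdist_triangle cD (G t) (g x) (G t'); have := cdist_triangle cD (g x) (g x') (G t').
rewrite (cdist_sym cD (G t) (g x)); lra.
Qed.

End extension.
End completion.

(** * Structures from codes *)

Section structures_from_codes.
Context {R : realType} {L : signature R}.
Implicit Types p q : code_space L.

Definition code_dist p (i j : nat) : R := cval (dcoord i j) p.

(** The conditions on codes that survive coordinatewise limits, as [closed_code_lim] shows. *)
Record closed_code p : Prop := {
  closed_dist : pseudo_dist (code_dist p) ;
  closed_dist_bound : forall i j, d_lo L <= code_dist p i j <= d_hi L ;
  closed_pred_bound : forall (P : other_psym L) (x : 'I_(other_parity P) -> nat),
    other_lo P <= cval (@pcoord _ L (Some P) x) p <= other_hi P ;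
  closed_pred_respects : forall (P : other_psym L) (x y : 'I_(other_parity P) -> nat),
    `|cval (@pcoord _ L (Some P) x) p - cval (@pcoord _ L (Some P) y) p| <=
      other_pmodulus P (fun i => code_dist p (x i) (y i)) ;
  closed_fun_respects : forall (F : Defs.fsym L) (x y : 'I_(farity F) -> nat) (j : nat),
    `|cval (fcoord x j) p - cval (fcoord y j) p| <=
      fmodulus F (fun i => code_dist p (x i) (y i)) ;
  closed_fun_lip : forall (F : Defs.fsym L) (x : 'I_(farity F) -> nat) (j k : nat),
    `|cval (fcoord x j) p - cval (fcoord x k) p| <= code_dist p j k ;
  closed_fun_triangle : forall (F : Defs.fsym L) (x : 'I_(farity F) -> nat) (j k : nat),
    code_dist p j k <= cval (fcoord x j) p + cval (fcoord x k) p
}.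

(** The existence conditions, which a limit may destroy: a generic sequence has to secure them by
    separate tasks. *)
Record rich_code p : Prop := {
  rich_tail : forall (i N : nat) (e : R), 0 < e -> exists2 k, (N <= k)%N & code_dist p i k < e ;
  rich_fun : forall (F : Defs.fsym L) (x : 'I_(farity F) -> nat) (e : R), 0 < e ->
    exists j, cval (fcoord x j) p < e
}.

Lemma code_of_closed (A : structure L) (a : nat -> A) : closed_code (code_of a).
Proof.
have dE i j : code_dist (code_of a) i j = mdist (a i) (a j) by rewrite /code_dist cval_d.
split.
- split=> [i|i j|i j k]; rewrite !dE; [exact: mdistxx|exact: metric_sym|exact: metric_triangle].
- by move=> i j; rewrite dE; exact: mdist_bound.
- by move=> P x; rewrite cval_p; exact: other_pint_bound.
- move=> P x y; rewrite !cval_p; under [X in modulus_fun _ X]eq_fun do rewrite dE.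
  exact: other_pint_respects.
- move=> F x y j; rewrite !cval_f; under [X in modulus_fun _ X]eq_fun do rewrite dE.
  apply: le_trans (mdist_dist _ _ _ _) _; rewrite mdistxx addr0.
  exact: fint_respects.
- move=> F x j k; rewrite !cval_f dE; apply: le_trans (mdist_dist _ _ _ _) _.
  by rewrite mdistxx add0r.
- move=> F x j k; rewrite !cval_f dE; apply: le_trans (metric_triangle _ (fint (a \o x)) _) _.
  by rewrite (metric_sym (a j)).
Qed.

Lemma tail_dense_rich (A : structure L) (a : nat -> A) : tail_dense a -> rich_code (code_of a).
Proof.
move=> /tail_denseP ta; split=> [i N e e0|F x e e0].
  by have [k Nk ik] := ta (a i) e N e0; exists k => //; rewrite /code_dist cval_d.
by have [k _ ik] := ta (fint (a \o x)) e 0%N e0; exists k => //; rewrite cval_f.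
Qed.

Section build.
Context (p : code_space L) (cp : closed_code p) (rp : rich_code p).
Let rhoP := closed_dist cp.
Local Notation T := (completion rhoP).
Local Notation pt := (completion_point rhoP).

Let ptE i j : mdist (pt i) (pt j) = code_dist p i j.
Proof. exact: completion_point_dist. Qed.

Let pt_dense (x : T) e : 0 < e -> exists i, mdist x (pt i) <= e.
Proof. exact: completion_point_dense. Qed.

Let cT := completion_complete rhoP.

(** The value of [F] at [x] is a limit of points whose prescribed distance to it tends to zero;
    [closed_fun_triangle] makes them a Cauchy sequence. *)
Let fun_point (F : Defs.fsym L) (x : 'I_(farity F) -> nat) :
  exists z : T, forall j, mdist z (pt j) = cval (fcoord x j) p.
Proof.
have /choice[y yP] (k : nat) := rich_fun rp x (inv_natS_gt0 k).
have [e e0|z zP] := cdist_complete cT (u := pt \o y).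
  have [|N HN] := @inv_natS_small R (e / 2); first by rewrite divr_gt0.
  exists N => m n Nm Nn; rewrite /= ptE; apply: le_trans (closed_fun_triangle cp x _ _) _.
  rewrite [leRHS]splitr; apply: lerD; apply/ltW.
    exact: lt_trans (yP m) (HN m Nm).
  exact: lt_trans (yP n) (HN n Nn).
exists z => j; apply/eqP; rewrite -subr_eq0 -normr_le0; apply/ler_addgt0Pl => e e0.
have e30 : 0 < e / 3 by rewrite divr_gt0.
have [N HN] := inv_natS_small e30; have [N' HN'] := zP _ e30.
set k := maxn N N'.
have h1 : cval (fcoord x (y k)) p < e / 3.
  by apply: lt_trans (yP k) (HN k _); rewrite leq_maxl.
have h2 : mdist (pt (y k)) z <= e / 3 by apply: HN'; rewrite leq_maxr.
have h3 := mdist_dist z (pt j) (pt (y k)) (pt j).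
have h4 := closed_fun_lip cp x j (y k).
have h5 := closed_fun_triangle cp x j (y k).
have h6 : 0 <= cval (fcoord x (y k)) p.
  have := closed_fun_triangle cp x (y k) (y k); case: rhoP => -> _ _; lra.
rewrite (metric_sym z (pt (y k))) mdistxx addr0 ptE in h3.
have [_ rs _] := rhoP; rewrite (rs (y k)) in h3.
move: h3 h4; rewrite !ler_norml => /andP[? ?] /andP[? ?]; apply/andP; split; lra.
Qed.

Theorem closed_rich_structure : structure_space L p.
Proof.
have /choice[gF gFP] (Fx : {F : Defs.fsym L & 'I_(farity F) -> nat}) :
    exists z : T, forall j, mdist z (pt j) = cval (fcoord (projT2 Fx) j) p.
  exact: fun_point.
have gF_respects (F : Defs.fsym L) (x x' : 'I_(farity F) -> nat) :
    mdist (gF (existT _ F x)) (gF (existT _ F x')) <=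
      fmodulus F (fun i => mdist (pt (x i)) (pt (x' i))).
  under [X in modulus_fun _ X]eq_fun do rewrite ptE.
  apply/ler_addgt0Pl => e e0; have [|y yP] := rich_fun rp x (e := e / 2).
    by rewrite divr_gt0.
  have := metric_triangle (gF (existT _ F x)) (pt y) (gF (existT _ F x')).
  rewrite (metric_sym (pt y)) !gFP /=.
  have := closed_fun_respects cp x x' y; rewrite ler_norml => /andP[? ?] ?; lra.
pose gG (F : Defs.fsym L) (x : 'I_(farity F) -> nat) := gF (existT _ F x).
pose dT (x y : T) := mdist x y.
pose EF F := cid (@extension_exists R T pt T dT pt_dense cT _ _ (gG F) (@gF_respects F)).
pose G F := projT1 (EF F); have GP F := projT2 (EF F).
pose gP (P : other_psym L) (x : 'I_(other_parity P) -> nat) := cval (@pcoord _ L (Some P) x) p.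
have gP_respects (P : other_psym L) (x x' : 'I_(other_parity P) -> nat) :
    `|gP P x - gP P x'| <= other_pmodulus P (fun i => mdist (pt (x i)) (pt (x' i))).
  under [X in modulus_fun _ X]eq_fun do rewrite ptE.
  exact: closed_pred_respects.
have cR := @real_complete_distance R.
pose dR (x y : R) := `|x - y|.
pose EP P := cid (@extension_exists R T pt R dR pt_dense cR _ _ (gP P) (@gP_respects P)).
pose H P := projT1 (EP P); have HP P := projT2 (EP P).
have Hb (P : other_psym L) (x : 'I_(other_parity P) -> T) : other_lo P <= H P x <= other_hi P.
  apply/andP; split; apply/ler_addgt0Pl => e e0.
    have [y [_ [h1 _ _]]] := @extension_near R T pt R dR pt_dense _ (gP P) (H P) (HP P) x x e e0.
    have /andP[h2 h3] := closed_pred_bound cp y.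
    by move: h1; rewrite /dR /gP ler_norml => /andP[? ?]; lra.
  have [y [_ [h1 _ _]]] := @extension_near R T pt R dR pt_dense _ (gP P) (H P) (HP P) x x e e0.
  have /andP[h2 h3] := closed_pred_bound cp y.
  by move: h1; rewrite /dR /gP ler_norml => /andP[? ?]; lra.
have db (x y : T) : d_lo L <= mdist x y <= d_hi L.
  apply/andP; split; apply/ler_addgt0Pl => e e0; have e20 : 0 < e / 2 by rewrite divr_gt0.
    have [i xi] := pt_dense x e20; have [j yj] := pt_dense y e20.
    have /andP[h1 h2] := closed_dist_bound cp i j.
    have := mdist_dist x y (pt i) (pt j); rewrite ptE ler_norml => /andP[? ?]; lra.
  have [i xi] := pt_dense x e20; have [j yj] := pt_dense y e20.
  have /andP[h1 h2] := closed_dist_bound cp i j.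
  have := mdist_dist x y (pt i) (pt j); rewrite ptE ler_norml => /andP[? ?]; lra.
pose B := @Structure R L T (complete_distance_filter cT) G H
  (fun F => @extension_respects R T pt T dT pt_dense cT _ _ (gG F) (@gF_respects F) (G F) (GP F))
  (fun P => @extension_respects R T pt R dR pt_dense cR _ _ (gP P) (@gP_respects P) (H P) (HP P)) Hb db.
have tB : tail_dense (pt : nat -> B).
  apply/(tail_denseP (A := B)) => x e N e0; have e20 : 0 < e / 2 by rewrite divr_gt0.
  have [i xi] := pt_dense x e20; have [k Nk ik] := rich_tail rp i N e20.
  exists k => //; have := metric_triangle x (pt i) (pt k); rewrite ptE.
  by rewrite /= in xi *; lra.
exists B, pt; split=> //.
  exists (range pt).
    exact: sub_countable (card_image_le pt [set: nat]) (countableP _).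
  move=> O O0 oO; have [x [Ox [k _ kx]]] := tB 0%N O O0 oO.
  by exists x; split=> //; exists k.
apply: functional_extensionality_dep => -[[P|]|F]; apply/funext => j /=.
- by rewrite (@extension_val R T pt R dR cR _ (gP P) (H P) (HP P)).
- have jE : j = fun k : 'I_2 => if k == ord0 then j ord0 else j ord_max.
    apply/funext => k; case: (eqVneq k ord0) => [->//|k0]; congr j.
    by apply/val_inj; case: k k0 => -[|[|]].
  by rewrite ptE [in LHS]jE.
- rewrite (@extension_val R T pt T dT cT _ (gG F) (G F) (GP F) (fun i => j (widen_ord (leqnSn _) i))) gFP /= /cval /=.
  by rewrite snoc_eta.
Qed.

End build.
End structures_from_codes.

(** * Limits of codes *)

Section real_limits.
Context {R : realType}.
Implicit Types (u v : nat -> R) (l : R).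

Definition tends u l : Prop :=
  forall e, 0 < e -> exists N, forall k, (N <= k)%N -> `|u k - l| < e.

Lemma tends_cst l : tends (fun=> l) l.
Proof. by move=> e e0; exists 0%N => k _; rewrite subrr normr0. Qed.

Lemma tendsD u v l l' : tends u l -> tends v l' -> tends (fun k => u k + v k) (l + l').
Proof.
move=> ul vl e e0; have e20 : 0 < e / 2 by rewrite divr_gt0.
have [N HN] := ul _ e20; have [N' HN'] := vl _ e20.
exists (maxn N N') => k; rewrite geq_max => /andP[/HN h1 /HN' h2].
move: h1 h2; rewrite !ltr_norml => /andP[? ?] /andP[? ?]; apply/andP; split; lra.
Qed.

Lemma tendsN u l : tends u l -> tends (fun k => - u k) (- l).
Proof.
move=> ul e /ul[N HN]; exists N => k /HN; rewrite !ltr_norml => /andP[? ?].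
by apply/andP; split; lra.
Qed.

Lemma tends_norm u l : tends u l -> tends (fun k => `|u k|) `|l|.
Proof.
move=> ul e /ul[N HN]; exists N => k /HN; apply: le_lt_trans; exact: ler_dist_dist.
Qed.

Lemma tends_le u v l l' : tends u l -> tends v l' -> (forall k, u k <= v k) -> l <= l'.
Proof.
move=> ul vl uv; apply/ler_addgt0Pl => e e0; have e20 : 0 < e / 2 by rewrite divr_gt0.
have [N HN] := ul _ e20; have [N' HN'] := vl _ e20.
have := HN (maxn N N') (leq_maxl _ _); have := HN' (maxn N N') (leq_maxr _ _).
have := uv (maxn N N'); rewrite !ltr_norml => ? /andP[? ?] /andP[? ?]; lra.
Qed.

Lemma tends_unique u l l' : tends u l -> tends u l' -> l = l'.
Proof.
move=> h h'; apply: le_anti; apply/andP; split.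
  exact: tends_le h h' (fun=> lexx _).
exact: tends_le h' h (fun=> lexx _).
Qed.

Lemma tends_modulus n (D : modulus R n) (u : nat -> 'I_n -> R) (l : 'I_n -> R) :
  (forall k, nonneg (u k)) -> nonneg l -> (forall i, tends (fun k => u k i) (l i)) ->
  forall e, 0 < e -> exists N, forall k, (N <= k)%N -> D (u k) <= D l + e.
Proof.
move=> u0 l0 ul e e0; have [eta eta0 H] := modulus_small D e0.
have /choice[N NP] i := ul i _ eta0.
exists (\max_i N i) => k Nk.
apply: le_trans (_ : D (l \+ fun=> eta) <= _).
  apply: modulus_mono => // i; have := NP i k (leq_trans (leq_bigmax i) Nk).
  by rewrite ltr_norml /= => /andP[_]; lra.
apply: le_trans (modulus_subadd _ l0 (fun=> ltW eta0)) _; rewrite lerD2l.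
by apply: H => // i; exact: ltW.
Qed.

Lemma tends_norm_le_modulus n (D : modulus R n) (u : nat -> 'I_n -> R) (l : 'I_n -> R) v m :
  (forall k, nonneg (u k)) -> nonneg l -> (forall i, tends (fun k => u k i) (l i)) ->
  tends v m -> (forall k, `|v k| <= D (u k)) -> `|m| <= D l.
Proof.
move=> u0 l0 ul vm vu; apply/ler_addgt0Pl => e e0; have e20 : 0 < e / 2 by rewrite divr_gt0.
have [N HN] := tends_modulus D u0 l0 ul e20; have [N' HN'] := tends_norm vm e20.
have := HN _ (leq_maxl N N'); have := HN' _ (leq_maxr N N'); have := vu (maxn N N').
by rewrite ltr_norml => ? /andP[? ?] ?; lra.
Qed.

End real_limits.

Section code_limits.
Context {R : realType} {L : signature R}.

Definition code_tends (u : nat -> code_space L) (p : code_space L) : Prop :=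
  forall k, tends (fun n => cval k (u n)) (cval k p).

Lemma closed_dist_ge0 p i j : closed_code (p : code_space L) -> 0 <= code_dist p i j.
Proof.
move=> /closed_dist[xx sy tri]; have := tri i j i; rewrite xx (sy j); lra.
Qed.

Lemma closed_code_lim (u : nat -> code_space L) p :
  (forall n, closed_code (u n)) -> code_tends u p -> closed_code p.
Proof.
move=> cu up.
have dv i j : tends (fun n => code_dist (u n) i j) (code_dist p i j) by exact: up.
have d0 i j : 0 <= code_dist p i j.
  by apply: tends_le (tends_cst 0) (dv i j) _ => k; exact: closed_dist_ge0.
split.
- split=> [i|i j|i j k].
  + apply: tends_unique (dv i i) _; rewrite (_ : (fun _ => _) = fun=> 0); first exact: tends_cst.
    by apply/funext => n; have [-> _ _] := closed_dist (cu n).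
  + apply: tends_unique (dv i j) _.
    rewrite (_ : (fun n => code_dist (u n) i j) = fun n => code_dist (u n) j i); first exact: dv.
    by apply/funext => n; have [_ -> _] := closed_dist (cu n).
  + by apply: tends_le (dv i k) (tendsD (dv i j) (dv j k)) _ => n; have [_ _] := closed_dist (cu n).
- move=> i j; apply/andP; split.
    by apply: tends_le (tends_cst _) (dv i j) _ => n; have /andP[] := closed_dist_bound (cu n) i j.
  by apply: tends_le (dv i j) (tends_cst _) _ => n; have /andP[] := closed_dist_bound (cu n) i j.
- move=> P x; apply/andP; split.
    by apply: tends_le (tends_cst _) (up _) _ => n; have /andP[] := closed_pred_bound (cu n) x.
  by apply: tends_le (up _) (tends_cst _) _ => n; have /andP[] := closed_pred_bound (cu n) x.
- move=> P x y.
  apply: (tends_norm_le_modulus (u := fun n i => code_dist (u n) (x i) (y i))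
    (v := fun n => cval (@pcoord _ L (Some P) x) (u n) - cval (@pcoord _ L (Some P) y) (u n))) => //.
  + by move=> n i; exact: closed_dist_ge0.
  + by apply: tendsD; [exact: up|apply: tendsN; exact: up].
  + by move=> n; exact: closed_pred_respects.
- move=> F x y j.
  apply: (tends_norm_le_modulus (u := fun n i => code_dist (u n) (x i) (y i))
    (v := fun n => cval (fcoord x j) (u n) - cval (fcoord y j) (u n))) => //.
  + by move=> n i; exact: closed_dist_ge0.
  + by apply: tendsD; [exact: up|apply: tendsN; exact: up].
  + by move=> n; exact: closed_fun_respects.
- move=> F x j k.
  apply: tends_le (tends_norm (tendsD (up (fcoord x j)) (tendsN (up (fcoord x k))))) (dv j k) _.
  by move=> n; exact: closed_fun_lip.
- move=> F x j k.
  apply: tends_le (dv j k) (tendsD (up (fcoord x j)) (up (fcoord x k))) _.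
  by move=> n; exact: closed_fun_triangle.
Qed.

Definition coord_size (k : coordinate (L := L)) : nat := \max_i projT2 k i.

Definition coord_atomic (k : coordinate (L := L)) : atomic L (coord_size k).+1 :=
  match k return atomic L (coord_size k).+1 with
  | existT (inl P) j => @Atomic R L _ P (fun i => Var L (inord (j i)))
  | existT (inr F) j => @Atomic R L _ None (fun b : 'I_2 =>
      if b == ord0 then App (fun i : 'I_(farity F) => Var L (inord (j (widen_ord (leqnSn _) i))))
      else Var L (inord (j ord_max)))
  end.

Lemma coord_atomic_eval k (A : structure L) (a : nat -> A) :
  atomic_eval (coord_atomic k) (restr (coord_size k).+1 a) = cval k (code_of a).
Proof.
have le (i : 'I_(rarity (projT1 k))) : (projT2 k i < (coord_size k).+1)%N.
  by rewrite ltnS /coord_size (leq_bigmax i).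
case: k le => [[P|F] j] le /=; rewrite /atomic_eval /cval /=.
  by congr pint; apply/funext => i; rewrite /= inordK.
congr mdist; last by rewrite inordK.
by congr fint; apply/funext => i; rewrite /= inordK.
Qed.

Context (Om : (nat -> R) -> \bar R) (OmU : universal_weak_modulus L Om).

(** For large [N] the atomic formula of the coordinate respects [Om \o sh N], so coordinates
    converge along conditions with growing shifts and shrinking radii. *)
Lemma coord_drift k : exists N, forall (W : wellOrder) (g : W) (A B : structure L)
    (a : nat -> A) (b : nat -> B) e, inhabited A -> inhabited B ->
  bfle (Om \o sh N) g (coord_size k).+1 a b e ->
  `|cval k (code_of a) - cval k (code_of b)| <= e.
Proof.
have [N HN] := universal_atomic_scaled OmU (coord_atomic k) ltr01.
exists N => W g A B a b e iA iB /bfleP[]//.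
  by apply: gauge_sh; exact: universal_gauge OmU.
move=> _ H _; have r : respects (Om \o sh N) (atom_basic 1 (coord_atomic k)).
  by apply: atom_basic_respects => // d d0; exact: HN.
by have := H _ r; rewrite /basic_eval/= !mul1r !coord_atomic_eval.
Qed.

End code_limits.

(** * Generic structures and isolation *)

(** The Rasiowa-Sikorski argument; [None] stands for stages that decode to no task. *)
Lemma generic_sequence (T : Type) (le : T -> T -> Prop) (K : countType) (D : K -> T -> Prop) (t0 : T) :
  (forall t, le t t) -> (forall k t, exists2 t', le t' t & D k t') ->
  exists c : nat -> T, (forall n, le (c n.+1) (c n)) /\ forall k, exists n, D k (c n).
Proof.
move=> refl dense.
have /choice[f fP] (kt : option K * T) : exists t', le t' kt.2 /\ (if kt.1 is Some k then D k t' else True).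
  case: kt => -[k|] t /=; last by exists t.
  by have [t' ? ?] := dense k t; exists t'.
pose c := fix c n := if n is m.+1 then f (unpickle m, c m) else t0.
exists c; split=> [n|k]; first by have [] := fP (unpickle n, c n).
by exists (pickle k).+1; have [_] := fP (unpickle (pickle k), c (pickle k)); rewrite /= pickleK.
Qed.

Section generic.
Context {R : realType} {L : signature R} (Om : (nat -> R) -> \bar R).
Hypothesis OmU : universal_weak_modulus L Om.
Context (en : nat -> coordinate (L := L)).
Hypothesis en_surj : forall k, exists i, en i = k.
Context (W : wellOrder) (WO : omega1_like W) (alpha w0 : W).
Hypotheses (w0_lt : (w0 < alpha)%O)
  (alpha_lim : forall g, (g < alpha)%O -> exists2 g', (g < g')%O & (g' < alpha)%O).
Context (A : structure L) (a : nat -> A) (ta : tail_dense a).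

Local Notation Th N := (Om \o sh N).
Let gOm := universal_gauge OmU.
Let gTh N : gauge (Th N). Proof. exact: gauge_sh. Qed.
Let iA : inhabited A. Proof. by split; exact: a 0%N. Qed.
Local Hint Resolve gTh iA : core.

Lemma gauge_sh_le N N' delta : (N <= N')%N -> nonneg delta ->
  (Om (sh N delta) <= Om (sh N' delta))%E.
Proof.
move=> NN d0; rewrite -(subnK NN) -sh_sh; apply: gauge_le_sh => //; exact: sh_ge0.
Qed.

Lemma bfle_sh_le N N' g (B C : structure L) n (b : nat -> B) (c : nat -> C) e :
  (N <= N')%N -> inhabited B -> inhabited C ->
  bfle (W := W) (Th N') g n b c e -> bfle (Th N) g n b c e.
Proof.
move=> NN iB iC; apply: bfle_gauge_le => // m d d0; apply: gauge_sh_le => //.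
exact: tr_ge0.
Qed.

(* A condition stands for the open ball [in_ball C x e] with [e < c_rad C]. *)
Record condition := Condition {
  c_len : nat ; c_pt : nat -> A ; c_rk : W ; c_sh : nat ; c_rad : R ;
  c_rk_lt : (c_rk < alpha)%O ; c_rad_gt0 : 0 < c_rad }.

Definition in_ball (C : condition) (B : structure L) (x : nat -> B) (e : R) : Prop :=
  bfle (Th (c_sh C)) (c_rk C) (c_len C) x (c_pt C) e.

(** Inclusion of balls is witnessed by the radii and the distance of the centres, so that it
    composes by the triangle inequality. *)
Definition extends (C' C : condition) : Prop :=
  [/\ (c_len C <= c_len C')%N, (c_rk C <= c_rk C')%O, (c_sh C <= c_sh C')%N &
   exists2 e, in_ball C (c_pt C') e & e + c_rad C' <= c_rad C].

Lemma in_ball_le C (B : structure L) (x : nat -> B) e e' :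
  inhabited B -> e <= e' -> in_ball C x e -> in_ball C x e'.
Proof. by move=> iB ee; apply: bfle_weaken. Qed.

Lemma extends_ball C C' (B : structure L) (x : nat -> B) e e' : inhabited B ->
  [/\ (c_len C <= c_len C')%N, (c_rk C <= c_rk C')%O & (c_sh C <= c_sh C')%N] ->
  in_ball C (c_pt C') e -> in_ball C' x e' -> in_ball C x (e' + e).
Proof.
move=> iB [l r s] h h'; apply: bfle_trans h => //.
by apply: bfle_sh_le (s) _ _ _ => //; apply: bfle_take (l) _ => //; apply: bfle_weaken (r) (lexx _) h'.
Qed.

Lemma extends_refl C : extends C C.
Proof. by split=> //; exists 0; [exact: bfle_refl|rewrite add0r]. Qed.

Lemma extends_trans C1 C2 C3 : extends C1 C2 -> extends C2 C3 -> extends C1 C3.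
Proof.
move=> [l12 r12 s12 [e12 h12 E12]] [l23 r23 s23 [e23 h23 E23]]; split.
- exact: leq_trans l12.
- exact: le_trans r12.
- exact: leq_trans s12.
by exists (e12 + e23); [exact: extends_ball h23 h12|lra].
Qed.

Lemma extends_in_ball C C' : extends C' C -> in_ball C (c_pt C') (c_rad C).
Proof.
move=> [_ _ _ [e h E]]; apply: in_ball_le h => //; have := c_rad_gt0 C'; lra.
Qed.

(** In particular [z] may carry new points at places from [c_len C] on, which the condition [C]
    leaves free. *)
Lemma extend_to C (z : nat -> A) e l g s r : in_ball C z e -> e < c_rad C ->
  (g < alpha)%O -> 0 < r ->
  exists C', [/\ extends C' C, c_pt C' = z, c_len C' = maxn (c_len C) l,
    [/\ (g <= c_rk C')%O, (s <= c_sh C')%N & c_rad C' <= r] &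
    [/\ (c_rk C <= c_rk C')%O & (c_sh C <= c_sh C')%N]].
Proof.
move=> zC eC ga r0.
have gm : (Order.max (c_rk C) g < alpha)%O by rewrite gt_max c_rk_lt.
have rm : 0 < Num.min r (c_rad C - e) by rewrite lt_min r0 subr_gt0.
exists (@Condition (maxn (c_len C) l) z _ (maxn (c_sh C) s) _ gm rm); split=> //=.
- split=> /=; [exact: leq_maxl|by rewrite le_max lexx|exact: leq_maxl|].
  exists e => //=; have : Num.min r (c_rad C - e) <= c_rad C - e by rewrite ge_min lexx orbT.
  lra.
- by split; [rewrite le_max lexx orbT|exact: leq_maxr|rewrite ge_min lexx].
- by split; [rewrite le_max lexx|exact: leq_maxl].
Qed.

Lemma extend_self C l g s r : (g < alpha)%O -> 0 < r ->
  exists C', [/\ extends C' C, c_pt C' = c_pt C, c_len C' = maxn (c_len C) l,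
    [/\ (g <= c_rk C')%O, (s <= c_sh C')%N & c_rad C' <= r] &
    [/\ (c_rk C <= c_rk C')%O & (c_sh C <= c_sh C')%N]].
Proof. by apply: extend_to; [exact: bfle_refl|exact: c_rad_gt0]. Qed.

(** * Tasks, and their density when a tuple is not isolated *)

Section not_isolated.
Context (n : nat) (u : nat -> A) (eps : R).

Definition near_at (I : nat -> nat) (B : structure L) (f : B -> A) (x : nat -> B) : Prop :=
  forall p, (p < n)%N -> mdist (f (x (I p))) (u p) < eps.

(* Some ball below [alpha] forces all of its points to have extensions by a tuple
   near [u], up to any later rank and error. *)
Definition isolated : Prop := exists (I : nat -> nat) (m : nat) (y : nat -> A) (g : W) (N : nat) (d : R),
  [/\ forall p q, (p < q)%N -> (q < n)%N -> (I p < I q)%N,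
   forall p, (p < n)%N -> (I p < m)%N,
   near_at I id y,
   (g < alpha)%O /\ 0 < d &
   forall z : nat -> A, bfle (Th N) g m z y d ->
     forall g' d', (g' < alpha)%O -> 0 < d' -> exists2 x : nat -> A,
       bfle Om g' m x z d' & near_at I id x].

Hypothesis not_isolated : ~ isolated.

Context (Nf : coordinate (L := L) -> nat).
Hypothesis NfP : forall k (g : W) (B C : structure L)
    (b : nat -> B) (c : nat -> C) e, inhabited B -> inhabited C ->
  bfle (Th (Nf k)) g (coord_size k).+1 b c e ->
  `|cval k (code_of b) - cval k (code_of c)| <= e.
Context (ge : nat -> W).
Hypothesis geP : forall g, (g < alpha)%O -> exists i, ge i = g.

Definition task : Type := (nat * nat * nat * nat * seq nat * rat)%type.

(** Later conditions then move coordinate [k] by at most $1/(r+1)$. *)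
Definition settled (C : condition) (k : coordinate (L := L)) (r : nat) : Prop :=
  [/\ (Nf k <= c_sh C)%N, (coord_size k < c_len C)%N & c_rad C <= r.+1%:R^-1].

(** Tuples of the dense sequence, coded by indices to keep the tasks countable. *)
Definition qpt (s : seq nat) : nat -> A := fun p => a (nth 0%N s p).

(* A descending sequence of conditions meeting all tasks converges to the code of
   a structure: tags 0 and 1 make lengths, shifts, radii and ranks exhaust
   everything, tags 2 and 3 make the code rich. Tag 4 yields the forth condition,
   and the remaining tags keep [u] at distance [eps] from the limit; these are
   dense because [u] is not isolated. *)
Definition meets (t : task) (C : condition) : Prop :=
  let: (tag, i, r, N, s, e) := t in
  match tag with
  | 0 => [/\ (r <= c_len C)%N, (r <= c_sh C)%N & c_rad C <= r.+1%:R^-1]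
  | 1 => (ge i < alpha)%O -> (ge i <= c_rk C)%O
  | 2 => exists j, [/\ (r <= j)%N, settled C (dcoord i j) r & mdist (c_pt C i) (c_pt C j) <= 0]
  | 3 => match en i with
         | existT (inr F) x => exists j,
             settled C (fcoord (fun k : 'I_(farity F) => x (widen_ord (leqnSn _) k)) j) r /\
             mdist (fint (fun k : 'I_(farity F) => c_pt C (x (widen_ord (leqnSn _) k)))) (c_pt C j) <= 0
         | _ => True
         end
  | 4 => let m := (size s).-1 in
         [/\ c_rad C <= r.+1%:R^-1, (N <= c_sh C)%N, (ge i < alpha)%O -> (ge i <= c_rk C)%O &
         ((exists j, [/\ (m <= j)%N, (j < c_len C)%N &
             bfle (Th N) (ge i) m.+1 (upd (c_pt C) m (c_pt C j)) (qpt s) (ratr e)]) \/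
         (forall z : nat -> A, forall e0, e0 < c_rad C -> in_ball C z e0 ->
            forall c, ~ bfle (Th N) (ge i) m.+1 (upd z m c) (qpt s) (ratr e)))]
  | _ => (forall p q, (p < q)%N -> (q < n)%N -> (nth 0 s p < nth 0 s q)%N) ->
         (forall x : nat -> A, in_ball C x (c_rad C) -> ~ near_at (nth 0%N s) id x)
  end.

Lemma meets_dense t C : exists2 C', extends C' C & meets t C'.
Proof.
case: t => -[[[[[|[|[|[|[|tag]]]]] i] r] N] s] e.
- have [C' [CC _ l [_ ? ?] _]] := extend_self C r r w0_lt (inv_natS_gt0 (R := R) r).
  by exists C' => //; split=> //; rewrite l leq_maxr.
- have [ia|nia] := boolP (ge i < alpha)%O; last first.
    by exists C => //=; [exact: extends_refl|move=> ia; rewrite ia in nia].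
  by have [C' [CC _ _ [? _ _] _]] := extend_self C 0 0 ia ltr01; exists C'.
(* Point [i] is repeated at a free place [j], which makes the limit sequence tail-dense. *)
- set j := maxn (maxn (c_len C) i.+1) r; set k : coordinate (L := L) := dcoord i j.
  have zC : in_ball C (upd (c_pt C) j (c_pt C i)) 0.
    apply: bfle_congr (bfle_refl (c_rk C) (c_len C) (c_pt C) (gTh (c_sh C)) iA) => // p pl; rewrite /upd ifT//.
    by rewrite (leq_trans pl)// /j -maxnA leq_maxl.
  have [C' [CC z l [_ ? ?] _]] := extend_to (maxn j.+1 (coord_size k).+1) (Nf k)
    zC (c_rad_gt0 C) w0_lt (inv_natS_gt0 (R := R) r).
  exists C' => //; exists j; split.
  + exact: leq_maxr.
  + by split=> //; rewrite l !leq_max ltnSn !orbT.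
  + rewrite z /upd ltnn ifT ?mdistxx//.
    by rewrite /j !leq_max ltnSn orbT.
- rewrite /meets; case: (en i) => -[P|F] x; first by exists C => //; exact: extends_refl.
  set y := fun k : 'I_(farity F) => x (widen_ord (leqnSn _) k).
  set j := maxn (c_len C) (\max_k y k).+1; set k := fcoord y j.
  have yj q : (y q < j)%N by rewrite /j leq_max ltnS (leq_bigmax q) orbT.
  have zC : in_ball C (upd (c_pt C) j (fint (fun q => c_pt C (y q)))) 0.
    apply: bfle_congr (bfle_refl (c_rk C) (c_len C) (c_pt C) (gTh (c_sh C)) iA) => // p pl; rewrite /upd ifT//.
    by rewrite (leq_trans pl)// leq_maxl.
  have [C' [CC z l [_ ? ?] _]] := extend_to (maxn j.+1 (coord_size k).+1) (Nf k)
    zC (c_rad_gt0 C) w0_lt (inv_natS_gt0 (R := R) r).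
  exists C' => //; exists j; split.
  + by split=> //; rewrite l !leq_max ltnSn !orbT.
  + rewrite z /upd ltnn (_ : (fun q => _) = fun q => c_pt C (y q)) ?mdistxx//.
    by apply/funext => q; rewrite -/(y q) yj.
(* If some point of the ball has the required extension, the extending point is stored at the free
   place [c_len C1]; otherwise the ball already excludes it. *)
- set m := (size s).-1.
  pose g := if (ge i < alpha)%O then ge i else w0.
  have ga : (g < alpha)%O by rewrite /g; case: ifP.
  have gi : (ge i < alpha)%O -> ge i = g by rewrite /g => ->.
  have [C1 [CC1 z1 l1 [gC1 NC1 r1] _]] := extend_self C m N ga (inv_natS_gt0 (R := R) r).
  have [[z [e0 [eC zC [c zc]]]]|H] := pselect (exists (z : nat -> A) (e0 : R), [/\ e0 < c_rad C1, in_ball C1 z e0 &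
      exists c, bfle (Th N) (ge i) m.+1 (upd z m c) (qpt s) (ratr e)]); last first.
    exists C1 => //; split=> //; first by move=> /gi->.
    by right=> z e0 eC zC c zc; apply: H; exists z, e0; split=> //; exists c.
  have zC' : in_ball C1 (upd z (c_len C1) c) e0.
    by apply: bfle_congr zC => // p pl; rewrite /upd pl.
  have [C' [CC z' l [_ _ ?] [rk' sh']]] := extend_to (c_len C1).+1 0 zC' eC w0_lt (inv_natS_gt0 (R := R) r).
  exists C'; first exact: extends_trans CC1.
  split=> //; first exact: leq_trans sh'.
    by move=> /gi->; exact: le_trans rk'.
  left; exists (c_len C1); split.
  + by rewrite -/m l1 leq_maxr.
  + by rewrite l leq_max ltnSn orbT.
  + apply: bfle_congr zc => // p; rewrite ltnS leq_eqVlt /upd -/m z' /upd.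
    move=> /orP[/eqP->|pm]; first by rewrite !ltnn.
    by rewrite pm ifT// l1 leq_max pm orbT.
- have [inc|ninc] := pselect (forall p q, (p < q)%N -> (q < n)%N -> (nth 0 s p < nth 0 s q)%N); last first.
    by exists C => //; exact: extends_refl.
  have [C1 [CC1 z1 l1 _ _]] := extend_self C (\max_(p < n) nth 0%N s p).+1 0 w0_lt ltr01.
  have Il p : (p < n)%N -> (nth 0 s p < c_len C1)%N.
    by move=> pn; rewrite l1 leq_max ltnS (leq_bigmax (Ordinal pn)) orbT.
  have [[x [e0 [eC xC xn]]]|H] := pselect (exists (x : nat -> A) (e0 : R), [/\ e0 < c_rad C1, in_ball C1 x e0 &
      near_at (nth 0%N s) id x]); last first.
    have r2 : 0 < c_rad C1 / 2 by rewrite divr_gt0 ?c_rad_gt0.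
    have [C' [CC z' l [_ _ r'] [rk' sh']]] := extend_self C1 0 0 w0_lt r2.
    exists C'; first exact: extends_trans CC1.
    move=> _ x xC xn; apply: H; exists x, (c_rad C1 / 2); split=> //.
      by have := c_rad_gt0 C1; lra.
    rewrite -(addr0 (c_rad C1 / 2)); apply: (@extends_ball C1 C') => //.
    + by split=> //; rewrite l leq_maxl.
    + by rewrite z'; exact: bfle_refl.
    + exact: in_ball_le xC.
  have d0 : 0 < (c_rad C1 - e0) / 2 by rewrite divr_gt0 ?subr_gt0.
  (* Otherwise the ball around [x] with half of the slack as radius would witness isolation. The
     rank [g'] and error [d'] failing at [z] define the next condition. *)
  have [z [zx [g' [d' [g'a d'0 zn]]]]] : exists z : nat -> A, bfle (Th (c_sh C1)) (c_rk C1) (c_len C1) z x ((c_rad C1 - e0) / 2) /\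
      exists (g' : W) (d' : R), [/\ (g' < alpha)%O, 0 < d' & forall y : nat -> A,
        bfle Om g' (c_len C1) y z d' -> ~ near_at (nth 0%N s) id y].
    apply: contrapT => H; apply: not_isolated.
    exists (nth 0%N s), (c_len C1), x, (c_rk C1), (c_sh C1), ((c_rad C1 - e0) / 2); split=> //.
      by split=> //; exact: c_rk_lt.
    move=> z zx g' d' g'a d'0; apply: contrapT => H'; apply: H; exists z; split=> //.
    by exists g', d'; split=> // y yz yn; apply: H'; exists y.
  have zC : in_ball C1 z ((c_rad C1 - e0) / 2 + e0) by exact: bfle_trans zx xC.
  have zr : (c_rad C1 - e0) / 2 + e0 < c_rad C1 by lra.
  have [C' [CC z' l [rk' _ r'] _]] := extend_to 0 0 zC zr g'a d'0.
  exists C'; first exact: extends_trans CC1.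
  move=> _ y yC; apply: zn; rewrite -z'.
  have gl : gauge Om by exact: gOm.
  apply: (bfle_weaken gl _ _ rk' r') => //.
  apply: (bfle_take gl (m := c_len C')) => //; first by rewrite l leq_maxl.
  apply: bfle_gauge_le yC => // m d dn; exact: gauge_le_sh (tr_ge0 _ dn).
Qed.

(** * The structure defined by a generic sequence of conditions *)

Section limit.
Context (c : nat -> condition) (c_ext : forall k, extends (c k.+1) (c k))
  (c_meets : forall t, exists k, meets t (c k)).

Lemma c_extends k l : (k <= l)%N -> extends (c l) (c k).
Proof.
move=> kl; rewrite -(subnK kl); elim: (l - k)%N => [|d IH]; first exact: extends_refl.
exact: extends_trans (c_ext _) IH.
Qed.

Lemma c_rad_le k l : (k <= l)%N -> c_rad (c l) <= c_rad (c k).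
Proof.
move=> /c_extends[_ _ _ [e h E]].
have : 0 <= e by apply: bfle_ge0 h.
lra.
Qed.

Lemma c_large r : exists k0, forall k, (k0 <= k)%N ->
  [/\ (r <= c_len (c k))%N, (r <= c_sh (c k))%N & c_rad (c k) <= r.+1%:R^-1].
Proof.
have [k0 /= [h1 h2 h3]] := c_meets (0, 0, r, 0, [::], 0%R)%N.
exists k0 => k kk; have [l _ s _] := c_extends kk; split.
- exact: leq_trans l.
- exact: leq_trans s.
- exact: le_trans (c_rad_le kk) h3.
Qed.

Lemma c_rank g : (g < alpha)%O -> exists k0, forall k, (k0 <= k)%N -> (g <= c_rk (c k))%O.
Proof.
move=> ga; have [i ig] := geP ga; have [k0 /=] := c_meets (1, i, 0, 0, [::], 0%R)%N.
rewrite ig => /(_ ga) h; exists k0 => k kk; have [_ r _ _] := c_extends kk.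
exact: le_trans r.
Qed.

Lemma c_drift k l N g m : (k <= l)%N -> (N <= c_sh (c k))%N -> (g <= c_rk (c k))%O ->
  (m <= c_len (c k))%N -> bfle (Th N) g m (c_pt (c l)) (c_pt (c k)) (c_rad (c k)).
Proof.
move=> /c_extends/extends_in_ball h Nk gk mk.
apply: bfle_sh_le (Nk) _ _ _ => //; apply: bfle_take (mk) _ => //.
exact: bfle_weaken gk (lexx _) h.
Qed.

Let cd k := code_of (c_pt (c k)).

Lemma c_coord_drift q k l : (k <= l)%N -> (Nf q <= c_sh (c k))%N ->
  (coord_size q < c_len (c k))%N -> `|cval q (cd l) - cval q (cd k)| <= c_rad (c k).
Proof.
by move=> kl Nk sk; apply: (NfP (g := c_rk (c k))) => //; exact: c_drift.
Qed.

Lemma c_coord_lim q : exists x, tends (fun k => cval q (cd k)) x.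
Proof.
have [e e0|x xP] := cdist_complete (@real_complete_distance R) (u := fun k => cval q (cd k)).
  have e20 : 0 < e / 2 by rewrite divr_gt0.
  have [r rP] := inv_natS_small e20.
  have [k0 kP] := c_large (maxn r (maxn (Nf q) (coord_size q).+1)).
  have [h1 h2 h3] := kP k0 (leqnn _).
  move: h1 h2; rewrite !geq_max => /andP[_ /andP[_ l1]] /andP[_ /andP[s1 _]].
  have h4 : c_rad (c k0) <= e / 2.
    by apply: le_trans h3 _; apply/ltW/rP; rewrite leq_maxl.
  exists k0 => k l k0k k0l.
  have := c_coord_drift k0k s1 l1; have := c_coord_drift k0l s1 l1.
  rewrite !ler_norml => /andP[? ?] /andP[? ?]; apply/andP; split; lra.
exists x => e e0; have [|N NP] := xP (e / 2); first by rewrite divr_gt0.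
by exists N => k /NP h; apply: le_lt_trans h _; lra.
Qed.

Definition generic_code : code_space L := fun s j => projT1 (cid (c_coord_lim (existT _ s j))).

Lemma generic_code_tends : code_tends cd generic_code.
Proof.
move=> [s j]; exact: projT2 (cid (c_coord_lim (existT _ s j))).
Qed.

Lemma settled_limit k q r : settled (c k) q r -> `|cval q (cd k) - cval q generic_code| <= r.+1%:R^-1.
Proof.
move=> [h1 h2 h3]; apply/ler_addgt0Pl => e e0.
have [N NP] := generic_code_tends q e0.
have h4 := c_coord_drift (leq_maxl k N) h1 h2; have h5 := NP _ (leq_maxr k N).
move: h4 (le_trans h4 h3) h5; move: (r.+1%:R^-1) => x.
rewrite !ler_norml !ltr_norml => /andP[? ?] /andP[? ?] /andP[? ?]; apply/andP; split; lra.
Qed.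

Lemma generic_code_closed : closed_code generic_code.
Proof. apply: closed_code_lim generic_code_tends => k; exact: code_of_closed. Qed.

Lemma generic_code_rich : rich_code generic_code.
Proof.
split=> [i N e e0|F x e e0]; have [r rP] := inv_natS_small e0.
  have [k [j [rj sj dj]]] := c_meets (2, i, maxn N r, 0, [::], 0%R)%N.
  exists j; first by apply: leq_trans rj; rewrite leq_maxl.
  have := settled_limit sj; have h := rP (maxn N r) (leq_maxr _ _).
  rewrite -cval_d in dj; move=> /le_lt_trans/(_ h); rewrite ltr_norml => /andP[? ?].
  by rewrite /code_dist; move: dj; rewrite -/(cd k); lra.
have [i ei] := en_surj (fcoord x 0).
have [k] := c_meets (3, i, r, 0, [::], 0%R)%N; rewrite /= ei /= => -[j [sj dj]].
have xE : (fun k : 'I_(farity F) => snoc x 0%N (widen_ord (leqnSn (farity F)) k)) = x.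
  by apply/funext => q; rewrite widen_lift_max snoc_lift.
rewrite xE in sj; exists j.
have := settled_limit sj => /le_lt_trans/(_ (rP r (leqnn _))).
rewrite cval_f (_ : c_pt (c k) \o x = fun q => c_pt (c k) (snoc x 0%N (widen_ord (leqnSn (farity F)) q))).
  by rewrite ltr_norml => /andP[? ?]; lra.
by apply/funext => q /=; rewrite -[in LHS]xE.
Qed.

Lemma generic_structure : structure_space L generic_code.
Proof. exact: closed_rich_structure generic_code_closed generic_code_rich. Qed.

Lemma bfle_pick N (g : W) (B C : structure L) (x : nat -> B) (y : nat -> C) m i e :
  inhabited B -> inhabited C -> (m <= i)%N -> bfle (Th N) g i.+1 x y e ->
  bfle (Th N) g m.+1 (upd x m (x i)) (upd y m (y i)) e.
Proof.
move=> iB iC mi h; pose j p := if (p < m)%N then p else i.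
have : bfle (Th N) g m.+1 (x \o j) (y \o j) e.
  apply: bfle_reindex h => // [p q pq|p]; rewrite ltnS /j.
    move=> qm; rewrite (leq_trans pq qm); case: ifP => // _; apply: leq_trans mi.
    exact: leq_trans qm.
  by move=> _; case: ifP => // pm; rewrite ltnS ltnW// (leq_trans pm).
by apply: bfle_congr => p _; rewrite /upd /j /=; case: ifP.
Qed.

Section generic_ball.
Context (B : structure L) (b : nat -> B) (tb : tail_dense b) (bE : code_of b = generic_code).
Let iB : inhabited B. Proof. by split; exact: b 0%N. Qed.

(** A point of [B] is matched through a later condition, which approximates [b] at smaller ranks by
    induction; a point of [A] is matched through the tasks with tag 4. *)
Lemma generic_ball g : (g < alpha)%O -> forall k m N, (g <= c_rk (c k))%O ->
  (m <= c_len (c k))%N -> (N <= c_sh (c k))%N ->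
  bfle (Th N) g m b (c_pt (c k)) (c_rad (c k)).
Proof.
elim/(well_founded_ind (@wo_wf W)): g => g IH ga k m N gk mk Nk.
apply/bfleP => //; split; first exact/ltW/c_rad_gt0.
  move=> phi rphi; apply/ler_addgt0Pl => e e0.
  have b_dense := tail_dense_near tb.
  have [K [eta eta0 H]] := basic_near en_surj b_dense phi id e0.
  have /choice[M MP] (q : 'I_K) := generic_code_tends (en q) eta0.
  pose l := maxn k (\max_q M q).
  have h1 := H A (c_pt (c l)) _.
  move: (c_drift (leq_maxl k _ : (k <= l)%N) Nk gk mk) => /bfleP[]// _ /(_ phi rphi) h2 _.
  have {}h1 : `|basic_eval phi (restr m (c_pt (c l))) - basic_eval phi (restr m b)| < e.
    apply: h1 => q qK; rewrite bE.
    apply: (MP (Ordinal qK)); apply: leq_trans (leq_maxr _ _).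
    exact: (leq_bigmax (Ordinal qK)).
  move: h1 h2; rewrite ltr_norml !ler_norml => /andP[? ?] /andP[? ?].
  by apply/andP; split; lra.
move=> g1 g1g e' ee'; have g1a := lt_trans g1g ga.
(* An eighth of the slack suffices: the replies below cost less than [c_rad (c k) + 5 * D]. *)
pose D := (e' - c_rad (c k)) / 8.
have D0 : 0 < D by rewrite divr_gt0// subr_gt0.
have e'E : e' = c_rad (c k) + 8 * D by rewrite /D; lra.
have [eta eta0 small] := gauge_small (gTh N) m.+1 D0.
have [r rP] := inv_natS_small D0.
have near (C : structure L) (x y : nat -> C) : inhabited C ->
    (forall p, (p < m.+1)%N -> mdist (x p) (y p) <= eta) -> bfle (Th N) g1 m.+1 x y D.
  move=> iC xy; apply: (@bfle_near _ _ _ _ _ _ _ _ _ (fun=> eta)) => //.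
    by move=> _; exact: ltW.
  by apply: small => // _; exact: ltW.
split=> [x|d].
  have [i mi xi] := (tail_denseP _).1 tb x eta m eta0.
  have [k0 k0P] := c_large (maxn r i.+1); have [k1 k1P] := c_rank g1a.
  pose l := maxn k (maxn k0 k1).
  have kl : (k <= l)%N by exact: leq_maxl.
  have [len_l _ rad_l] : [/\ (maxn r i.+1 <= c_len (c l))%N, (maxn r i.+1 <= c_sh (c l))%N
      & c_rad (c l) <= (maxn r i.+1).+1%:R^-1] by apply: k0P; rewrite /l !leq_max leqnn !orbT.
  have rk_l : (g1 <= c_rk (c l))%O by apply: k1P; rewrite /l !leq_max leqnn !orbT.
  have [_ _ sh_l _] := c_extends kl.
  have h1 := IH g1 g1g g1a l i.+1 N rk_l (leq_trans (leq_maxr _ _) len_l) (leq_trans Nk sh_l).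
  have h2 := bfle_pick iB iA mi h1.
  move: (c_drift kl Nk gk mk) => /bfleP[]// _ _ /(_ g1 g1g (c_rad (c k) + D)).
  rewrite ltrDl => /(_ D0)[/(_ (c_pt (c l) i))[d h3] _]; exists d.
  have h4 : bfle (Th N) g1 m.+1 (upd b m x) (upd b m (b i)) D.
    apply: near => // p _; rewrite /upd; case: ifP => _; last exact: ltW.
    by rewrite mdistxx ltW.
  have := bfle_trans (gTh N) iB iB iA h4 (bfle_trans (gTh N) iB iA iA h2 h3).
  apply: bfle_weaken => //.
  have := le_lt_trans rad_l (rP _ (leq_maxl _ _)); rewrite e'E; lra.
pose y := upd (c_pt (c k)) m d.
have a_dense x : exists q, mdist x (a q) <= eta.
  by have [q _ xq] := (tail_denseP _).1 ta x eta 0%N eta0; exists q; exact: ltW.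
have /choice[f fP] p := a_dense (y p).
pose s := mkseq f m.+1.
have ys : bfle (Th N) g1 m.+1 y (qpt s) D.
  by apply: near => // p pm; rewrite /qpt /s nth_mkseq//; exact: fP.
(* This error exceeds what the drift of later conditions permits, which rules out the negative
   alternative of tag 4. *)
have [t /andP[t1 t2]] : exists t : rat, c_rad (c k) + 2 * D < ratr t < c_rad (c k) + 3 * D.
  by have [|t tP] := @rat_in_itvoo R (c_rad (c k) + 2 * D) (c_rad (c k) + 3 * D);
    [lra|exists t; move: tP; rewrite in_itv].
have [i ig] := geP g1a.
have [l] := c_meets (4, i, r, N, s, t)%N.
rewrite /meets size_mkseq /= ig => -[rad_l sh_l /(_ g1a) rk_l].
have {}rad_l := le_lt_trans rad_l (rP r (leqnn _)).
case=> [[j [mj jl h1]]|H].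
  have h2 := bfle_pick iB iA mj (IH g1 g1g g1a l j.+1 N rk_l jl sh_l).
  exists (b j).
  have := bfle_trans (gTh N) iB iA iA h2 (bfle_trans (gTh N) iA iA iA h1 (bfle_sym (gTh N) iA iA ys)).
  apply: bfle_weaken => //; rewrite e'E; lra.
exfalso; pose l' := maxn k l.
have [_ _ _ [e1 in1 e1E]] := c_extends (leq_maxr k l : (l <= l')%N).
have e1l : e1 < c_rad (c l) by have := c_rad_gt0 (c l'); lra.
move: (c_drift (leq_maxl k l : (k <= l')%N) Nk gk mk) => /bfleP[]// _ _ /(_ g1 g1g (c_rad (c k) + D)).
rewrite ltrDl => /(_ D0)[_ /(_ d)[x h3]].
apply: (H _ e1 e1l in1 x); have := bfle_trans (gTh N) iA iA iA h3 ys.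
apply: bfle_weaken => //; lra.
Qed.

End generic_ball.
End limit.
End not_isolated.
Lemma code_of_iso (B C : structure L) (f : B -> C) (b : nat -> B) :
  (forall F (x : 'I_(farity F) -> B), f (fint x) = fint (f \o x)) ->
  (forall P (x : 'I_(parity P) -> B), @pint _ L B P x = @pint _ L C P (f \o x)) ->
  code_of (f \o b) = code_of b.
Proof.
move=> fF fP; apply: functional_extensionality_dep => -[P|F]; apply/funext => j /=.
  by rewrite fP.
by rewrite -(iso_mdist fP) fF.
Qed.

Lemma tail_dense_iso (B C : structure L) (f : B -> C) (b : nat -> B) : bijective f ->
  (forall P (x : 'I_(parity P) -> B), @pint _ L B P x = @pint _ L C P (f \o x)) ->
  tail_dense b -> tail_dense (f \o b).
Proof.
move=> [g fg gf] fP /tail_denseP tb; apply/tail_denseP => x e N e0.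
have [k Nk xk] := tb (g x) e N e0; exists k => //.
by rewrite -(gf x) (iso_mdist fP).
Qed.

Theorem generic_isolation (n : nat) (u : nat -> A) (eps : R) : 0 < eps ->
  (forall (B : structure L) (b : nat -> B), codes (code_of b) b ->
     bfle Om alpha 0 a b 1 -> isomorphic A B) ->
  isolated n u eps.
Proof.
move=> eps0 S1; apply: contrapT => niso.
have /choice[Nf NfP] k : exists N, forall (g : W) (B C : structure L)
    (b : nat -> B) (c : nat -> C) e, inhabited B -> inhabited C ->
    bfle (Th N) g (coord_size k).+1 b c e ->
    `|cval k (code_of b) - cval k (code_of c)| <= e.
  by have [N NP] := coord_drift OmU k; exists N => g B C b c e; exact: NP.
have [ge geP] := ordinal_enum (omega1_countable WO alpha).
pose t0 := @Condition 0 a w0 0 1 w0_lt ltr01.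
have [c [c_ext c_meets]] := generic_sequence t0 extends_refl (meets_dense niso Nf ge).
have [B [b [sepB tb pE]]] := generic_structure NfP c_ext c_meets.
have iB : inhabited B by split; exact: b 0%N.
have ball := generic_ball geP tb (esym pE).
have AB : isomorphic A B.
  apply: (S1 B b); first by split.
  have small g : (g < alpha)%O -> bfle Om g 0 a b 1.
    move=> ga; have [k0 k0P] := c_large c_ext c_meets 0; have [k1 k1P] := c_rank geP c_ext c_meets ga.
    pose k := maxn k0 k1; have [_ _ rk] := k0P k (leq_maxl _ _).
    have h := ball g ga k 0%N 0%N (k1P k (leq_maxr _ _)) (leq0n _) (leq0n _).
    have : bfle (Th 0) g 0 a b 1.
      apply: bfle_sym => //; apply: bfle_congr (bfle_weaken _ _ _ _ _ h) => //.
      by apply: le_trans rk _; rewrite invr1.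
    by apply: bfle_gauge_le => // m d d0; apply: gauge_le_sh => //; exact: tr_ge0.
  apply/bfleP => //; split=> //.
    by have /bfleP[] := small _ w0_lt.
  move=> g /alpha_lim[g' gg' g'a]; by move: (small _ g'a) => /bfleP[]// _ _; exact.
have [f [fb fF fP]] := isomorphic_sym AB.
(* Through the isomorphism the generic code is also the code of an enumeration of [A] itself. *)
have ty := tail_dense_iso fb fP tb; set y := f \o b in ty.
have yE : code_of y = generic_code NfP c_ext c_meets by rewrite (code_of_iso _ fF fP) -pE.
have /choice[h hP] (pN : nat * nat) : exists k, (pN.2 <= k)%N /\ mdist (u pN.1) (y k) < eps.
  by have [k ? ?] := (tail_denseP _).1 ty (u pN.1) eps pN.2 eps0; exists k.
pose I := fix I p := if p is p'.+1 then h (p, (I p').+1) else h (0, 0)%N.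
have I_lt p : (I p < I p.+1)%N by have [] := hP (p.+1, (I p).+1).
have Iu p : mdist (y (I p)) (u p) < eps.
  by rewrite metric_sym; case: p => [|p]; [have [] := hP (0, 0)%N|have [] := hP (p.+1, (I p).+1)].
have I_mono : {homo I : p q / (p < q)%N} by apply: homo_ltn => //; exact: ltn_trans.
(* For the indices [I] this task keeps [u] away from every point of the ball, although [y] lies in
   it. *)
have [k] := c_meets (5, 0, 0, 0, mkseq I n, 0%R)%N.
rewrite /meets => /(_ _ y) H; apply: H.
- move=> p q pq qn; rewrite !nth_mkseq//; first exact: I_mono.
  exact: ltn_trans qn.
- by apply: (generic_ball geP ty yE) => //; exact: c_rk_lt.
- by move=> p pn; rewrite nth_mkseq//; exact: Iu.
Qed.

End generic.

(** * Isolation and stability *)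

Section stability.
Context {R : realType} {L : signature R} (Om : (nat -> R) -> \bar R).
Hypothesis OmU : universal_weak_modulus L Om.
Context (W : wellOrder) (WO : omega1_like W).
Local Notation Th N := (Om \o sh N).
Let gOm := universal_gauge OmU.

Lemma injective_left_inverse (i : nat -> nat) : injective i -> exists g : nat -> nat, cancel i g.
Proof.
move=> ii; have /choice[g gP] k : exists q, forall q', i q' = k -> q = q'.
  have [[q qk]|nq] := pselect (exists q, i q = k).
    by exists q => q' q'k; apply: ii; rewrite qk.
  by exists 0%N => q' q'k; case: nq; exists q'.
by exists g => q; exact: gP.
Qed.

(* [f v k] leaves room for amplifying at rank [v] after [k] more rounds of the game. *)
Theorem isolation_stability : exists f : W -> nat -> W, (forall w k, (w < f w k)%O) /\
  forall (alpha w0 : W) (A : structure L), (w0 < alpha)%O -> inhabited A ->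
  (forall v k, (v < alpha)%O -> (f v k < alpha)%O) ->
  (forall n (u : nat -> A) eps, 0 < eps -> isolated Om alpha n u eps) ->
  forall n (u v : nat -> A) e, bfle Om alpha n u v e -> zigzag Om alpha n u v e.
Proof.
have [s sP] := omega1_succ WO.
have /choice[h hP] := amplify OmU WO.
have s_ge k w : (w <= iter k s w)%O.
  by elim: k => //= k IH; apply: le_trans IH _; exact/ltW/sP.
exists (fun w k => Order.max (s w) (iter k s (h w))); split.
  by move=> w k; rewrite lt_max sP.
move=> alpha w0 A w0a iA aC iso.
have aS w : (w < alpha)%O -> (s w < alpha)%O.
  by move=> /(aC _ 0%N); rewrite gt_max => /andP[].
have aH w k : (w < alpha)%O -> (iter k s (h w) < alpha)%O.
  by move=> /(aC _ k); rewrite gt_max => /andP[].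
have half n (u v : nat -> A) e : bfle Om alpha n u v e ->
    forall e', e < e' -> forall c, exists d, bfle Om alpha n.+1 (upd u n c) (upd v n d) e'.
  move=> uv e' ee' c; pose D := (e' - e) / 8.
  have D0 : 0 < D by rewrite divr_gt0// subr_gt0.
  have e'E : e' = e + 8 * D by rewrite /D; lra.
  have e0 : 0 <= e by apply: bfle_ge0 uv.
  have [eps eps0 small] := gauge_small gOm n.+1 D0.
  (* The isolated tuple is [u] followed by the point [c] to be answered. *)
  have [I [m [y [g [N [d [Imono Im ynear [ga d0] H]]]]]]] := iso n.+1 (upd u n c) eps eps0.
  pose M := (e + 2 * D) / d.
  have M0 : 0 < M by rewrite divr_gt0//; lra.
  have M10 : 0 < M + 1 by lra.
  have [i [ni imono iw]] := weights OmU n N M10.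
  have ii : injective i.
    by move=> p q ipq; case: (ltngtP p q) => // /imono; rewrite ipq ltnn.
  have [j jK] := injective_left_inverse ii.
  (* [u] followed by the isolating tuple at the sparse places [i]; [j] is a left inverse of [i]. *)
  pose Y k := if (k < n)%N then u k else y (j k).
  have i_ge p : (n <= i p)%N.
    by case: p => // p; apply: leq_trans ni (ltnW (imono _ _ (ltn0Sn p))).
  have Yi p : Y (i p) = y p by rewrite /Y ltnNge i_ge/= jK.
  have nim : (n + (i m - n) = i m)%N by rewrite subnKC.
  have Yu p : (p < n)%N -> Y p = u p by rewrite /Y => ->.
  have eD : e < e + D by rewrite ltrDl.
  have uv' : bfle Om (iter (i m - n) s (h g)) n u v e.
    by apply: bfle_weaken uv => //; exact/ltW/aH.
  have [V Vv YV] := forth_many gOm iA iA sP eD Yu uv'.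
  rewrite nim in YV.
  have Imono' p q : (p < q)%N -> (q < n)%N -> (I p < I q)%N.
    by move=> pq qn; apply: Imono => //; exact: ltnW.
  have Im' p : (p < n)%N -> (I p < m)%N by move=> pn; exact/Im/ltnW.
  have := hP g n N M I i M0 Imono' imono iw A A m (i m) Y V _ iA iA Im'
    (i_ge m) (fun p pm => imono _ _ pm) (leqnn _) YV.
  set aY := anchor _ _ _ _ Y; set aV := anchor _ _ _ _ V => YVi.
  have aYD : aY <= D.
    have d0n : nonneg (fun _ : nat => eps) by move=> _; exact: ltW.
    apply: le_trans (_ : gauge_value Om n (fun=> eps) <= _).
      apply: (gauge_value_le OmU) => [q|q qn]; first exact: mdist_ge0.
      rewrite Yu// Yi metric_sym; apply: ltW.
      by have := ynear q (ltnW qn); rewrite /upd qn.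
    rewrite -lee_fin -(gauge_valueE OmU)//; apply: le_trans (small _ d0n (fun _ _ => lexx _)).
    apply: (gauge_le gOm); first exact: tr_ge0.
    move=> q; rewrite /tr; case: ifP => [qn|_]; first by rewrite ltnW.
    by case: ifP => // _; exact: ltW.
  (* The amplified error is nonnegative, so the anchor of [V], which measures the copy of [u] in [V]
     against [v], stays within the error of the game. *)
  have aVD : aV <= e + 2 * D.
    have := bfle_ge0 (gauge_sh N gOm) iA iA YVi.
    by rewrite pmulr_lge0 ?invr_gt0//; lra.
  have YVd : bfle (Th N) g m (Y \o i) (V \o i) d.
    apply: bfle_weaken YVi => //; first exact: gauge_sh.
    rewrite ler_pdivrMr// /M mulrC divfK ?gt_eqF//.
    have : 0 <= aV by apply: (gauge_value_ge0 OmU) => q; exact: mdist_ge0.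
    lra.
  have zy : bfle (Th N) g m (V \o i) y d.
    apply: bfle_sym => //; first exact: gauge_sh.
    by apply: bfle_congr YVd => // p _; rewrite /= Yi.
  (* The last entry of the copy of [(u, c)]. It does not depend on the rank [g'] below, which is
     what allows rank [alpha] to be reached. *)
  exists (V (i (I n))).
  have key g' : (g' < alpha)%O ->
      bfle Om g' n.+1 (upd u n c) (upd v n (V (i (I n)))) (e + 4 * D).
    move=> g'a; have [x xz xnear] := H _ zy g' D g'a D0.
    have h1 : bfle Om g' n.+1 (upd u n c) (x \o I) D.
      apply: (@bfle_near _ _ _ _ _ _ _ _ _ (fun=> eps)) => //.
      - by move=> _; exact: ltW.
      - by move=> p pn; rewrite metric_sym; apply: ltW; exact: xnear.
      - by apply: small => // _; exact: ltW.
    have h2 : bfle Om g' n.+1 (x \o I) (V \o i \o I) D by exact: bfle_reindex xz.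
    have h3 : bfle Om g' n.+1 (V \o i \o I) (upd v n (V (i (I n)))) (e + 2 * D).
      pose de q := if (q < n)%N then mdist (V q) (V (i (I q))) else 0.
      have de0 : nonneg de by move=> q; rewrite /de; case: ifP => // _; exact: mdist_ge0.
      apply: (@bfle_near _ _ _ _ _ _ _ _ _ de) => //.
        move=> p; rewrite ltnS leq_eqVlt /upd /de /= => /orP[/eqP->|pn].
          by rewrite ltnn mdistxx.
        by rewrite pn (Vv _ pn) metric_sym.
      rewrite (_ : tr n.+1 de = tr n (fun q => mdist (V q) (V (i (I q))))); last first.
        apply/funext => q; rewrite /tr /de; case: (ltnP q n) => qn; last by case: ifP.
        by rewrite ltnW.
      by rewrite (gauge_valueE OmU) ?lee_fin// => q; exact: mdist_ge0.
    have := bfle_trans gOm iA iA iA h1 (bfle_trans gOm iA iA iA h2 h3).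
    by apply: bfle_weaken => //; lra.
  have key' g' : (g' < alpha)%O -> bfle Om g' n.+1 (upd u n c) (upd v n (V (i (I n)))) e'.
    by move=> g'a; apply: bfle_weaken (key g' g'a) => //; lra.
  apply/bfleP => //; split; first lra.
    by have /bfleP[] := key' _ w0a.
  by move=> g' g'a; move: (key' _ (aS _ g'a)) => /bfleP[]// _ _; apply; exact: sP.
move=> n u v e uv e' ee'; split=> [c|d]; first exact: half uv _ ee' c.
have [c hc] := half _ _ _ _ (bfle_sym gOm iA iA uv) _ ee' d.
by exists c; exact: bfle_sym.
Qed.

End stability.

(** * Analytic sets *)

Section souslin.
Context {R : realType} {T : Type} (ev : nat -> T -> R).
Implicit Types (S : set T) (t : T) (u : nat -> T).

(* Analytic sets are presented as projections of sets which are sequentially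
   closed in [T * (nat -> nat)], for the topology induced by the functions [ev i]. *)
Definition ev_tends u t : Prop := forall i, tends (fun k => ev i (u k)) (ev i t).

Definition seq_closed (C : T -> (nat -> nat) -> Prop) : Prop :=
  forall u (zs : nat -> nat -> nat) t z, (forall k, C (u k) (zs k)) -> ev_tends u t ->
  (forall i, exists N, forall k, (N <= k)%N -> zs k i = z i) -> C t z.

Definition souslin S : Prop := exists C, seq_closed C /\ forall t, S t <-> exists z, C t z.

Lemma souslin_closed S : (forall u t, (forall k, S (u k)) -> ev_tends u t -> S t) -> souslin S.
Proof.
move=> H; exists (fun t _ => S t); split=> [u zs t z uS ut _|t]; first exact: H ut.
by split=> [St|[]//]; exists (fun=> 0%N).
Qed.

(** The first term of a witness names the set. Along a convergent sequence of witnesses it is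
    eventually constant, so finitely many of them are dropped. *)
Lemma souslin_bigcup (F : nat -> set T) : (forall n, souslin (F n)) -> souslin (\bigcup_n F n).
Proof.
move=> /choice[C CP]; exists (fun t z => C (z 0%N) t (fun i => z i.+1)); split.
  move=> u zs t z uC ut zz; have [N0 N0P] := zz 0%N.
  apply: (proj1 (CP (z 0%N)) (fun k => u (k + N0)%N) (fun k i => zs (k + N0)%N i.+1)).
  - by move=> k; rewrite -(N0P (k + N0)%N) ?leq_addl//; exact: uC.
  - by move=> i e /(ut i)[N NP]; exists N => k Nk; apply: NP; rewrite (leq_trans Nk)// leq_addr.
  - by move=> i; have [N NP] := zz i.+1; exists N => k Nk; apply: NP; rewrite (leq_trans Nk)// leq_addr.
move=> t; split=> [[n _ /(CP n).2[z Cz]]|[z Cz]].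
  by exists (fun i => if i is i'.+1 then z i' else n).
by exists (z 0%N) => //; apply/(CP (z 0%N)).2; exists (fun i => z i.+1).
Qed.

(** Witnesses for all the sets are interleaved into one sequence. *)
Lemma souslin_bigcap (F : nat -> set T) : (forall n, souslin (F n)) -> souslin (\bigcap_n F n).
Proof.
move=> /choice[C CP]; exists (fun t z => forall n, C n t (fun i => z (pickle (n, i)))); split.
  move=> u zs t z uC ut zz n; apply: (proj1 (CP n) u (fun k i => zs k (pickle (n, i)))) => //.
move=> t; split=> [H|[z Cz] n _]; last by apply/(CP n).2; exists (fun i => z (pickle (n, i))).
have /choice[z zP] n : exists z, C n t z by apply/(CP n).2; exact: H.
exists (fun i => if unpickle i is Some (n, j) then z n j else 0%N) => n.
rewrite (_ : (fun i => _) = z n)//; apply/funext => i; by rewrite pickleK.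
Qed.

Lemma souslin0 : souslin set0.
Proof. by apply: souslin_closed => u t /(_ 0%N). Qed.

Lemma souslinU S S' : souslin S -> souslin S' -> souslin (S `|` S').
Proof.
move=> sS sS'; rewrite -bigcup2E; apply: souslin_bigcup => -[|[|n]] //=; exact: souslin0.
Qed.

Lemma souslinI S S' : souslin S -> souslin S' -> souslin (S `&` S').
Proof.
move=> sS sS'; rewrite (_ : _ `&` _ = \bigcap_n (if n == 0%N then S else S')).
  by apply: souslin_bigcap => -[|n].
apply/seteqP; split=> [t [St S't] n _|t H]; first by case: ifP.
by split; [exact: (H 0%N)|exact: (H 1%N)].
Qed.

(** Symmetric under complement, so closure under countable unions makes it a sigma-algebra and
    brings in the Borel sets. *)
Definition bisouslin S : Prop := souslin S /\ souslin (~` S).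

Lemma bisouslinC S : bisouslin S -> bisouslin (~` S).
Proof. by move=> [h1 h2]; split=> //; rewrite setCK. Qed.

Lemma bisouslin_bigcup (F : nat -> set T) : (forall n, bisouslin (F n)) -> bisouslin (\bigcup_n F n).
Proof.
move=> H; split; first by apply: souslin_bigcup => n; case: (H n).
by rewrite setC_bigcup; apply: souslin_bigcap => n; case: (H n).
Qed.

Lemma souslin_lt i (r : R) : souslin [set t | ev i t < r].
Proof.
rewrite (_ : [set t | ev i t < r] = \bigcup_n [set t | ev i t <= r - n.+1%:R^-1]).
  apply: souslin_bigcup => n; apply: souslin_closed => u t uS ut.
  exact: tends_le (ut i) (tends_cst _) uS.
apply/seteqP; split=> t /= => [tr|[n _ /=]].
  have [|N NP] := @inv_natS_small R (r - ev i t); first by rewrite subr_gt0.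
  by exists N => //=; have := NP N (leqnn _); set x := _^-1; lra.
by move=> h; apply: le_lt_trans h _; rewrite ltrBlDr ltrDl invr_gt0.
Qed.

End souslin.

Section souslin_borel.
Context {R : realType} {T : topologicalType} (ev : nat -> T -> R).
Hypothesis ev_basis : forall t (U : set T), nbhs t U -> exists K, exists2 e : R, 0 < e &
  forall q, (forall i, (i < K)%N -> `|ev i q - ev i t| < e) -> U q.

Lemma bisouslin_open (U : set T) : open U -> bisouslin ev U.
Proof.
move=> oU; have UP t : U t -> exists K, exists2 e : R, 0 < e &
    forall q, (forall i, (i < K)%N -> `|ev i q - ev i t| < e) -> U q.
  by move=> Ut; apply: ev_basis; exact: open_nbhs_nbhs.
split; last first.
  apply: souslin_closed => u t uU ut Ut; have [K [e e0 H]] := UP t Ut.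
  have /choice[N NP] (i : 'I_K) := ut i e e0.
  apply: (uU (\max_i N i)); apply: H => i iK.
  by apply: (NP (Ordinal iK)); exact: (leq_bigmax (Ordinal iK)).
(* Closed boxes given by finitely many rationals and a radius: countably many of them exhaust
   [U]. *)
pose box (sr : seq rat * nat) : set T :=
  [set q | forall i, (i < size sr.1)%N -> `|ev i q - ratr (nth 0 sr.1 i)| <= sr.2.+1%:R^-1].
pose F n : set T := if unpickle n is Some sr then
  (if pselect (box sr `<=` U) then box sr else set0) else set0.
rewrite (_ : U = \bigcup_n F n).
  apply: souslin_bigcup => n; rewrite /F; case: unpickle => [sr|]; last exact: souslin0.
  case: (pselect (box sr `<=` U)) => h /=; last exact: souslin0.
  apply: souslin_closed => u t uF ut i isz.
  apply: (tends_le (tends_norm (tendsD (ut i) (tends_cst (- ratr (nth 0 sr.1 i))))) (tends_cst sr.2.+1%:R^-1)).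
  by move=> k; exact: uF.
apply/seteqP; split=> t => [Ut|[n _]]; last first.
  rewrite /F; case: unpickle => // sr; case: (pselect (box sr `<=` U)) => // sub; exact: sub.
have [K [e e0 H]] := UP t Ut.
have [r rP] := @inv_natS_small R (e / 2) ltac:(by rewrite divr_gt0).
have {rP}re := rP r (leqnn _).
have /choice[f fP] i : exists q : rat, `|ev i t - ratr q| < r.+1%:R^-1.
  have [|q qP] := @rat_in_itvoo R (ev i t - r.+1%:R^-1) (ev i t + r.+1%:R^-1).
    by rewrite ltrBlDr -addrA ltrDl addr_gt0.
  exists q; move: qP; rewrite in_itv /= ltr_norml; move: (r.+1%:R^-1) => x /andP[? ?].
  by apply/andP; split; lra.
have tb : box (mkseq f K, r) t.
  by move=> i; rewrite size_mkseq /= => iK; rewrite nth_mkseq//; exact/ltW.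
exists (pickle (mkseq f K, r)) => //; rewrite /F pickleK; case: (pselect (box _ `<=` U)) => // nsub.
exfalso; apply: nsub => q qb; apply: H => i iK.
have := qb i; have := tb i; rewrite size_mkseq /= => /(_ iK) h1 /(_ iK) h2.
move: h1 h2 re; move: (r.+1%:R^-1) => x; rewrite !ler_norml ltr_norml => /andP[? ?] /andP[? ?] ?.
by apply/andP; split; lra.
Qed.

Lemma borel_in_bisouslin (D X : set T) : borel_in D X ->
  exists2 X', bisouslin ev X' & X = D `&` X'.
Proof.
apply: (@smallest_sub _ _ _ [set X | exists2 X', bisouslin ev X' & X = D `&` X']).
- split.
  + exists set0; last by rewrite setI0.
    by apply: bisouslin_open; exact: open0.
  + move=> A [A' bA ->]; exists (~` A'); first exact: bisouslinC.
    by apply/seteqP; split=> t /= => [[Dt nA]|[Dt nA]]; split=> //; [move=> A't; exact: nA|case].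
  + move=> A /= AP.
    have /choice[A' A'P] n : exists A', bisouslin ev A' /\ A n = D `&` A'.
      by have [A' ? ?] := AP n; exists A'.
    exists (\bigcup_n A' n); first by apply: bisouslin_bigcup => n; exact: (A'P n).1.
    rewrite setI_bigcupr; apply: eq_bigcupr => n _; exact: (A'P n).2.
- by move=> _ [U oU <-]; exists U => //; exact: bisouslin_open.
Qed.

End souslin_borel.

Lemma souslin_preimage (R : realType) (T T' : Type) (ev : nat -> T -> R) (ev' : nat -> T' -> R)
    (f : T -> T') (g : nat -> nat) (S : set T') :
  (forall i t, ev' i (f t) = ev (g i) t) -> souslin ev' S -> souslin ev (f @^-1` S).
Proof.
move=> fg [C [cC CP]]; exists (fun t z => C (f t) z); split=> [u zs t z uC ut|t]; last exact: CP.
apply: (cC (f \o u)) => // i e e0; have [N NP] := ut (g i) e e0.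
by exists N => k Nk /=; rewrite !fg; exact: NP.
Qed.

(** * A bound on the rank of analytic sets of non-isomorphic pairs *)

Lemma not_acc_chain (T : Type) (r : T -> T -> Prop) (x : T) : ~ Acc r x ->
  exists f : nat -> T, f 0%N = x /\ forall n, r (f n.+1) (f n).
Proof.
move=> nx; pose S := {y : T | ~ Acc r y}.
have /choice[g gP] (y : S) : exists z : S, r (projT1 z) (projT1 y).
  apply: contrapT => H; apply: (projT2 y); split=> z zy; apply: contrapT => nz.
  by apply: H; exists (exist _ z nz).
pose f n := iter n g (exist _ x nx : S); exists (fun n => projT1 (f n)); split=> // n.
exact: gP (f n).
Qed.

Section code_souslin.
Context {R : realType} {L : signature R}.
Context (en : nat -> coordinate (L := L)).
Hypothesis en_surj : forall k, exists i, en i = k.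
Local Notation codes2 := (code_space L * code_space L)%type.

Definition ev1 (i : nat) (p : code_space L) : R := cval (en i) p.

Definition ev2 (i : nat) (pq : codes2) : R :=
  if odd i then ev1 i./2 pq.2 else ev1 i./2 pq.1.

Lemma ev2_fst i pq : ev2 i.*2 pq = ev1 i pq.1.
Proof. by rewrite /ev2 odd_double doubleK. Qed.

Lemma ev2_snd i pq : ev2 i.*2.+1 pq = ev1 i pq.2.
Proof. by rewrite /ev2 /= odd_double /= uphalf_double. Qed.

Lemma ev1_code_tends u p : ev_tends ev1 u p <-> code_tends u p.
Proof.
split=> [H k|H i]; last exact: H.
by have [i <-] := en_surj k; exact: H.
Qed.

Lemma ev1_basis (t : code_space L) (U : set (code_space L)) : nbhs t U ->
  exists K, exists2 e : R, 0 < e & forall q, (forall i, (i < K)%N -> `|ev1 i q - ev1 i t| < e) -> U q.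
Proof. exact: code_nbhs_coord. Qed.

Lemma ev2_basis (t : codes2) (U : set codes2) : nbhs t U ->
  exists K, exists2 e : R, 0 < e & forall q, (forall i, (i < K)%N -> `|ev2 i q - ev2 i t| < e) -> U q.
Proof.
move=> [[P Q] [/= /ev1_basis[K [e e0 KP]] /ev1_basis[K' [e' e'0 KQ]]] PQ].
exists (maxn K K').*2.+2, (Num.min e e'); first by rewrite lt_min e0.
move=> q qt; apply: PQ; split.
  apply: KP => i iK; have := qt i.*2; rewrite !ev2_fst lt_min => h.
  have /h/andP[]// : (i.*2 < (maxn K K').*2.+2)%N.
  by have := leq_maxl K K'; lia.
apply: KQ => i iK; have := qt i.*2.+1; rewrite !ev2_snd lt_min => h.
have /h/andP[]// : (i.*2.+1 < (maxn K K').*2.+2)%N.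
by have := leq_maxr K K'; lia.
Qed.

Lemma codes_closed_rich (p : code_space L) : structure_space L p <-> closed_code p /\ rich_code p.
Proof.
split=> [[A [a [_ ta ->]]]|[cp rp]]; last exact: closed_rich_structure.
by split; [exact: code_of_closed|exact: tail_dense_rich].
Qed.

Lemma souslin_structure_space : souslin ev1 (structure_space L).
Proof.
pose F (t : nat) : set (code_space L) := if unpickle t is Some (i, N, r) then
  \bigcup_k [set p | code_dist p i (N + k) < r.+1%:R^-1] else setT.
pose G (t : nat) : set (code_space L) := if unpickle t is Some (l, r) then
  match en l with
  | existT (inr F) x => \bigcup_k [set p | cval (fcoord (fun i : 'I_(farity F) => x (widen_ord (leqnSn _) i)) k) p < r.+1%:R^-1]
  | _ => setT end else setT.
have lt k (r : R) : souslin ev1 [set p | cval k p < r].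
  by have [i <-] := en_surj k; exact: (@souslin_lt R _ ev1 i r).
have sT : souslin ev1 setT by apply: souslin_closed.
rewrite (_ : structure_space L = closed_code `&` (\bigcap_t F t `&` \bigcap_t G t)).
  apply: souslinI; first by apply: souslin_closed => u p cu /ev1_code_tends; exact: closed_code_lim.
  apply: souslinI; apply: souslin_bigcap => t.
    rewrite /F; case: (unpickle t) => [[[i N] r]|]//; apply: souslin_bigcup => k; exact: lt.
  rewrite /G; case: (unpickle t) => [[l r]|]//; case: (en l) => -[P|f] x //.
  apply: souslin_bigcup => k; exact: lt.
apply/seteqP; split=> p.
  move=> /codes_closed_rich[cp [rt rf]]; split=> //; split=> t _.
    rewrite /F; case: (unpickle t) => [[[i N] r]|]//.
    have [k Nk h] := rt i N _ (inv_natS_gt0 r); exists (k - N)%N => //=.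
    by rewrite subnKC.
  rewrite /G; case: (unpickle t) => [[l r]|]//; case: (en l) => -[P|f] x //.
  by have [k h] := rf f (fun i => x (widen_ord (leqnSn _) i)) _ (inv_natS_gt0 r); exists k.
move=> [cp [Fp Gp]]; apply/codes_closed_rich; split=> //; split=> [i N e e0|f x e e0].
  have [r rP] := inv_natS_small e0; have := Fp (pickle (i, N, r)) I.
  rewrite /F pickleK => -[k _ /= h]; exists (N + k)%N; first exact: leq_addr.
  by apply: lt_trans h (rP _ _).
have [r rP] := inv_natS_small e0; have [l lE] := en_surj (fcoord x 0).
have := Gp (pickle (l, r)) I; rewrite /G pickleK lE /= => -[k _ /=].
rewrite (_ : (fun i : 'I_(farity f) => snoc x 0%N (widen_ord (leqnSn (farity f)) i)) = x); last first.
  by apply/funext => q; rewrite widen_lift_max snoc_lift.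
by move=> h; exists k; apply: lt_trans h (rP _ _).
Qed.

Lemma code_complete (u : nat -> code_space L) :
  (forall k, exists l, tends (fun n => cval k (u n)) l) -> exists p, code_tends u p.
Proof.
move=> H; exists (fun s j => projT1 (cid (H (existT _ s j)))) => -[s j].
exact: projT2 (cid (H (existT _ s j))).
Qed.

(** * The well-founded tree of approximate isomorphisms *)

Section tree.
Context (Om : (nat -> R) -> \bar R) (OmU : universal_weak_modulus L Om).
Context (W : wellOrder) (WO : omega1_like W).
Let gOm := universal_gauge OmU.
Context (S : set codes2) (sS : souslin ev2 S).
Hypothesis S_not_iso : forall pq, S pq -> structure_space L pq.1 /\ structure_space L pq.2 /\
  forall A a B b, codes pq.1 (A := A) a -> codes pq.2 (A := B) b -> ~ isomorphic A B.

Context (C : codes2 -> (nat -> nat) -> Prop) (C_closed : seq_closed ev2 C)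
  (CP : forall t, S t <-> exists z, C t z).

(* A branch of the tree consists of a point of S, of a witness for it, and of
   two enumerations matched by the back-and-forth game. *)
Record branch := Branch {
  br_pt : codes2 ; br_wit : nat -> nat ; br_l : nat -> nat ; br_r : nat -> nat }.

Definition letter : Type := (nat * nat * nat * seq int)%type.

(** Letter [k] fixes coordinates 0 to [k] up to $1/(k+1)$ by integers, so the alphabet is countable
    and an infinite branch makes the pairs of codes converge. *)
Definition encode (t : branch) (k : nat) : letter :=
  (br_wit t k, br_l t k, br_r t k, mkseq (fun m => Num.floor (k.+1%:R * ev2 m (br_pt t))) k.+1).

(** The bound 2 is a closed condition and passes to the limit; the game in [node_bound] keeps its
    errors strictly below 2. *)
Definition matched (k : nat) (t : branch) : Prop :=
  [/\ C (br_pt t) (br_wit t),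
   forall l, (l < k)%N -> if odd l then br_r t l = l./2 else br_l t l = l./2 &
   exists A a B b, [/\ codes (br_pt t).1 (A := A) a, codes (br_pt t).2 (A := B) b &
     forall n, (n <= k)%N -> bf0le Om n (a \o br_l t) (b \o br_r t) 2]].

Definition node (s : seq letter) : Prop :=
  exists2 t, matched (size s) t & s = mkseq (encode t) (size s).

(* An infinite branch through this tree would yield a point of S together with an
   isomorphism between its two structures. *)
Definition child (s' s : seq letter) : Prop := node s' /\ exists x, s' = rcons s x.

Lemma floor_close (k : nat) (x y : R) :
  Num.floor (k.+1%:R * x) = Num.floor (k.+1%:R * y) -> `|x - y| <= k.+1%:R^-1.
Proof.
move=> xy; have /andP[x1 x2] := floor_itv (k.+1%:R * x).
have /andP[y1 y2] := floor_itv (k.+1%:R * y).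
rewrite xy in x1 x2; move: x1 x2 y1 y2; set f := Num.floor _; rewrite intrD => x1 x2 y1 y2.
have h : `|k.+1%:R * x - k.+1%:R * y| <= 1 by rewrite ler_norml; apply/andP; split; lra.
rewrite -mulrBr normrM ger0_norm// in h.
by rewrite -(mul1r k.+1%:R^-1) ler_pdivlMr// mulrC.
Qed.

Lemma child_wf : Acc child [::].
Proof.
apply: contrapT => nacc; have [f [f0 fP]] := not_acc_chain nacc.
have fsz n : size (f n) = n.
  by elim: n => [|n IH]; [rewrite f0|have [_ [x ->]] := fP n; rewrite size_rcons IH].
pose x0 : letter := (0, 0, 0, [::])%N.
pose w n := nth x0 (f n.+1) n.
have fw n : f n = mkseq w n.
  elim: n => [|n IH]; first by rewrite f0.
  have [_ [x fx]] := fP n.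
  by rewrite mkseqS -IH /w fx nth_rcons fsz ltnn eqxx.
have /choice[t tP] n : exists t, matched n.+1 t /\ forall l, (l <= n)%N -> encode t l = w l.
  have [[t mt ft] _] := fP n; rewrite fsz in mt ft; exists t; split=> // l ln.
  have := congr1 (fun s => nth x0 s l) ft; rewrite fw !nth_mkseq//; exact.
have wz n l : (l <= n)%N -> br_wit (t n) l = (w l).1.1.1.
  by move=> /(tP n).2 <-.
have wl n l : (l <= n)%N -> br_l (t n) l = (w l).1.1.2 by move=> /(tP n).2 <-.
have wr n l : (l <= n)%N -> br_r (t n) l = (w l).1.2 by move=> /(tP n).2 <-.
have close m k n n' : (m <= k)%N -> (k <= n)%N -> (k <= n')%N ->
    `|ev2 m (br_pt (t n)) - ev2 m (br_pt (t n'))| <= k.+1%:R^-1.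
  move=> mk kn kn'; apply: floor_close.
  have : (encode (t n) k).2 = (encode (t n') k).2 by rewrite (tP n).2// (tP n').2.
  by move=> /(congr1 (fun s => nth 0 s m)); rewrite !nth_mkseq// ltnS.
have lim m : exists l, tends (fun n => ev2 m (br_pt (t n))) l.
  have [e e0|l lP] := cdist_complete (@real_complete_distance R) (u := fun n => ev2 m (br_pt (t n))).
    have [N NP] := inv_natS_small e0; exists (maxn m N) => n n' h h'.
    apply: le_trans (close m (maxn m N) n n' _ h h') _; first exact: leq_maxl.
    by apply/ltW/NP; exact: leq_maxr.
  exists l => e e0; have [|N NP] := lP (e / 2); first by rewrite divr_gt0.
  by exists N => k /NP h; apply: le_lt_trans h _; lra.
have [p pP] : exists p, code_tends (fun n => (br_pt (t n)).1) p.
  apply: code_complete => k; have [i <-] := en_surj k; have [l lP] := lim i.*2.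
  by exists l => e /lP[N NP]; exists N => n /NP; rewrite ev2_fst.
have [q qP] : exists q, code_tends (fun n => (br_pt (t n)).2) q.
  apply: code_complete => k; have [i <-] := en_surj k; have [l lP] := lim i.*2.+1.
  by exists l => e /lP[N NP]; exists N => n /NP; rewrite ev2_snd.
have pq : ev_tends ev2 (fun n => br_pt (t n)) (p, q).
  by move=> i; rewrite /ev2; case: ifP => _; [exact: qP|exact: pP].
have Spq : S (p, q).
  (* The witness spelled by the letters is the limit of the witnesses of the nodes, so closedness of
     [C] applies. *)
  apply/CP; exists (fun l => (w l).1.1.1).
  apply: (C_closed (zs := fun n => br_wit (t n)) _ pq) => [n|i]; first by have [[cn _ _] _] := tP n.
  by exists i => k ik; exact: wz.
have [[A [a [sA ta pE]]] [[B [b [sB tb qE]]] niso]] := S_not_iso Spq.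
apply: (niso A a B b); [by split|by split|].
pose i l := (w l).1.1.2; pose j l := (w l).1.2.
have book l : if odd l then j l = l./2 else i l = l./2.
  have [[_ /(_ l (ltnSn l)) h _] _] := tP l.
  by move: h; rewrite /i /j (wr l l)// (wl l l).
apply: (interleaved_isomorphic OmU (C := 2) ta tb book).
move=> n phi rphi; apply/ler_addgt0Pl => e e0; have e20 : 0 < e / 2 by rewrite divr_gt0.
have a_dense := tail_dense_near ta.
have b_dense := tail_dense_near tb.
have [K [eta eta0 H]] := basic_near en_surj a_dense phi i e20.
have [K' [eta' eta'0 H']] := basic_near en_surj b_dense phi j e20.
have /choice[N NP] (m : 'I_K) := pP (en m) eta eta0.
have /choice[N' N'P] (m : 'I_K') := qP (en m) eta' eta'0.
pose k := maxn n (maxn (\max_m N m) (\max_m N' m)).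
have [[_ _ [A' [a' [B' [b' [[_ _ aE] [_ _ bE] m2]]]]]] _] := tP k.
have h1 := H A' a' _; have h2 := H' B' b' _.
have {}h1 : `|basic_eval phi (restr n (a' \o i)) - basic_eval phi (restr n (a \o i))| < e / 2.
  apply: h1 => m mK; rewrite -aE -pE; apply: (NP (Ordinal mK)).
  by rewrite /k !leq_max (leq_bigmax (Ordinal mK)) orbT.
have {}h2 : `|basic_eval phi (restr n (b' \o j)) - basic_eval phi (restr n (b \o j))| < e / 2.
  apply: h2 => m mK; rewrite -bE -qE; apply: (N'P (Ordinal mK)).
  by rewrite /k !leq_max (leq_bigmax (Ordinal mK)) !orbT.
have nk : (n <= k)%N by exact: leq_maxl.
have := m2 n (leqW nk) phi rphi.
rewrite (_ : restr n (a' \o br_l (t k)) = restr n (a' \o i)); last first.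
  by apply: restr_eq => l ln /=; rewrite wl// (leq_trans (ltnW ln)).
rewrite (_ : restr n (b' \o br_r (t k)) = restr n (b' \o j)); last first.
  by apply: restr_eq => l ln /=; rewrite wr// (leq_trans (ltnW ln)).
move: h1 h2; rewrite !ltr_norml !ler_norml => /andP[? ?] /andP[? ?] /andP[? ?].
by apply/andP; split; lra.
Qed.

(* Playing the game from a matched node of rank g > w leads to a child node, so the
   ranks at the nodes are bounded along the well-founded tree. *)
Lemma node_bound (s : seq letter) : Acc child s -> exists w : W,
  forall t, matched (size s) t -> s = mkseq (encode t) (size s) ->
  forall (A : structure L) a (B : structure L) b, codes (br_pt t).1 (A := A) a ->
  codes (br_pt t).2 (A := B) b -> forall g e, e < 2 ->
  bfle Om g (size s) (a \o br_l t) (b \o br_r t) e -> (g <= w)%O.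
Proof.
elim=> {}s _ IH.
have [w00] := omega1_inhabited WO.
have /choice[f fP] (x : letter) : exists w : W, node (rcons s x) ->
    forall t, matched (size (rcons s x)) t -> rcons s x = mkseq (encode t) (size (rcons s x)) ->
    forall (A : structure L) a (B : structure L) b, codes (br_pt t).1 (A := A) a ->
    codes (br_pt t).2 (A := B) b -> forall g e, e < 2 ->
    bfle Om g (size (rcons s x)) (a \o br_l t) (b \o br_r t) e -> (g <= w)%O.
  have [nx|nnx] := pselect (node (rcons s x)); last by exists w00.
  by have [w wP] := IH _ (conj nx (ex_intro _ x erefl)); exists w.
(* A node has countably many children, so their bounds have a common strict bound. *)
have [w wP] := omega1_bound WO (fun n => if unpickle n is Some x then f x else w00).
exists w => t mt st A a B b ca cb g e e2 tg; rewrite leNgt; apply/negP => wg.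
have [_ ta _] := ca; have [_ tb _] := cb.
have iA : inhabited A by split; exact: a 0%N.
have iB : inhabited B by split; exact: b 0%N.
set k := size s in mt st tg.
(* Successive midpoints towards 2: [e1] for the reply, [e3] after moving it into the dense
   sequence. *)
pose e1 := (e + 2) / 2; pose e3 := (e1 + 2) / 2.
have e12 : e1 < 2 by rewrite /e1; lra.
have e32 : e3 < 2 by rewrite /e3; lra.
have e31 : 0 < e3 - e1 by rewrite /e3; lra.
have [eta eta0 near] := bfle_upd_near (L := L) w k gOm e31.
have [l [r [lr h]]] : exists l r, (if odd k then r = k./2 else l = k./2) /\
    bfle Om w k.+1 (upd (a \o br_l t) k (a l)) (upd (b \o br_r t) k (b r)) e3.
  move: (tg) => /bfleP[]// _ _ /(_ w wg e1); rewrite /e1 => /(_ ltac:(lra))[h1 h2].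
  case: (boolP (odd k)) => ok.
    have [c hc] := h2 (b k./2); have [l _ cl] := (tail_denseP _).1 ta c eta 0%N eta0.
    exists l, k./2; split=> //; rewrite (_ : e3 = (e3 - e1) + e1); last by rewrite subrK.
    apply: bfle_trans hc => //; apply: near => //.
    by rewrite (@metric_sym _ A) ltW.
  have [d hd] := h1 (a k./2); have [r _ dr] := (tail_denseP _).1 tb d eta 0%N eta0.
  exists k./2, r; split=> //; rewrite (_ : e3 = e1 + (e3 - e1)); last by rewrite addrC subrK.
  by apply: bfle_trans hd _ => //; apply: near => //; exact: ltW.
pose t' := Branch (br_pt t) (br_wit t) (upd (br_l t) k l) (upd (br_r t) k r).
have enc p : (p < k)%N -> encode t' p = encode t p by move=> pk; rewrite /encode /= /upd pk.
pose x := encode t' k.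
have szx : size (rcons s x) = k.+1 by rewrite size_rcons.
have sx : rcons s x = mkseq (encode t') (size (rcons s x)).
  rewrite szx mkseqS {1}st; congr rcons; apply/eq_in_map => p; rewrite mem_iota => /andP[_ pk].
  by rewrite enc.
have mt' : matched (size (rcons s x)) t'.
  rewrite szx; have [Ct bt _] := mt; split=> //.
    move=> p; rewrite ltnS leq_eqVlt /= /upd => /orP[/eqP->|pk]; first by rewrite ltnn.
    by rewrite pk; exact: bt.
  exists A, a, B, b; split=> // n nk; rewrite /= !comp_upd.
  have := bfle_take gOm iA iB nk h => /bfleP[]// _ h0 _ phi rphi.
  by apply: le_trans (h0 phi rphi) _; exact: ltW.
have nx : node (rcons s x) by exists t'.
have hx := fP x nx t' mt' sx A a B b ca cb w e3 e32.
have : (w <= f x)%O by apply: hx; rewrite szx /= !comp_upd.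
by rewrite leNgt => /negP; apply; have := wP (pickle x); rewrite pickleK.
Qed.

End tree.

(** Boundedness for analytic sets: every point of [S] sits at the root with an empty matching, so
    the ordinal bounding the root bounds all of [S]. *)
Theorem souslin_bound (Om : (nat -> R) -> \bar R) (OmU : universal_weak_modulus L Om)
    (W : wellOrder) (WO : omega1_like W) (S : set codes2) : souslin ev2 S ->
  (forall pq, S pq -> structure_space L pq.1 /\ structure_space L pq.2 /\
    forall A a B b, codes pq.1 (A := A) a -> codes pq.2 (A := B) b -> ~ isomorphic A B) ->
  exists w : W, forall pq, S pq -> forall (A : structure L) a (B : structure L) b,
    codes pq.1 (A := A) a -> codes pq.2 (A := B) b -> ~ bfle Om w 0 a b 1.
Proof.
move=> [C [cC CP]] Sn.
have [w wP] := node_bound OmU WO (child_wf OmU Sn cC CP).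
have [s sP] := omega1_succ WO; exists (s w) => pq Spq A a B b ca cb ab.
have [z Cz] := (CP pq).1 Spq.
have lt12 : 1 < 2 :> R by rewrite ltr1n.
have iA : inhabited A by split; exact: a 0%N.
have iB : inhabited B by split; exact: b 0%N.
have mt : matched Om C 0 (Branch pq z id id).
  split=> //; exists A, a, B, b; split=> // n; rewrite leqn0 => /eqP-> phi rphi.
  move: ab => /(bfleP _ _ _ _ _ (universal_gauge OmU) iA iB)[_ h _].
  by apply: le_trans (h _ rphi) _; rewrite ler1n.
have := wP (Branch pq z id id) mt erefl A a B b ca cb (s w) 1 lt12 ab.
by rewrite leNgt sP.
Qed.

End code_souslin.

(** * From Borel isomorphism to bounded ranks *)

Section stable.
Context {R : realType} {L : signature R} (Om : (nat -> R) -> \bar R).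
Hypothesis gOm : gauge Om.
Context (W : wellOrder) (A : structure L) (iA : inhabited A).

Lemma zigzag_bfle (B : structure L) (g : W) n (a : nat -> A) (b : nat -> B) e :
  inhabited B -> 0 <= e -> zigzag Om g n a b e -> bfle Om g n a b e.
Proof.
move=> iB e0 H; have [x] := iA; have [y] := iB; apply/bfleP => //; split=> //.
  move=> phi rphi; apply/ler_addgt0Pr => d d0.
  have [|/(_ x)[z hz] _] := H (e + d); first by rewrite ltrDl.
  move: hz => /bfleP[]// _ /(bf0le_upd gOm)/(_ phi rphi) h _.
  exact: h.
move=> g' g'g e' /H[h1 h2]; split=> [c|d].
  by have [d hd] := h1 c; exists d; apply: bfle_weaken hd => //; exact: ltW.
by have [c hc] := h2 d; exists c; apply: bfle_weaken hc => //; exact: ltW.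
Qed.

Lemma extend_tuple n (x : 'I_n -> A) : exists u : nat -> A, restr n u = x.
Proof.
have [a0] := iA; exists (fun k => if insub k is Some i then x i else a0).
by apply/funext => i /=; rewrite valK.
Qed.

Lemma lee_of_real (x y : \bar R) : (0 <= y)%E ->
  (forall e : R, (y <= e%:E)%E -> (x <= e%:E)%E) -> (x <= y)%E.
Proof. by case: y => [y| |] //= _; [apply|move=> _; exact: leey]. Qed.

Lemma bf_stableP (g : W) : bf_stable Om A g <->
  forall n (u v : nat -> A) e, bfle Om g n u v e -> zigzag Om g n u v e.
Proof.
split=> [H n u v e uv|H n x y].
  have e0 := bfle_ge0 gOm iA iA uv.
  by move: uv; rewrite /bfle H => /(bf_step_leP _ _ _ _ _ _ iA iA)[].
have [u <-] := extend_tuple x; have [v <-] := extend_tuple y.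
apply: le_anti; apply/andP; split; apply: lee_of_real.
- by apply: ereal_sup_ubound; left.
- by move=> e /(bf_step_leP _ _ _ _ _ _ iA iA)[e0 /zigzag_bfle]; exact.
- rewrite leNgt; apply/negP => lt0.
  have : bfle Om g n u v (-1).
    case E : (bf Om g (restr n u) (restr n v)) lt0 => [r| |] // r0.
      have : bfle Om g n u v r by rewrite /bfle E.
      by move=> /(bfle_ge0 gOm iA iA); rewrite leNgt -lte_fin r0.
    by rewrite /bfle E leNye.
  by move=> /(bfle_ge0 gOm iA iA); rewrite lerNr oppr0 ler10.
- move=> e uv; apply/(bf_step_leP _ _ _ _ _ _ iA iA); split; last exact: H.
  exact: bfle_ge0 uv.
Qed.

End stable.

Section forward.
Context {R : realType} {L : signature R} (L_countable : countable_signature L).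
Context (X : set (code_space L)) (X_borel : borel_in (structure_space L) X).
Context (X_invariant : iso_invariant X).
Context (Om : (nat -> R) -> \bar R) (OmU : universal_weak_modulus L Om).

Lemma least_wo (W : wellOrder) (P : W -> Prop) (w : W) : P w ->
  exists w', P w' /\ forall v, P v -> (w' <= v)%O.
Proof.
elim/(well_founded_ind (@wo_wf W)): w => w IH Pw.
have [[v vw Pv]|H] := pselect (exists2 v, (v < w)%O & P v); first exact: IH vw Pv.
by exists w; split=> // v Pv; rewrite leNgt; apply/negP => vw; apply: H; exists v.
Qed.

(** Equal codes give equal values to all formulas, so the two enumerations match with constant 0. *)
Lemma codes_isomorphic p (A B : structure L) (a : nat -> A) (b : nat -> B) :
  codes p a -> codes p b -> isomorphic A B.
Proof.
move=> [_ ta pa] [_ tb pb]; have [en en_surj] := coord_countable L_countable.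
apply: (tail_isomorphic OmU ta tb (C := 0)) => n phi _.
have a_dense := tail_dense_near ta.
apply/ler_addgt0Pr => e e0; rewrite add0r.
have [K [eta eta0 H]] := basic_near en_surj a_dense phi id e0.
rewrite distrC; apply/ltW; apply: (H B b).
by rewrite -pa pb; exact: near_code_refl.
Qed.

Lemma bounded_of_borel : borel_in (X `*` X) (iso_on X) -> scott_ranks_bounded Om X.
Proof.
move=> iso_borel; have [W WO] := omega1_exists; have [en en_surj] := coord_countable L_countable.
have [X' [sX' cX'] XE] := borel_in_bisouslin (ev1_basis en_surj) X_borel.
have [E' [sE' cE'] EE] := borel_in_bisouslin (ev2_basis en_surj) iso_borel.
(* Either [q] lies outside [X], or [(p, q)] outside the isomorphism relation on [X]; invariance of
   [X] makes both cases non-isomorphism. The sets [X'] and [E'] have analytic complements in the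
   whole spaces. *)
pose S : set (code_space L * code_space L) :=
  (fst @^-1` X) `&` ((snd @^-1` structure_space L) `&` ((snd @^-1` ~` X') `|` ~` E')).
have sfst (Y : set (code_space L)) : souslin (ev1 en) Y ->
    souslin (ev2 en) ((fst : code_space L * code_space L -> _) @^-1` Y).
  by apply: souslin_preimage => i t; exact: esym (ev2_fst en i t).
have ssnd (Y : set (code_space L)) : souslin (ev1 en) Y ->
    souslin (ev2 en) ((snd : code_space L * code_space L -> _) @^-1` Y).
  by apply: souslin_preimage => i t; exact: esym (ev2_snd en i t).
have sss := souslin_structure_space en_surj.
have sS : souslin (ev2 en) S.
  apply: souslinI; first by apply: sfst; rewrite XE; exact: souslinI.
  apply: souslinI; first exact: ssnd.
  by apply: souslinU => //; exact: ssnd.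
have S_niso pq : S pq -> structure_space L pq.1 /\ structure_space L pq.2 /\
    forall A a B b, codes pq.1 (A := A) a -> codes pq.2 (A := B) b -> ~ isomorphic A B.
  move=> [/= Xp [qs nE]]; split; first by move: Xp; rewrite XE => -[].
  split=> // A a B b ca cb AB; have pq_iso : code_iso pq.1 pq.2 by exists A, a, B, b.
  have Xq : X pq.2 by exact: X_invariant Xp qs pq_iso.
  case: nE; first by move=> h; apply: h; move: Xq; rewrite XE => -[].
  by move=> h; apply: h; have : iso_on X pq by []; rewrite EE => -[].
have [w wP] := souslin_bound en_surj OmU WO sS S_niso.
have [f [f_gt stab]] := isolation_stability OmU WO.
have [alpha walpha alpha_closed] := omega1_closed WO f w.
exists W, alpha; split; first exact: omega1_countable WO alpha.
move=> p Xp A a cp; have [sepA ta pE] := cp.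
have iA : inhabited A by split; exact: a 0%N.
have gOm := universal_gauge OmU.
have stable_alpha : bf_stable Om A alpha.
  apply/(bf_stableP gOm) => // n u v e.
  apply: (stab alpha w A walpha iA alpha_closed) => {}n {}u eps eps0.
  apply: (generic_isolation OmU en_surj WO walpha _ ta) => // [g galpha|B b cb ab].
    by exists (f g 0%N); [exact: f_gt|exact: alpha_closed].
  have iB : inhabited B by split; exact: b 0%N.
  apply: contrapT => nAB; apply: (wP (p, code_of b) _ A a B b) => //.
    split=> //=; split; first by exists B, b.
    apply: contrapT => /not_orP[/contrapT/= X'q /contrapT E'pq].
    have Xq : X (code_of b) by rewrite XE; split=> //; exists B, b.
    have : iso_on X (p, code_of b) by rewrite EE.
    move=> [_ _ [A1 [a1 [B1 [b1 [c1 c2 AB]]]]]].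
    exact: nAB (isomorphic_trans (isomorphic_trans (codes_isomorphic cp c1) AB) (codes_isomorphic c2 cb)).
  by apply: bfle_weaken ab => //; exact: ltW.
have [alpha' [st' le']] := least_wo stable_alpha.
by exists alpha' => //; exact: le'.
Qed.

End forward.

(** * From bounded ranks to Borel isomorphism *)

Section index_game.
Context {R : realType} {L : signature R} (Om : (nat -> R) -> \bar R).
Hypothesis gOm : gauge Om.
Context (W : wellOrder).
Implicit Types (A B : structure L) (g : W).

(** Moves among the indices of the dense sequences with slack $1/(r+1)$: only countable quantifiers
    occur. *)
Definition index_zigzag g A B n (a : nat -> A) (b : nat -> B) (i j : nat -> nat) (e : R) : Prop :=
  forall r : nat,
  (forall k, exists l, bfle Om g n.+1 (a \o upd i n k) (b \o upd j n l) (e + r.+1%:R^-1)) /\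
  (forall l, exists k, bfle Om g n.+1 (a \o upd i n k) (b \o upd j n l) (e + r.+1%:R^-1)).

Lemma zigzag_index g A B n (a : nat -> A) (b : nat -> B) (i j : nat -> nat) (e : R) :
  tail_dense a -> tail_dense b ->
  zigzag Om g n (a \o i) (b \o j) e <-> index_zigzag g n a b i j e.
Proof.
move=> /tail_denseP ta /tail_denseP tb.
have iA : inhabited A by split; exact: a 0%N.
have iB : inhabited B by split; exact: b 0%N.
split=> [H r|H e' ee'].
  have r0 : 0 < r.+1%:R^-1 / 2 :> R by rewrite divr_gt0// inv_natS_gt0.
  have [eta eta0 near] := bfle_upd_near (L := L) g n gOm r0.
  have [|h1 h2] := H (e + r.+1%:R^-1 / 2); first by rewrite ltrDl.
  rewrite [r.+1%:R^-1]splitr addrA; split=> [k|l].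
    have [d hd] := h1 (a k); have [l _ dl] := tb d eta 0%N eta0; exists l.
    by rewrite !comp_upd; apply: bfle_trans hd _ => //; apply: near => //; exact: ltW.
  have [c hc] := h2 (b l); have [k _ ck] := ta c eta 0%N eta0; exists k.
  rewrite !comp_upd addrC; apply: bfle_trans hc => //; apply: near => //.
  by rewrite (@metric_sym _ A) ltW.
have e20 : 0 < (e' - e) / 2 by rewrite divr_gt0// subr_gt0.
have [r rP] := inv_natS_small e20; have [h1 h2] := H r.
have [eta eta0 near] := bfle_upd_near (L := L) g n gOm e20.
have le : e + r.+1%:R^-1 <= e + (e' - e) / 2 by rewrite lerD2l ltW// rP.
have eE : e' = (e' - e) / 2 + (e + (e' - e) / 2) by lra.
split=> [c|d].
  have [k _ ck] := ta c eta 0%N eta0; have [l hl] := h1 k; exists (b l).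
  rewrite eE; apply: (bfle_trans gOm iA iA iB (near A _ c (a k) iA (ltW ck))).
  by rewrite -!comp_upd; exact: bfle_weaken hl.
have [l _ dl] := tb d eta 0%N eta0; have [k hk] := h2 l; exists (a k).
rewrite eE addrC; apply: (bfle_trans gOm iA iB iB (b := upd (b \o j) n (b l))).
  by rewrite -!comp_upd; exact: bfle_weaken hk.
by apply: near => //; rewrite (@metric_sym _ B) ltW.
Qed.

Lemma stable_above (A : structure L) (alpha beta : W) : inhabited A -> (alpha <= beta)%O ->
  bf_stable Om A alpha -> forall n (u v : nat -> A) e,
  bfle Om beta n u v e -> zigzag Om beta n u v e.
Proof.
move=> iA ab /(bf_stableP gOm iA) st.
(* After a stable rank the distances inside [A] no longer grow. *)
have up (g : W) n (u v : nat -> A) e : bfle Om alpha n u v e -> bfle Om g n u v e.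
  elim/(well_founded_ind (@wo_wf W)): g n u v e => g IH n u v e uv.
  move: (uv) => /bfleP[]// e0 h0 h; apply/bfleP => //; split=> // g' g'g.
  case: (ltP g' alpha) => [|ag']; first exact: h.
  move=> e' ee'; have [h1 h2] := st _ _ _ _ uv e' ee'.
  split=> [c|d]; first by have [d hd] := h1 c; exists d; exact: IH.
  by have [c hc] := h2 d; exists c; exact: IH.
move=> n u v e uv e' ee'; have [|h1 h2] := st n u v e _ e' ee'.
  by apply: bfle_weaken uv.
split=> [c|d]; first by have [d hd] := h1 c; exists d; exact: up.
by have [c hc] := h2 d; exists c; exact: up.
Qed.

(** Tuples are carried along the isomorphism at distance zero at every rank, so replies found inside
    [A] can be carried to [B] without loss. *)
Lemma stable_transfer (A B : structure L) (beta : W) : inhabited A -> isomorphic A B ->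
  (forall n (u v : nat -> A) e, bfle Om beta n u v e -> zigzag Om beta n u v e) ->
  forall n (u : nat -> A) (v : nat -> B) e, bfle Om beta n u v e -> zigzag Om beta n u v e.
Proof.
move=> iA [f [bf fF fP]] st n u v e uv; have [g fg gf] := bf.
have iB : inhabited B by case: iA => x; split; exact: f x.
have vE : v = f \o (g \o v) by apply/funext => p /=; rewrite gf.
have fle m (w : nat -> A) : bfle Om beta m w (f \o w) 0 := bfle_iso beta m w gOm iA bf fF fP.
have /st h : bfle Om beta n u (g \o v) e.
  rewrite -[e]addr0; apply: (bfle_trans gOm iA iB iA uv).
  by apply: bfle_sym => //; have := fle n (g \o v); rewrite -vE.
move=> e' /h[h1 h2]; split=> [c|d].
  have [d hd] := h1 c; exists (f d); rewrite -[e']addr0.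
  by apply: (bfle_trans gOm iA iA iB hd); have := fle n.+1 (upd (g \o v) n d); rewrite comp_upd -vE.
have [c hc] := h2 (g d); exists c; rewrite -[e']addr0.
apply: (bfle_trans gOm iA iA iB hc); rewrite -comp_upd.
have := fle n.+1 (g \o upd v n d).
by rewrite (_ : f \o _ = upd v n d)//; apply/funext => p /=; rewrite gf.
Qed.

End index_game.

(** * A countable criterion for isomorphism *)

Section characterization.
Context {R : realType} {L : signature R} (Om : (nat -> R) -> \bar R).
Hypothesis OmU : universal_weak_modulus L Om.
Context (W : wellOrder) (beta : W).
Let gOm := universal_gauge OmU.
Implicit Types (A B : structure L).

(* The errors 2 - 1/(n+1) increase with the length and start at 1, so that the game
   can be played forever with errors bounded by 2. *)
Definition back_forth_condition A B (a : nat -> A) (b : nat -> B) : Prop :=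
  bfle Om beta 0 a b 1 /\ forall (i j : seq nat) n,
  bfle Om beta n (a \o nth 0%N i) (b \o nth 0%N j) (2 - n.+1%:R^-1) ->
  index_zigzag Om beta n a b (nth 0%N i) (nth 0%N j) (2 - n.+1%:R^-1).

Lemma back_forth_isomorphic A B (a : nat -> A) (b : nat -> B) :
  tail_dense a -> tail_dense b -> back_forth_condition a b -> isomorphic A B.
Proof.
move=> ta tb [ab game].
have iA : inhabited A by split; exact: a 0%N.
have iB : inhabited B by split; exact: b 0%N.
pose good (s : seq nat * seq nat) := size s.1 = size s.2 /\
  bfle Om beta (size s.1) (a \o nth 0%N s.1) (b \o nth 0%N s.2) (2 - (size s.1).+1%:R^-1).
have upd_nth (s : seq nat) k p : (p < (size s).+1)%N ->
    upd (nth 0%N s) (size s) k p = nth 0%N (rcons s k) p.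
  rewrite /upd nth_rcons ltnS leq_eqVlt => /orP[/eqP->|->] //; by rewrite ltnn eqxx.
have /choice[f fP] (s : seq nat * seq nat) : exists kl : nat * nat, good s ->
    good (rcons s.1 kl.1, rcons s.2 kl.2) /\
    if odd (size s.1) then kl.2 = (size s.1)./2 else kl.1 = (size s.1)./2.
  have [[sz gs]|ngs] := pselect (good s); last by exists (0, 0)%N.
  set n := size s.1; have n0 : 0 < n.+1%:R^-1 - n.+2%:R^-1 :> R.
    by rewrite subr_gt0 ltf_pV2 ?posrE// ltr_nat.
  (* The gap between consecutive errors absorbs the slack $1/(r+1)$ of one move. *)
  have [r /(_ r (leqnn r)) rP] := inv_natS_small n0.
  have [h1 h2] := game s.1 s.2 n gs r.
  have done k l : bfle Om beta n.+1 (a \o upd (nth 0%N s.1) n k) (b \o upd (nth 0%N s.2) n l)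
      (2 - n.+1%:R^-1 + r.+1%:R^-1) -> good (rcons s.1 k, rcons s.2 l).
    move=> h; rewrite /good /= !size_rcons sz; split=> //.
    rewrite -sz -/n; apply: (@bfle_congr _ _ _ _ _ _ _ _ (a \o upd (nth 0%N s.1) n k) _
      (b \o upd (nth 0%N s.2) n l)).
    - by move=> p pn /=; rewrite /n upd_nth.
    - by move=> p pn /=; rewrite /n sz upd_nth// -sz.
    apply: bfle_weaken h => //; move: rP.
    move: (r.+1%:R^-1) (n.+1%:R^-1) (n.+2%:R^-1) => x y z ?; lra.
  case: (boolP (odd n)) => on.
    by have [k /done hk] := h2 n./2; exists (k, n./2).
  by have [l /done hl] := h1 n./2; exists (n./2, l).
pose next s := (rcons s.1 (f s).1, rcons s.2 (f s).2).
pose s n := iter n next ([::], [::]).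
have sg n : good (s n) /\ size (s n).1 = n.
  elim: n => [|n [gn sn]].
    split=> //; split=> //=; apply: bfle_congr; last by apply: bfle_weaken ab => //; rewrite invr1; lra.
      by [].
    by [].
  by split; [exact: (fP _ gn).1|rewrite /= size_rcons sn].
pose i n := (f (s n)).1; pose j n := (f (s n)).2.
have sE n p : (p < n)%N -> nth 0%N (s n).1 p = i p /\ nth 0%N (s n).2 p = j p.
  elim: n => // n IH; have [[sz _] sn] := sg n.
  rewrite ltnS leq_eqVlt /= !nth_rcons -sz sn => /orP[/eqP->|pn].
    by rewrite ltnn eqxx.
  by rewrite pn; exact: IH.
have book n : if odd n then j n = n./2 else i n = n./2.
  by have [gn sn] := sg n; have := (fP _ gn).2; rewrite sn.
apply: (interleaved_isomorphic OmU (C := 2) ta tb book).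
move=> n; have [[_ gn] sn] := sg n; rewrite sn in gn.
have : bfle Om beta n (a \o i) (b \o j) 2.
  apply: bfle_congr (bfle_weaken gOm iA iB (lexx _) _ gn).
  - by move=> p /sE[h _] /=; rewrite h.
  - by move=> p /sE[_ h] /=; rewrite h.
  - by rewrite lerBlDr lerDl ltW// inv_natS_gt0.
by move=> /(bfleP _ _ _ _ _ gOm iA iB)[].
Qed.

Lemma isomorphic_back_forth A B (a : nat -> A) (b : nat -> B) :
  tail_dense a -> tail_dense b ->
  (forall n (u v : nat -> A) e, bfle Om beta n u v e -> zigzag Om beta n u v e) ->
  isomorphic A B -> back_forth_condition a b.
Proof.
move=> ta tb st AB.
have iA : inhabited A by split; exact: a 0%N.
have iB : inhabited B by split; exact: b 0%N.
split.
  have [f [bf fF fP]] := AB.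
  apply: bfle_congr (bfle_weaken gOm iA iB (lexx beta) ler01 (bfle_iso beta 0 a gOm iA bf fF fP)) => //.
move=> i j n h; apply/(zigzag_index gOm) => //.
exact: (stable_transfer gOm iA AB st).
Qed.

End characterization.

(** * Borel complexity of the back-and-forth distances *)

Section definable.
Context {R : realType} {L : signature R} (L_countable : countable_signature L).
Context (X : set (code_space L)).
Context (Om : (nat -> R) -> \bar R) (OmU : universal_weak_modulus L Om).
Let gOm := universal_gauge OmU.

Definition pair_predicate : Type :=
  forall A : structure L, (nat -> A) -> forall B : structure L, (nat -> B) -> Prop.

(** On codes from [X] the truth value must depend on the codes alone. Borel sets can then be
    obtained from formulas by closure properties. *)
Definition borel_predicate (Q : pair_predicate) : Prop :=
  exists2 S, borel_in (X `*` X) S & forall p q, X p -> X q ->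
  forall A a B b, codes p a -> codes q b -> S (p, q) <-> Q A a B b.

Lemma borel_in_sigma (T : topologicalType) (D : set T) : sigma_algebra D (borel_in D).
Proof. exact: smallest_sigma_algebra. Qed.

Lemma borel_predicate_ext (Q Q' : pair_predicate) :
  (forall A a B b, tail_dense a -> tail_dense b -> Q A a B b <-> Q' A a B b) ->
  borel_predicate Q -> borel_predicate Q'.
Proof.
move=> QQ [S bS SQ]; exists S => // p q Xp Xq A a B b ca cb.
apply: iff_trans (SQ p q Xp Xq A a B b ca cb) _.
by have [_ ta _] := ca; have [_ tb _] := cb; exact: QQ.
Qed.

Lemma borel_predicate_not (Q : pair_predicate) : borel_predicate Q ->
  borel_predicate (fun A a B b => ~ Q A a B b).
Proof.
move=> [S bS SQ]; have [_ cS _] := borel_in_sigma (X `*` X).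
exists (X `*` X `\` S); first exact: cS.
move=> p q Xp Xq A a B b ca cb; have := SQ p q Xp Xq A a B b ca cb => -[h1 h2].
by split=> [[_ nS] /h2|nQ]//; split=> // /h1.
Qed.

Lemma borel_predicate_true (P : Prop) : borel_predicate (fun _ _ _ _ => P).
Proof.
have [S0 cS _] := borel_in_sigma (X `*` X); have [p|np] := pselect P.
  exists (X `*` X `\` set0); first exact: cS.
  by move=> p' q Xp Xq A a B b _ _; split=> // _; split.
by exists set0.
Qed.

Lemma borel_predicate_ex (T : countType) (Q : T -> pair_predicate) :
  (forall t, borel_predicate (Q t)) -> borel_predicate (fun A a B b => exists t, Q t A a B b).
Proof.
move=> QB; have [S0 _ US] := borel_in_sigma (X `*` X).
have /choice[S SP] n : exists S, borel_in (X `*` X) S /\ forall p q, X p -> X q ->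
    forall A a B b, codes p a -> codes q b -> S (p, q) <-> exists2 t, unpickle n = Some t & Q t A a B b.
  case E : (unpickle n) => [t|].
    have [S bS SQ] := QB t; exists S; split=> // p q Xp Xq A a B b ca cb.
    apply: iff_trans (SQ p q Xp Xq A a B b ca cb) _; split=> [h|[_ [<-]]//].
    by exists t.
  by exists set0; split=> // p q Xp Xq A a B b ca cb; split=> // -[].
exists (\bigcup_n S n); first by apply: US => n; exact: (SP n).1.
move=> p q Xp Xq A a B b ca cb; split=> [[n _ /((SP n).2 _ _ Xp Xq _ _ _ _ ca cb)[t _ ?]]|[t Qt]].
  by exists t.
by exists (pickle t) => //; apply/((SP _).2 _ _ Xp Xq _ _ _ _ ca cb); exists t => //; rewrite pickleK.
Qed.

Lemma borel_predicate_all (T : countType) (Q : T -> pair_predicate) :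
  (forall t, borel_predicate (Q t)) -> borel_predicate (fun A a B b => forall t, Q t A a B b).
Proof.
move=> QB; have := borel_predicate_not (borel_predicate_ex (fun t => borel_predicate_not (QB t))).
apply: borel_predicate_ext => A a B b _ _; split=> [H t|H [t]]; last exact.
by apply: contrapT => nQ; apply: H; exists t.
Qed.

Lemma borel_predicate_and (Q Q' : pair_predicate) : borel_predicate Q -> borel_predicate Q' ->
  borel_predicate (fun A a B b => Q A a B b /\ Q' A a B b).
Proof.
move=> bQ bQ'; have := @borel_predicate_all bool (fun t => if t then Q else Q') _.
case=> [[]//|S bS SQ]; move: (ex_intro2 _ _ S bS SQ : borel_predicate _).
apply: borel_predicate_ext => A a B b _ _; split=> [H|[h h'] []//].
by split; [exact: (H true)|exact: (H false)].
Qed.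

Lemma borel_predicate_imply (Q Q' : pair_predicate) : borel_predicate Q -> borel_predicate Q' ->
  borel_predicate (fun A a B b => Q A a B b -> Q' A a B b).
Proof.
move=> bQ bQ'; have := borel_predicate_not (borel_predicate_and bQ (borel_predicate_not bQ')).
apply: borel_predicate_ext => A a B b _ _; split=> [H q|H [q nq]]; last exact: nq (H q).
by apply: contrapT => nq; apply: H.
Qed.

Lemma near_code_nbhs (en : nat -> coordinate (L := L)) K (eta : R) p : 0 < eta ->
  nbhs p [set q | near_code en K eta p q].
Proof.
move=> eta0; elim: K => [|K IH]; first by apply: (@filterE _ (nbhs p) (nbhs_filter p)) => q i.
have h : nbhs p [set q | `|cval (en K) q - cval (en K) p| < eta].
  have := @cval_continuous _ _ (en K) p _ (nbhsx_ballx (cval (en K) p) eta eta0).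
  apply: (@filterS _ (nbhs p) (nbhs_filter p)) => q.
  by rewrite /ball /= distrC.
apply: (@filterS _ (nbhs p) (nbhs_filter p) _ _ _ (@filterI _ (nbhs p) (nbhs_filter p) _ _ IH h)) => q [h1 h2] i; rewrite ltnS leq_eqVlt => /orP[/eqP->//|].
exact: h1.
Qed.

(** The formulas are uncountable in number, but one that separates two tuples still separates them
    near their codes; hence the negation is relatively open. *)
Lemma borel_predicate_bf0le n (i j : nat -> nat) (e : R) :
  borel_predicate (fun A a B b => bf0le Om n (a \o i) (b \o j) e).
Proof.
have [en en_surj] := coord_countable L_countable.
pose far (V : set (code_space L * code_space L)) := open V /\
  forall p q, V (p, q) -> forall (A : structure L) (a : nat -> A) (B : structure L) (b : nat -> B), codes p a -> codes q b ->
  ~ bf0le Om n (a \o i) (b \o j) e.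
pose U := \bigcup_(V in far) V.
have oU : open U by apply: bigcup_open => V [].
have : borel_predicate (fun A a B b => ~ bf0le Om n (a \o i) (b \o j) e).
  exists (X `*` X `&` U); first by apply: sub_sigma_algebra; exists U.
  move=> p q Xp Xq A a B b ca cb; split=> [[_ [V [_ VP] Vpq]]|H]; first exact: VP Vpq _ _ _ _ ca cb.
  split=> //; have [_ ta pE] := ca; have [_ tb qE] := cb.
  have [phi [rphi lt]] : exists phi : basic L n, respects Om phi /\
      e < `|basic_eval phi (restr n (a \o i)) - basic_eval phi (restr n (b \o j))|.
    apply: contrapT => nex; apply: H => phi rphi; rewrite leNgt; apply/negP => lt.
    by apply: nex; exists phi.
  have a_dense := tail_dense_near ta.
  have b_dense := tail_dense_near tb.
  set z := `|_ - _| in lt; have d0 : 0 < (z - e) / 2 by rewrite divr_gt0// subr_gt0.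
  have [K [eta eta0 h]] := basic_near en_surj a_dense phi i d0.
  have [K' [eta' eta'0 h']] := basic_near en_surj b_dense phi j d0.
  have nV : nbhs (p, q) [set pq | near_code en K eta p pq.1 /\ near_code en K' eta' q pq.2].
    exists ([set q' | near_code en K eta p q'], [set q' | near_code en K' eta' q q']).
      by split; exact: near_code_nbhs.
    by move=> [p' q'] [].
  exists (interior [set pq | near_code en K eta p pq.1 /\ near_code en K' eta' q pq.2]) => //.
  split; first exact: open_interior.
  move=> p' q' /interior_subset[/= np nq] A' a' B' b' [_ _ pE'] [_ _ qE'] hle.
  rewrite pE pE' in np; rewrite qE qE' in nq.
  have := h _ _ np; have := h' _ _ nq; have := hle phi rphi.
  set x' := basic_eval _ _; set y' := basic_eval _ _.
  have : z <= `|x' - y'| + (`|y' - basic_eval phi (restr n (b \o j))| +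
      `|x' - basic_eval phi (restr n (a \o i))|).
    rewrite /z; set x := basic_eval _ _; set y := basic_eval _ _.
    rewrite (_ : x - y = (x' - y') + ((y' - y) - (x' - x))); last by lra.
    by apply: le_trans (ler_normD _ _) _; rewrite lerD2l ler_normB.
  move: lt d0; clear h h'; move: z => z lt d0; move: `|_ - _| `|_ - _| `|_ - _| => t1 t2 t3; lra.
move=> /borel_predicate_not; apply: borel_predicate_ext => A a B b _ _.
by split=> [/contrapT|h nh] //; exact: nh h.
Qed.

(** With countably many ranks below [beta] and moves among indices, the recursion of [bfleP]
    consists of countable Boolean operations. *)
Lemma borel_predicate_bfle (W : wellOrder) (beta g : W) n (i j : nat -> nat) (e : R) :
  countable_ordinal beta -> (g <= beta)%O ->
  borel_predicate (fun A a B b => bfle Om g n (a \o i) (b \o j) e).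
Proof.
move=> cbeta; elim/(well_founded_ind (@wo_wf W)): g n i j e => g IH n i j e gbeta.
have [f fP] := ordinal_enum cbeta.
apply: (@borel_predicate_ext (fun A a B b => 0 <= e /\ (bf0le Om n (a \o i) (b \o j) e /\
  forall m : nat, (f m < g)%O -> index_zigzag Om (f m) n a b i j e))).
  move=> A a B b ta tb.
  have iA : inhabited A by split; exact: a 0%N.
  have iB : inhabited B by split; exact: b 0%N.
  split=> [[e0 [h0 h]]|/bfleP[]// e0 h0 h].
    apply/bfleP => //; split=> // g' g'g; apply/(zigzag_index gOm) => //.
    have [m fm] := fP g' (lt_le_trans g'g gbeta); rewrite -fm in g'g *; exact: h.
  by split=> //; split=> // m /h/(zigzag_index gOm); exact.
apply: borel_predicate_and; first exact: borel_predicate_true.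
apply: borel_predicate_and; first exact: borel_predicate_bf0le.
apply: borel_predicate_all => m; have [fmg|nfmg] := pselect (f m < g)%O; last first.
  by apply: borel_predicate_ext (borel_predicate_true True) => A a B b _ _; split.
apply: borel_predicate_imply; first exact: borel_predicate_true.
apply: borel_predicate_all => r; apply: borel_predicate_and;
  apply: borel_predicate_all => k; apply: borel_predicate_ex => l;
  exact: IH fmg _ _ _ _ (ltW (lt_le_trans fmg gbeta)).
Qed.

Lemma borel_predicate_back_forth (W : wellOrder) (beta : W) : countable_ordinal beta ->
  borel_predicate (fun A a B b => back_forth_condition Om beta a b).
Proof.
move=> cbeta; have bP n i j e := borel_predicate_bfle n i j e cbeta (lexx beta).
apply: borel_predicate_and; first exact: bP 0%N id id 1.
apply: borel_predicate_all => i; apply: borel_predicate_all => j.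
apply: borel_predicate_all => n; apply: borel_predicate_imply; first exact: bP.
by apply: borel_predicate_all => r; apply: borel_predicate_and;
  apply: borel_predicate_all => k; apply: borel_predicate_ex => l; exact: bP.
Qed.

End definable.

Lemma borel_of_bounded (R : realType) (L : signature R) (L_countable : countable_signature L)
    (X : set (code_space L)) (X_borel : borel_in (structure_space L) X)
    (Om : (nat -> R) -> \bar R) (OmU : universal_weak_modulus L Om) :
  scott_ranks_bounded Om X -> borel_in (X `*` X) (iso_on X).
Proof.
move=> [W [beta [cbeta rank]]]; have [en en_surj] := coord_countable L_countable.
have [X' _ XE] := borel_in_bisouslin (ev1_basis en_surj) X_borel.
have [S bS SP] := borel_predicate_back_forth L_countable X OmU cbeta.
have [S' _ SE] := borel_in_bisouslin (ev2_basis en_surj) bS.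
have gOm := universal_gauge OmU.
rewrite (_ : iso_on X = S)//; apply/seteqP.
have charac p q (A : structure L) (a : nat -> A) (B : structure L) (b : nat -> B) : X p -> X q -> codes p a -> codes q b ->
    S (p, q) <-> isomorphic A B.
  move=> Xp Xq ca cb; apply: iff_trans (SP p q Xp Xq A a B b ca cb) _.
  have [_ ta _] := ca; have [_ tb _] := cb.
  split; first exact: (back_forth_isomorphic OmU ta tb).
  apply: isomorphic_back_forth => //; have [alpha [st _] ab] := rank p Xp A a ca.
  have iA : inhabited A by split; exact: a 0%N.
  exact: (stable_above gOm iA ab st).
have coded p : X p -> structure_space L p by rewrite XE => -[].
(* Membership of [S] in the Borel sets of [X * X] confines it to pairs from [X], which the converse
   inclusion uses. *)
split=> -[p q].
  by move=> [/= Xp Xq [A [a [B [b [ca cb AB]]]]]]; apply/(charac p q A a B b).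
move=> Spq; have [Xp Xq] : X p /\ X q by move: Spq; rewrite SE => -[].
split=> //=; have [A [a ca]] := coded p Xp; have [B [b cb]] := coded q Xq.
by exists A, a, B, b; split=> //; apply/(charac p q A a B b Xp Xq ca cb).
Qed.

Theorem theorem1p3 (R : realType) (L : signature R)
    (L_countable : countable_signature L)
    (X : set (code_space L)) (X_borel : borel_in (structure_space L) X)
    (X_invariant : iso_invariant X)
    (Omega : (nat -> R) -> \bar R)
    (Omega_universal : universal_weak_modulus L Omega) :
  borel_in (X `*` X) (iso_on X) <-> scott_ranks_bounded Omega X.
Proof. by split; [exact: bounded_of_borel|exact: borel_of_bounded]. Qed.
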